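(* Let $s,t\ge 6$ be integers with $t$ even and $(s,t)\neq(6,6)$, put $S=s-4$, $T=t-4$, and let $$P=\frac{T+\sqrt{T^2+8ST}}{4}.$$ Let $X$ be an $(s,t)$-uniform simplicial complex. For spheres $S_n^{s,t}$ centered at an $s$-vertex of the disc of a minimal filling diagram associated to a loop of $X$, $$\lim_{n\to\infty}K_{Avg}(S_n^{s,t})=2-\frac{T+\sqrt{T^2+8ST}}{4}=2-P.$$ Explicitly: for every $\varepsilon>0$ there is $N\ge 1$ such that for every loop $\gamma$ of $X$, every minimal filling diagram $(D,f)$ for $\gamma$, every $s$-vertex $v$ of $D$, and every $n\ge N$ for which the sphere of radius $n$ centered at $v$ is complete in $D$, one has $\big|K_{Avg}(S_n^{s,t})-(2-P)\big|<\varepsilon$, where $S_n^{s,t}$ is the sphere of radius $n$ in $D$ centered at $v$.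
   Context: Simplicial complexes. A simplicial complex is flag if any finite set of pairwise adjacent vertices spans a simplex. A loop (cycle) $\gamma$ in $X$ is a subcomplex isomorphic to a triangulation of $S^1$; it is a full cycle if every simplex of $X$ spanned by vertices of $\gamma$ is a simplex of $\gamma$. A simplicial map sends vertices to vertices, and sends each simplex onto the simplex spanned by the images of its vertices. Filling diagrams. A filling diagram for a loop $\gamma$ in $X$ is a simplicial map $f:D\to X$, where $D$ is a triangulated $2$-disc and $f|_{\partial D}$ maps $\partial D$ isomorphically onto $\gamma$. It is denoted $(D,f)$, and it is minimal if $D$ has the least possible number of triangles among all filling diagrams for $\gamma$. Interior vertices of $D$ are those not on $\partial D$; boundary vertices are those on $\partial D$. $(s,t)$-uniformness. A $k$-vertex of $D$ is an interior vertex with exactly $k$ neighbours. A flag, simply connected simplicial complex $X$ is $(s,t)$-uniform if the following holds. (1) If $s\ne t$: for every loop $\gamma$ in $X$ and every minimal filling diagram $(D,f)$ for $\gamma$, every interior vertex $u$ of $D$ is an $s$-vertex or a $t$-vertex; moreover (a) if $u$ is an $s$-vertex, each of its neighbours is a $t$-vertex or a boundary vertex; (b) if $u$ is a $t$-vertex, its neighbours form a full cycle $(u_1,\dots,u_t)$ whose vertices at odd indices are $t$-vertices or boundary vertices and whose vertices at even indices are $s$-vertices or boundary vertices. (2) If $s=t$: $X$ is $t$-uniform, i.e. in every minimal filling diagram for every loop every interior vertex has exactly $t$ neighbours (so every interior vertex has $s=t$ neighbours and can serve as the center $v$). Spheres. Distances between vertices of $D$ are measured by the number of edges in a shortest path in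 the $1$-skeleton of $D$. For an interior vertex $v$ of $D$, the sphere $S_n^{s,t}$ of radius $n\ge 0$ centered at $v$ is the set of edges of $D$ both of whose endpoints are at distance $n$ from $v$. The vertices inside $S_n^{s,t}$ are the vertices of $D$ at distance at most $n-1$ from $v$ (including $v$). The sphere of radius $n$ centered at $v$ is complete in $D$ if all vertices of $D$ at distance at most $n$ from $v$ are interior vertices of $D$. Curvature. The Gaussian curvature at an interior vertex $u$ of $D$ is $K(u)=6-\chi(u)$, where $\chi(u)$ is the number of triangles of $D$ containing $u$; thus $K(u)=6-s$ at an $s$-vertex and $K(u)=6-t$ at a $t$-vertex. For $n\ge 1$, $K(S_n^{s,t})$ is the sum of $K(u)$ over all vertices $u$ inside $S_n^{s,t}$, and $K_{Avg}(S_n^{s,t})$ is $K(S_n^{s,t})$ divided by the number of vertices inside $S_n^{s,t}$. *)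

(* Defs.v *)
From HB Require Import structures.
From mathcomp Require Import all_boot all_order all_algebra finmap.
From mathcomp Require Import all_classical all_reals all_analysis.
Import Order.TTheory GRing.Theory Num.Theory numFieldNormedType.Exports.

Set Implicit Arguments.
Unset Strict Implicit.
Unset Printing Implicit Defensive.

Local Open Scope classical_set_scope.
Local Open Scope fset_scope.
Local Open Scope ring_scope.

(* Abstract simplicial complexes with vertex set exactly V: simplices are
   nonempty finite sets, and every element of V is a vertex. *)
Record scomplex (V : choiceType) := SComplex {
  simplex :> {fset V} -> bool;
  simplex0 : ~~ simplex fset0;
  simplex1 : forall v, simplex [fset v];
  simplexS : forall A B : {fset V},
    simplex B -> A `<=` B -> A != fset0 -> simplex A }.

Section Complexes.
Variables (V : choiceType) (K : scomplex V).

Definition adj : rel V := fun x y => (x != y) && K [fset x; y].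

Definition triangle (A : {fset V}) : bool := K A && (#|` A| == 3)%N.

Definition flag : Prop := forall A : {fset V}, A != fset0 ->
  (forall x y, x \in A -> y \in A -> x != y -> adj x y) -> K A.

(* The simplices of the polygon with cyclic vertex list c, resp. of the arc
   with vertex list p; meaningful when c (resp. p) is duplicate-free, and a
   polygon needs at least three vertices. *)
Definition cycle_complex (c : seq V) : set {fset V} :=
  [set A | exists2 x, x \in c & A = [fset x] \/ A = [fset x; next c x]].

Definition arc_complex (p : seq V) : set {fset V} :=
  [set A | (exists2 x, x \in p & A = [fset x]) \/
           (exists p1 p2 x y, p = p1 ++ [:: x, y & p2] /\ A = [fset x; y])].

(* Subcomplexes are given by their sets of simplices. *)
Definition is_loop (G : set {fset V}) : Prop :=
  (forall A, G A -> K A) /\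
  exists c : seq V, [/\ uniq c, (3 <= size c)%N & G = cycle_complex c].

Definition full_cycle (c : seq V) : Prop :=
  [/\ uniq c, (3 <= size c)%N,
      forall A, cycle_complex c A -> K A &
      forall A, K A -> (forall x, x \in A -> x \in c) -> cycle_complex c A].

Definition link (v : V) : set {fset V} :=
  [set A | [/\ A != fset0, v \notin A & K (v |` A)]].

Definition triangulated_surface : Prop := forall v,
  (exists c : seq V,
     [/\ uniq c, (3 <= size c)%N & link v = cycle_complex c]) \/
  (exists p : seq V,
     [/\ uniq p, (2 <= size p)%N & link v = arc_complex p]).

End Complexes.

Section Realization.
Variables (R : realType) (V : choiceType) (K : scomplex V).

Definition in_cell (A : {fset V}) (x : V -> R) : Prop :=
  [/\ forall v, 0 <= x v, forall v, v \notin A -> x v = 0 &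
      \sum_(v <- A) x v = 1].

(* The geometric realization, in barycentric coordinates. *)
Record realization := Realization {
  bary :> V -> R;
  baryP : exists2 A, K A & in_cell A bary }.

HB.instance Definition _ := gen_eqMixin realization.
HB.instance Definition _ := gen_choiceMixin realization.

(* Coherent (weak) topology: U is open iff its trace on every closed simplex
   is open for the metric topology of that simplex. *)
Definition realization_open : set_system realization := [set U |
  forall A, K A -> forall x : realization, in_cell A x -> U x ->
  exists2 e : R, 0 < e & forall y : realization, in_cell A y ->
    (forall v, v \in A -> `|x v - y v| < e) -> U y].

Let openT : realization_open setT.
Proof. by move=> A KA x xA _; exists 1. Qed.

Let openI : setI_closed realization_open.
Proof.
move=> U1 U2 o1 o2 A KA x xA [x1 x2].
have [e1 e1p h1] := o1 A KA x xA x1; have [e2 e2p h2] := o2 A KA x xA x2.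
exists (Num.min e1 e2); first by rewrite lt_min e1p e2p.
by move=> y yA h; split; [apply: h1|apply: h2] => // v vA;
  move: (h v vA); rewrite lt_min => /andP[].
Qed.

Let openU (I : Type) (f : I -> set realization) :
  (forall i, realization_open (f i)) -> realization_open (\bigcup_i f i).
Proof.
move=> fo A KA x xA [i _ fx]; have [e ep h] := fo i A KA x xA fx.
by exists e => // y yA hy; exists i => //; apply: h.
Qed.

HB.instance Definition _ :=
  @isOpenTopological.Build realization realization_open openT openI openU.

End Realization.

Definition simply_connected (R : realType) (T : topologicalType) : Prop :=
  (forall x y : T, exists p : R -> T,
     [/\ {within `[0, 1], continuous p}, p 0 = x & p 1 = y]) /\
  (forall p : R -> T, {within `[0, 1], continuous p} -> p 0 = p 1 ->
   exists H : R * R -> T,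
     [/\ {within (`[0, 1] `*` `[0, 1])%classic, continuous H},
         forall x, x \in `[0, 1] -> H (x, 0) = p x,
         forall x, x \in `[0, 1] -> H (x, 1) = p 0 &
         forall y, y \in `[0, 1] -> H (0, y) = p 0 /\ H (1, y) = p 0]).

Definition closed_disc (R : realType) : set (R * R) :=
  [set z | z.1 ^+ 2 + z.2 ^+ 2 <= 1].

Definition homeomorphic_to_set (T S : topologicalType) (A : set S) : Prop :=
  exists (phi : T -> S) (psi : S -> T),
    [/\ continuous phi, {within A, continuous psi}, forall x, A (phi x),
        cancel phi psi & forall z, A z -> phi (psi z) = z].

(* The combinatorial-manifold condition, which every triangulation of the disc
   satisfies, is what gives the combinatorial boundary below its meaning. *)
Definition triangulated_disc (R : realType) (W : finType) (D : scomplex W) :=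
  triangulated_surface D /\
  homeomorphic_to_set (realization R D) (@closed_disc R).

Section Discs.
Variables (W : finType) (D : scomplex W).

Definition num_triangles : nat := #|[pred A : {fset W} | triangle D A]|.

Definition boundary_edge (A : {fset W}) : bool :=
  [&& D A, #|` A| == 2 &
      #|[pred B : {fset W} | triangle D B && (A `<=` B)]| == 1]%N.

Definition boundary_simplex : set {fset W} :=
  [set A | A != fset0 /\ exists2 B, boundary_edge B & A `<=` B].

Definition boundary_vertex (u : W) : Prop := boundary_simplex [fset u].
Definition interior_vertex (u : W) : Prop := ~ boundary_vertex u.

Definition k_vertex (k : nat) (u : W) : Prop :=
  interior_vertex u /\ #|[pred w | adj D u w]| = k.

Definition walk (n : nat) (u v : W) : bool :=
  [exists p : n.-tuple W, path (adj D) u p && (last u p == v)].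

(* The least length of a path from u to v; a shortest path has fewer than
   #|W| edges, and the value is #|W| if there is no path at all. *)
Definition dist (u v : W) : nat :=
  find (fun n => walk n u v) (iota 0 #|W|).

(* The sphere of radius n centered at v is represented by the pair (v, n). *)
Definition inside_sphere (v : W) (n : nat) : pred W :=
  [pred u | (dist v u < n)%N].

Definition sphere_complete (v : W) (n : nat) : Prop :=
  forall u, (dist v u <= n)%N -> interior_vertex u.

Variable R : realType.

Definition curvature (u : W) : R :=
  6 - #|[pred A : {fset W} | triangle D A && (u \in A)]|%:R.

Definition sphere_curvature (v : W) (n : nat) : R :=
  \sum_(u | inside_sphere v n u) curvature u.

Definition sphere_avg_curvature (v : W) (n : nat) : R :=
  sphere_curvature v n / #|inside_sphere v n|%:R.

End Discs.

Section Fillings.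
Variables (R : realType) (V : choiceType) (X : scomplex V).

Definition simplicial_map (W : choiceType) (D : scomplex W) (f : W -> V) :=
  forall A : {fset W}, D A -> X [fset f x | x in A].

Definition filling_diagram (G : set {fset V}) (W : finType) (D : scomplex W)
    (f : W -> V) : Prop :=
  [/\ triangulated_disc R D, simplicial_map D f,
      forall x y, boundary_vertex D x -> boundary_vertex D y ->
        f x = f y -> x = y &
      G = [set [fset f x | x in A] | A in boundary_simplex D]].

Definition minimal_filling (G : set {fset V}) (W : finType) (D : scomplex W)
    (f : W -> V) : Prop :=
  filling_diagram G D f /\
  forall (W' : finType) (D' : scomplex W') (f' : W' -> V),
    filling_diagram G D' f' -> (num_triangles D <= num_triangles D')%N.

(* The list c = [:: u_1; ...; u_t] is 0-based: odd positions of the cyclic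
   labelling u_1, ..., u_t are the even indices of c. *)
Definition st_interior_vertex (s t : nat) (W : finType) (D : scomplex W)
    (u : W) : Prop :=
  [/\ k_vertex D s u \/ k_vertex D t u,
      k_vertex D s u ->
        forall w, adj D u w -> k_vertex D t w \/ boundary_vertex D w &
      k_vertex D t u -> exists c : seq W,
        [/\ size c = t, c =i [pred w | adj D u w], full_cycle D c,
            forall i, (i < t)%N -> ~~ odd i ->
              k_vertex D t (nth u c i) \/ boundary_vertex D (nth u c i) &
            forall i, (i < t)%N -> odd i ->
              k_vertex D s (nth u c i) \/ boundary_vertex D (nth u c i)]].

Definition st_uniform (s t : nat) : Prop :=
  [/\ flag X, simply_connected R (realization R X) &
      forall (G : set {fset V}) (W : finType) (D : scomplex W) (f : W -> V),
        is_loop X G -> minimal_filling G D f ->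
        forall u, interior_vertex D u ->
          (s <> t -> st_interior_vertex s t D u) /\
          (s = t -> k_vertex D t u)].

End Fillings.

Definition Pst (R : realType) (s t : nat) : R :=
  let S : R := s%:R - 4 in
  let T : R := t%:R - 4 in
  (T + Num.sqrt (T ^+ 2 + 8 * S * T)) / 4.

(* Main.v *)
(** The disc [D] is acyclic: a potential for a 1-cocycle is obtained by pulling it back to a fine
    grid on a square that retracts onto the disc.  Over F_2, duality then makes every simple
    closed edge path the boundary of a set of triangles, and the Euler characteristic of that
    region gives a Gauss-Bonnet inequality, interior vertices having degree at least 6.  Pushing
    geodesics across the region shows that adjacent vertices at the same distance from the
    centre have a common parent and that two parents of a vertex are adjacent; hence
    every vertex of a sphere has two neighbours in the sphere, and every edge of the sphere spans one
    triangle with each of the two neighbouring spheres.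

    If s = t, all curvatures agree.  Otherwise every triangle has exactly one s-vertex.  Counting triangles at the [a_k] s-vertices and
    [b_k] t-vertices of the k-th sphere gives, with S = s - 4, T = t - 4 and h_k = b_k - a_k,
    a_(k+1) + a_(k-1) = (T/2) b_k and h_(k+1) + h_(k-1) = S a_k.  The combination
    2 P a_k + T h_k obeys y_(k+1) = P y_k - y_(k-1), and S a_k + T b_k - P (a_k + b_k), the
    deviation from the average P, obeys the recursion with T/2 - P, of smaller growth rate. *)

Require Import Defs.
From HB Require Import structures.
From mathcomp Require Import all_boot all_order all_algebra finmap.
From mathcomp Require Import all_classical all_reals all_analysis.
(* [fintype] and [finset] again: [classical_sets] shadows their lemmas. *)
From mathcomp Require Import fintype finset finmap perm zify ring lra.
Import Order.TTheory GRing.Theory Num.Theory numFieldNormedType.Exports.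

Set Implicit Arguments.
Unset Strict Implicit.
Unset Printing Implicit Defensive.

Local Open Scope ring_scope.

(** * First cohomology of a triangulated disc *)

(** The hypothesis on the disc is topological and the conclusion is a count, so the obstacle is to
    extract just enough topology. No Jordan curve theorem enters: the region bounded by a closed
    edge path is only a mod-2 chain of triangles, which is never shown to be a disc. It inherits the
    vanishing of H^1 from the whole disc, and this bounds its Euler characteristic below by 1, the
    direction in which Gauss-Bonnet is applied.

    The bound N can be chosen before the diagram because the recursions and the counts on the first
    sphere determine every a_k and b_k in a complete ball: the average depends on s, t and n only.

    The number P is the positive root of 2 x^2 = T (x + S), the characteristic equation of the
    matrix with rows (T/2, T/2) and (S, 0) acting on (a, h). The roots have sum T/2 > 0, so the
    other one, which is negative, is smaller in absolute value. *)

Definition local_cocycle (V : choiceType) (K : scomplex V) (G : zmodType)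
    (z : V -> V -> G) : Prop :=
  forall A x y w, K A -> x \in A -> y \in A -> w \in A -> z x y + z y w = z x w.

Section GridPotential.
Variables (V : choiceType) (K : scomplex V) (G : zmodType) (z : V -> V -> G).
Variable w : nat -> nat -> V.
Hypothesis zK : local_cocycle K z.
Hypothesis cellK : forall i j, exists2 A, K A &
  [/\ w i j \in A, w i.+1 j \in A, w i j.+1 \in A & w i.+1 j.+1 \in A].

Let F (i j : nat) : G :=
  \sum_(k < i) z (w k 0) (w k.+1 0) + \sum_(k < j) z (w i k) (w i k.+1).

Let F_up i j : F i j.+1 = F i j + z (w i j) (w i j.+1).
Proof. by rewrite /F big_ord_recr /= addrA. Qed.

(** [F] follows the bottom row and then climbs a column. Moving to the next column is path
    independence, one cell at a time: the four corners of a cell lie in one simplex. *)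
Let F_right i j : F i.+1 j = F i j + z (w i j) (w i.+1 j).
Proof.
elim: j => [|j IH]; first by rewrite /F !big_ord0 !addr0 big_ord_recr.
rewrite !F_up IH -!addrA; congr (_ + _).
have [A KA [a b c d]] := cellK i j.
by rewrite (zK KA a b d) (zK KA a c d).
Qed.

Lemma grid_potential : exists F : nat -> nat -> G, forall i j i' j',
  (i <= i'.+1)%N -> (i' <= i.+1)%N -> (j <= j'.+1)%N -> (j' <= j.+1)%N ->
  F i' j' - F i j = z (w i j) (w i' j').
Proof.
exists F => i j i' j' h1 h2 h3 h4.
have cell (a b c d : bool) i0 j0 :
    F (i0 + c) (j0 + d) - F (i0 + a) (j0 + b) = z (w (i0 + a) (j0 + b)) (w (i0 + c) (j0 + d)).
  have [A KA [m00 m10 m01 m11]] := cellK i0 j0.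
  have mA (a' b' : bool) : w (i0 + a') (j0 + b') \in A.
    by case: a'; case: b'; rewrite ?addn0 ?addn1.
  have FA (a' b' : bool) : F (i0 + a') (j0 + b') = F i0 j0 + z (w i0 j0) (w (i0 + a') (j0 + b')).
    have z0 : z (w i0 j0) (w i0 j0) = 0.
      by apply: (@addrI _ (z (w i0 j0) (w i0 j0))); rewrite (zK KA) ?addr0.
    case: a'; case: b'; rewrite ?addn0 ?addn1 ?z0 ?addr0 ?F_up ?F_right //.
    by rewrite -addrA (zK KA).
  by rewrite !FA opprD addrACA subrr add0r; apply/eqP; rewrite subr_eq addrC (zK KA).
(* Points whose coordinates differ by at most 1 are corners, possibly opposite, of the cell based at
   the coordinatewise minimum. *)
pose i0 := minn i i'; pose j0 := minn j j'.
have -> : i = (i0 + (i' < i)%N)%N by rewrite /i0; lia.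
have -> : i' = (i0 + (i < i')%N)%N by rewrite /i0; lia.
have -> : j = (j0 + (j' < j)%N)%N by rewrite /j0; lia.
have -> : j' = (j0 + (j < j')%N)%N by rewrite /j0; lia.
exact: cell.
Qed.

End GridPotential.

Section DiscCohomology.
Local Open Scope classical_set_scope.
Variables (R : realType) (V : choiceType) (K : scomplex V).

Lemma bary_support (p : realization R K) : exists w, 0 < p w.
Proof.
have [A KA [p0 pA p1]] := baryP p.
apply: contrapT => /forallNP h; move: p1; rewrite big1 => [|v _].
  by move/eqP; rewrite eq_sym oner_eq0.
by apply/eqP; rewrite eq_le p0 andbT leNgt; apply/negP/h.
Qed.

Lemma support_simplex (p : realization R K) :
  exists2 A, K A & forall w, 0 < p w -> w \in A.
Proof.
have [A KA [_ pA _]] := baryP p; exists A => // w pw.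
by apply/negPn/negP => /pA pw0; rewrite pw0 ltxx in pw.
Qed.

Lemma open_star (w : V) : open [set p : realization R K | 0 < p w].
Proof.
move=> A KA x xA /= xw; exists (x w) => // y yA h.
have wA : w \in A by case: xA => _ h0 _; apply/negPn/negP => /h0 e; rewrite e ltxx in xw.
by have := h w wA; rewrite ltr_norml; case/andP => _; lra.
Qed.

Let bary_vertex (u v : V) : R := (v == u)%:R.

Let bary_vertexP u : exists2 A, K A & in_cell A (bary_vertex u).
Proof.
exists [fset u]%fset; first exact: simplex1.
split=> [v|v|]; rewrite /bary_vertex.
- by case: eqP.
- by rewrite inE => /negPf ->.
- by rewrite big_seq_fset1 eqxx.
Qed.

Let vertex_pt u : realization R K := Realization (bary_vertexP u).

Lemma locally_constant_eq (G : Type) (L : R -> G) :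
  (forall x, \forall y \near x, L y = L x) -> forall x y, L x = L y.
Proof.
move=> Lc x y.
have cR : connected [set: R]%classic.
  by apply/connected_intervalP => a b _ _ c _.
have oL (P : set G) : open (L @^-1` P).
  rewrite openE => t Pt; rewrite /interior; near=> u.
  by rewrite /preimage /= (near (Lc t) u).
suff : [set t | L t = L x] = [set: R]%classic by move/seteqP => [_ /(_ y I)] ->.
apply: cR.
- by exists x.
- by exists [set t | L t = L x]; [exact: (oL [set g | g = L x]) | rewrite classical_sets.setTI].
- exists [set t | L t = L x]; last by rewrite classical_sets.setTI.
  by rewrite -[X in closed X]classical_sets.setCK; apply: open_closedC; exact: (oL (~` [set g | g = L x])).
Unshelve. all: by end_near. Qed.

Section Edge.
Variables (u u' : V).
Hypothesis uu' : adj K u u'.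

(** Clamping to [0, 1] defines the edge path on all of R, so that [locally_constant_eq] applies to
    it. *)
Let clip (t : R) : R := Num.max 0 (Num.min 1 t).

Let bary_edge (t : R) (v : V) : R :=
  (1 - clip t) * bary_vertex u v + clip t * bary_vertex u' v.

Let clip01 t : 0 <= clip t <= 1.
Proof. by rewrite /clip le_max lexx ge_max ler01 ge_min lexx. Qed.

Let bary_edge_cell t : in_cell [fset u; u']%fset (bary_edge t).
Proof.
have /andP[c0 c1] := clip01 t; have /andP[nuu' _] := uu'.
split=> [v|v|]; rewrite /bary_edge /bary_vertex.
- by rewrite addr_ge0 // mulr_ge0 ?subr_ge0 // ler0n.
- by rewrite !inE negb_or => /andP[/negPf -> /negPf ->]; rewrite !mulr0 addr0.
- rewrite big_fsetU1 ?inE //= big_seq_fset1 !eqxx (negPf nuu') eq_sym (negPf nuu').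
  by rewrite /= !mulr0 !mulr1 addr0 add0r subrK.
Qed.

Let bary_edgeP t : exists2 A, K A & in_cell A (bary_edge t).
Proof. by exists [fset u; u']%fset => //; case/andP: uu'. Qed.

Let edge_pt t : realization R K := Realization (bary_edgeP t).

Let clip_continuous : continuous clip.
Proof.
have -> : clip = (fun=> 0 : R^o) \max ((fun=> 1 : R^o) \min id) by [].
move=> t; apply: continuous_max; first exact: cvg_cst.
by apply: continuous_min; [exact: cvg_cst | exact: cvg_id].
Qed.

Lemma edge_path : exists e : R -> realization R K,
  [/\ continuous e, e 0 = vertex_pt u, e 1 = vertex_pt u' &
      forall t w, 0 < e t w -> w \in [fset u; u']%fset].
Proof.
have eqpt (p q : realization R K) : p =1 q :> (V -> R) -> p = q.
  case: p q => p pP [q qP] /= /funext epq; rewrite epq in pP *.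
  by congr Realization; exact: Prop_irrelevance.
have /andP[nuu' Kuu'] := uu'.
exists edge_pt; split.
- move=> t U /=; rewrite nbhsE => -[U' [oU' U't] U'U].
  suff h : \forall x \near t, U' (edge_pt x) by apply: filterS h => x /U'U.
  (* The path stays in one closed simplex, and a weakly open set has a metrically open trace
     there. *)
  have [e e0 he] := oU' _ Kuu' (edge_pt t) (bary_edge_cell t) U't.
  near=> x; apply: he; first exact: bary_edge_cell.
  move=> v _ /=.
  have bE : bary_edge t v - bary_edge x v
     = (clip t - clip x) * (bary_vertex u' v - bary_vertex u v).
    by rewrite /bary_edge; ring.
  have b1 : `|bary_vertex u' v - bary_vertex u v| <= 1.
    by rewrite /bary_vertex; do 2 case: eqP => _; rewrite ?subrr ?normr0 ?subr0 ?sub0r ?normrN ?normr1 ?ler01.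
  rewrite bE normrM (le_lt_trans (ler_piMr _ b1)) //.
  by near: x; have /cvgrPdist_lt := @clip_continuous t; apply.
- apply: eqpt => v /=; rewrite /bary_edge /clip (min_r ler01) (max_l (lexx _)).
  by rewrite subr0 mul1r mul0r addr0.
- apply: eqpt => v /=; rewrite /bary_edge /clip (min_l (lexx _)) (max_r ler01).
  by rewrite subrr mul0r mul1r add0r.
- move=> t w /= e0; case: (bary_edge_cell t) => _ h _.
  by apply/negPn/negP => /h e1; rewrite e1 ltxx in e0.
Unshelve. all: by end_near. Qed.

End Edge.

(** The inverse homeomorphism [psi] is continuous only within the disc. Composed with the radial
    retraction it becomes continuous on the whole plane, hence on a square containing the disc. *)
Let radius (p : R * R) : R := Num.max 1 (Num.sqrt (p.1 ^+ 2 + p.2 ^+ 2)).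

Let retract (p : R * R) : R * R := (p.1 / radius p, p.2 / radius p).

Let radius_ge1 p : 1 <= radius p.
Proof. by rewrite /radius le_max lexx. Qed.

Let retractP p : closed_disc (retract p).
Proof.
rewrite /closed_disc /retract /= !expr_div_n -mulrDl.
have r0 : 0 < radius p ^+ 2 by rewrite exprn_gt0 // (lt_le_trans ltr01).
rewrite ler_pdivrMr // mul1r.
have s0 : 0 <= p.1 ^+ 2 + p.2 ^+ 2 by rewrite addr_ge0 ?sqr_ge0.
rewrite -{1}(sqr_sqrtr s0) ler_pXn2r ?nnegrE ?sqrtr_ge0 //.
  by rewrite /radius le_max lexx orbT.
by rewrite (le_trans ler01).
Qed.

Let retract_id p : closed_disc p -> retract p = p.
Proof.
rewrite /closed_disc /= => p1.
have m1 : radius p = 1 by rewrite /radius max_l // -sqrtr1 ler_sqrt.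
by rewrite /retract m1 !divr1 -surjective_pairing.
Qed.

Let retract_continuous : continuous retract.
Proof.
have rc : continuous radius.
  have -> : radius = (fun=> 1 : R^o) \max (fun p => Num.sqrt (p.1 ^+ 2 + p.2 ^+ 2) : R^o) by [].
  move=> p; apply: continuous_max; first exact: cvg_cst.
  apply: (@continuous_comp _ _ _ ((fun p : R * R => p.1 * p.1) + (fun p : R * R => p.2 * p.2)) Num.sqrt).
    by apply: (@continuousD R R^o); apply: (@continuousM R _); do ?exact: cvg_fst; exact: cvg_snd.
  exact: sqrt_continuous.
have r0 p : radius p != 0 by rewrite gt_eqF // (lt_le_trans ltr01).
have ric p : {for p, continuous (fun q => (radius q)^-1)}.
  by apply: (@cvgV R) => //; exact: rc.
move=> p; apply: (@cvg_pair _ _ _ (nbhs p) (nbhs (p.1 / radius p)) (nbhs (p.2 / radius p))).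
  by apply: (@continuousM R _ fst (fun q => (radius q)^-1)); [exact: cvg_fst | exact: ric].
by apply: (@continuousM R _ snd (fun q => (radius q)^-1)); [exact: cvg_snd | exact: ric].
Qed.

Section Disc.
Hypothesis homeoK : homeomorphic_to_set (realization R K) (@closed_disc R).

(** A Lebesgue number argument: the open vertex stars, pulled back by [g], cover the compact square,
    and [om p] is a vertex whose star receives the whole [d]-neighbourhood of [p]. *)
Lemma square_star_cover : exists (phi : realization R K -> R * R)
    (om : R * R -> V) (d : R),
  [/\ 0 < d, continuous phi, forall p, -1 <= (phi p).1 <= 1 /\ -1 <= (phi p).2 <= 1 &
    exists g : R * R -> realization R K, cancel phi g /\
    forall p p' : R * R, -1 <= p.1 <= 1 -> -1 <= p.2 <= 1 ->
      `|p.1 - p'.1| < d -> `|p.2 - p'.2| < d -> 0 < g p' (om p)].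
Proof.
have [phi [psi [phic /subspace_continuousP psic phiD phiK _]]] := homeoK.
have sq1 (a b : R) : a ^+ 2 + b ^+ 2 <= 1 -> -1 <= a <= 1.
  by move=> ab; rewrite -ler_norml -ler_sqr ?nnegrE // expr1n real_normK ?num_real //; have := sqr_ge0 b; lra.
pose g := psi \o retract.
have gc : continuous g.
  move=> p U /= /(psic _ (retractP p)).
  rewrite nbhs_filterE /fmap /within /= => h.
  have h' : nbhs p (retract @^-1` [set t | closed_disc t -> U (psi t)]).
    exact: (@retract_continuous p _ h).
  by apply: (@filterS _ _ _ _ (g @^-1` U) _ h') => q /=; apply; exact: retractP.
pose sq := `[(-1 : R), 1]%classic `*` `[(-1 : R), 1]%classic.
have csq : compact sq by apply: compact_setX; apply: segment_compact.
pose P (d : R) (p : R * R) := exists w, forall p' : R * R,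
  `|p.1 - p'.1| < d -> `|p.2 - p'.2| < d -> 0 < g p' w.
have cov : \forall d \near 0^'+, sq `<=` P d.
  apply: (iffLR (compact_near_coveringP sq) csq R 0^'+ P) => p _.
  have [w w0] := bary_support (g p).
  have /nbhs_ballP[e /= e0 he] := gc p _ (open_nbhs_nbhs (conj (@open_star w) w0)).
  have e20 : 0 < e / 2 by rewrite divr_gt0.
  exists (ball p (e / 2), [set d | d < e / 2]) => /=.
    by split; [exact: nbhsx_ballx | exact: nbhs_right_lt].
  case=> q d /= [[q1 q2] de]; exists w => p' h1 h2; apply: (he p').
  split; first by apply: (ball_split q1); exact: lt_trans h1 de.
  by apply: (ball_split q2); exact: lt_trans h2 de.
have /filter_ex[d [d0 hd]] : \forall d \near 0^'+, 0 < d /\ sq `<=` P d.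
  near=> d; split; near: d; [exact: nbhs_right_gt | exact: cov].
have /choice[om omP] : forall p, exists w, sq p -> forall p' : R * R,
  `|p.1 - p'.1| < d -> `|p.2 - p'.2| < d -> 0 < g p' w.
  move=> p; have [sqp|nsqp] := pselect (sq p); first by have [w hw] := hd _ sqp; exists w.
  by have [w _] := bary_support (g p); exists w.
exists phi, om, d; split => //.
  by move=> p; have := phiD p; rewrite /closed_disc /=; split; [apply: sq1; eassumption | apply: sq1; rewrite addrC; eassumption].
exists g; split; first by move=> p; rewrite /g /= retract_id // phiK.
by move=> p p' p1 p2; apply: omP; rewrite /sq /= !in_itv /=.
Unshelve. all: by end_near. Qed.

(** The labels [om] at grid points form a simplicial approximation of [g]. The potential of the
    pulled back cocycle, read off at the image of a vertex, is the potential sought. *)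
Lemma disc_cocycle_coboundary (G : zmodType) (z : V -> V -> G) :
  local_cocycle K z ->
  exists f : V -> G, forall x y, adj K x y -> z x y = f y - f x.
Proof.
move=> zK; have [phi [om [d [d0 phic phisq [g [phiK omP]]]]]] := square_star_cover.
(* Any mesh below [d] serves: adjacent grid coordinates, and a coordinate and its rounding, are then
   less than [d] apart. *)
pose e := d / 2; have e0 : 0 < e by rewrite divr_gt0.
have ed : e < d by rewrite /e ltr_pdivrMr // ltr_pMr // ltr1n.
(* Clamped at 1, so that the grid is indexed by all pairs of naturals and yet stays in the
   square. *)
pose cl (i : nat) : R := Num.min 1 (-1 + i%:R * e).
have cl1 i : -1 <= cl i <= 1.
  rewrite /cl ge_min lexx le_min /= lerDl mulr_ge0 ?ler0n ?(ltW e0) //= !andbT.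
  by rewrite (le_trans _ ler01) // oppr_le0 ler01.
have clS i : `|cl i - cl i.+1| < d /\ `|cl i.+1 - cl i| < d.
  rewrite distrC; split; rewrite /cl mulrSr mulrDl mul1r;
  by rewrite ltr_norml /Num.min; do 2 case: ifP; lra.
have cl0 i : `|cl i - cl i| < d by rewrite subrr normr0.
pose w i j := om (cl i, cl j).
have cellK i j : exists2 A, K A &
  [/\ w i j \in A, w i.+1 j \in A, w i j.+1 \in A & w i.+1 j.+1 \in A].
  (* The base point of the cell lies in the stars of all four labels, so they belong to its
     supporting simplex. *)
  have [A KA hA] := support_simplex (g (cl i, cl j)); exists A => //.
  have [h1 h2] := clS i; have [h3 h4] := clS j.
  by split; apply: hA; apply: omP => //=.
have [F FP] := grid_potential zK cellK.
pose idx (x : R) : nat := Num.trunc ((x + 1) / e).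
have idxP (x : R) : -1 <= x -> (idx x)%:R * e <= x + 1 < (idx x)%:R * e + e.
  move=> x1; have := @truncn_itv _ ((x + 1) / e); rewrite -/(idx x).
  rewrite divr_ge0 ?(ltW e0) //; last lra.
  by move=> /(_ isT); rewrite ler_pdivlMr // ltr_pdivrMr // mulrSr mulrDl mul1r.
have idx_cl (x : R) : -1 <= x <= 1 -> `|cl (idx x) - x| < d.
  case/andP=> x1 x2; have /andP[h1 h2] := idxP x x1.
  by rewrite /cl ltr_norml /Num.min; case: ifP; lra.
have idx_near (x y : R) : -1 <= x <= 1 -> -1 <= y <= 1 -> `|x - y| < e -> (idx x <= (idx y).+1)%N.
  case/andP=> x1 x2 /andP[y1 y2] xy; have /andP[h1 h2] := idxP x x1.
  have /andP[h3 h4] := idxP y y1.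
  have : (idx x)%:R * e < (idx y).+2%:R * e.
    by move: xy; rewrite !mulrSr !mulrDl !mul1r ltr_norml; lra.
  by rewrite ltr_pM2r // ltr_nat.
pose Phi p := F (idx p.1) (idx p.2); pose W p := w (idx p.1) (idx p.2).
have W_supp (q : realization R K) : 0 < q (W (phi q)).
  have [h1 h2] := phisq q; rewrite -{1}(phiK q); apply: omP => //=; exact: idx_cl.
have Phi_near (q q' : realization R K) : `|(phi q).1 - (phi q').1| < e -> `|(phi q).2 - (phi q').2| < e ->
    Phi (phi q') - Phi (phi q) = z (W (phi q)) (W (phi q')).
  have [a1 a2] := phisq q; have [b1 b2] := phisq q' => h1 h2.
  by apply: FP; apply: idx_near => //; rewrite distrC.
exists (fun u => Phi (phi (vertex_pt u))) => x y xy.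
have [E [Ec E0 E1 Es]] := edge_path xy.
(* Along the edge the label [W] stays in {x, y}, so a small change of [Phi] equals the change of z x
   W. Thus [L] is locally constant, and its end values are f x and f y - z x y. *)
pose L t := Phi (phi (E t)) - z x (W (phi (E t))).
have Wv u : W (phi (vertex_pt u)) = u.
  by have := W_supp (vertex_pt u); rewrite /= /bary_vertex; case: eqP => // _; rewrite ltxx.
have Kxy : K [fset x; y]%fset by case/andP: xy.
have z0 : z x x = 0 by apply: (@addrI _ (z x x)); rewrite (zK _ _ _ _ Kxy) ?addr0 ?inE ?eqxx.
suff : L 0 = L 1.
  by rewrite /L E0 E1 !Wv z0 subr0 => ->; rewrite opprB addrC subrK.
have near_E1 t : (phi (E t')).1 @[t' --> t] --> (phi (E t)).1.
  apply: (@continuous_comp _ _ _ E (fun q => (phi q).1)); first exact: Ec.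
  by apply: (@continuous_comp _ _ _ phi fst); [exact: phic | exact: cvg_fst].
have near_E2 t : (phi (E t')).2 @[t' --> t] --> (phi (E t)).2.
  apply: (@continuous_comp _ _ _ E (fun q => (phi q).2)); first exact: Ec.
  by apply: (@continuous_comp _ _ _ phi snd); [exact: phic | exact: cvg_snd].
apply: locally_constant_eq => t; near=> t'.
have xin : x \in [fset x; y]%fset by rewrite !inE eqxx.
have := zK _ x (W (phi (E t))) (W (phi (E t'))) Kxy xin (Es _ _ (W_supp _)) (Es _ _ (W_supp _)).
rewrite -Phi_near.
- by rewrite /L => <-; rewrite opprD opprB addrCA [X in _ + X]addrC subrK addrC.
- by near: t'; have /cvgrPdist_lt := near_E1 t; apply.
- by near: t'; have /cvgrPdist_lt := near_E2 t; apply.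
Unshelve. all: by end_near. Qed.

End Disc.

End DiscCohomology.

(** * Mod-2 chains and the Gauss-Bonnet inequality *)

Lemma F2_natr (n : nat) : n%:R = (odd n)%:R :> 'F_2.
Proof. by elim: n => [|n IH] //; rewrite mulrS IH /=; case: (odd n); apply/val_inj. Qed.

Lemma F2_neq0 (x : 'F_2) : x = (x != 0)%:R.
Proof. by case: x => -[|[|m]] i //; apply/val_inj. Qed.

Lemma F2_natr_inj (b c : bool) : b%:R = c%:R :> 'F_2 -> b = c.
Proof. by case: b; case: c. Qed.

Lemma F2_addrr (x : 'F_2) : x + x = 0.
Proof. by rewrite (F2_neq0 x); case: (_ != _); apply/val_inj. Qed.

Lemma F2_oppr (x : 'F_2) : - x = x.
Proof. by apply/eqP; rewrite eq_sym -addr_eq0 F2_addrr. Qed.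

Section Chains.
Variable W : finType.
Implicit Types (A C Tr Ed X : {set {set W}}) (T e : {set W}) (u : W).

Definition incident A e : nat := #|[set T in A | e \subset T]|.
Definition corner_count A u : nat := #|[set T in A | u \in T]|.

Definition coboundary (phi : W -> 'F_2) e : 'F_2 := \sum_(u in e) phi u.

Definition cocycle Tr Ed (z : {set W} -> 'F_2) : Prop :=
  forall T, T \in Tr -> \sum_(e in Ed | e \subset T) z e = 0.

(** Vanishing of H^1 with coefficients in F_2, where no orientations are needed. *)
Definition acyclic Tr Ed : Prop := forall z, cocycle Tr Ed z ->
  exists phi, forall e, e \in Ed -> z e = coboundary phi e.

(** The mod-2 boundary of the chain [A] is [C]. *)
Definition bounds Ed A C : Prop :=
  forall e, e \in Ed -> (e \in C) = odd (incident A e).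

Lemma natr_incident A e :
  (incident A e)%:R = \sum_(T in A) (e \subset T)%:R :> 'F_2.
Proof.
rewrite /incident -sum1_card natr_sum [RHS]big_mkcond [LHS]big_mkcond /=.
by apply: eq_bigr => T _; rewrite inE; case: (T \in A); case: (e \subset T).
Qed.

Definition extension X (v : 'I_#|X| -> 'F_2) e : 'F_2 :=
  \sum_(i < #|X| | enum_val i == e) v i.

Lemma extensionE X (v : 'I_#|X| -> 'F_2) i : extension v (enum_val i) = v i.
Proof. by rewrite /extension (big_pred1 i) // => j; rewrite /= (inj_eq enum_val_inj). Qed.

(** Linear duality: [C] is a boundary as soon as it annihilates the cokernel of the incidence
    matrix. Columns of the cokernel are cocycles, hence coboundaries, and these vanish on [C] by
    assumption. *)
Lemma filling_exists Tr Ed C : acyclic Tr Ed -> C \subset Ed ->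
  (forall phi, \sum_(e in C) coboundary phi e = 0) ->
  exists2 A : {set {set W}}, A \subset Tr & bounds Ed A C.
Proof.
move=> H1 CE C0.
pose B : 'M['F_2]_(#|Tr|, #|Ed|) := \matrix_(i < #|Tr|, j < #|Ed|) ((enum_val j : {set W}) \subset (enum_val i : {set W}))%:R.
pose c : 'rV['F_2]_#|Ed| := \row_(j < #|Ed|) (enum_val j \in C)%:R.
have : (c <= B)%MS.
  rewrite submxE; apply/eqP/rowP => k; rewrite !mxE.
  pose z := extension (fun j : 'I_#|Ed| => cokermx B j k).
  have [phi hphi] : exists phi, forall e, e \in Ed -> z e = coboundary phi e.
    apply: H1 => T TTr.
    have /matrixP/(_ (enum_rank_in TTr T) k) := mulmx_coker B.
    rewrite !mxE => BT; rewrite -[RHS]BT big_mkcondr /= big_enum_val /=.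
    apply: eq_bigr => j _; rewrite mxE enum_rankK_in // /z extensionE.
    by case: ifP; rewrite ?mul1r ?mul0r.
  rewrite -[RHS](C0 phi) (eq_bigr (fun e => z e)) => [|e eC]; last first.
    by rewrite hphi // (subsetP CE).
  rewrite [RHS](eq_bigl (fun e => (e \in Ed) && (e \in C))) => [|e]; last first.
    by case: (boolP (e \in C)) => [/(subsetP CE) ->|]; rewrite ?andbF.
  rewrite [RHS]big_mkcondr /= [RHS]big_enum_val /=; apply: eq_bigr => j _.
  by rewrite mxE /z extensionE; case: ifP; rewrite ?mul1r ?mul0r.
case/submxP => x cx; exists [set T in Tr | extension (x 0) T != 0].
  by apply/subsetP => T; rewrite inE => /andP[].
move=> e eEd; apply: F2_natr_inj; rewrite -F2_natr natr_incident.
have /rowP/(_ (enum_rank_in eEd e)) := cx; rewrite !mxE enum_rankK_in // => ->.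
rewrite [RHS](eq_bigl (fun T => (T \in Tr) && (extension (x 0) T != 0))); last by move=> T; rewrite inE.
rewrite [RHS]big_mkcondr /= [RHS]big_enum_val /=; apply: eq_bigr => i _.
rewrite mxE enum_rankK_in // extensionE [x 0 i]F2_neq0.
by case: (_ != 0); rewrite ?mul1r ?mul0r.
Qed.

(* The Euler characteristic is at least 1: this half only needs H^1 = 0. *)
Lemma euler_ge1 (V : {set W}) Ed A : acyclic A Ed -> V != set0 ->
  (forall e, e \in Ed -> #|e| = 2%N /\ e \subset V) -> (#|Ed| + 1 <= #|V| + #|A|)%N.
Proof.
move=> H1 V0 Ed2.
pose M1 : 'M['F_2]_(#|Ed|, #|A|) := \matrix_(i < #|Ed|, j < #|A|) ((enum_val i : {set W}) \subset (enum_val j : {set W}))%:R.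
pose M0 : 'M['F_2]_(#|V|, #|Ed|) := \matrix_(i < #|V|, j < #|Ed|) ((enum_val i : W) \in (enum_val j : {set W}))%:R.
have sub_e e : e \in Ed -> #|e| = 2%N /\ e \subset V by exact: Ed2.
(* Cocycles are coboundaries, as an inclusion of row spaces. *)
have k1 : (kermx M1 <= M0)%MS.
  apply/row_subP => k.
  pose z := extension (fun i : 'I_#|Ed| => kermx M1 k i).
  have [phi hphi] : exists phi, forall e, e \in Ed -> z e = coboundary phi e.
    apply: H1 => T TA.
    have /matrixP/(_ k (enum_rank_in TA T)) := mulmx_ker M1.
    rewrite !mxE => BT; rewrite -[RHS]BT big_mkcondr /= big_enum_val /=.
    apply: eq_bigr => j _; rewrite [M1 _ _]mxE enum_rankK_in // /z extensionE.
    by case: ifP; rewrite ?mulr1 ?mulr0.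
  apply/submxP; exists (\row_i phi (enum_val i)); apply/rowP => j; rewrite [LHS]mxE [RHS]mxE.
  have eE := enum_valP j; have [_ eV] := sub_e _ eE.
  rewrite -[LHS](extensionE (fun i : 'I_#|Ed| => kermx M1 k i)) -/z hphi // /coboundary.
  rewrite (eq_bigl (fun u => (u \in V) && (u \in enum_val j))) => [|u]; last first.
    by case: (boolP (u \in enum_val j)) => [/(subsetP eV) ->|]; rewrite ?andbF.
  rewrite big_mkcondr /= big_enum_val /=; apply: eq_bigr => i _; rewrite !mxE.
  by case: ifP; rewrite ?mulr1 ?mulr0.
(* Every edge has two ends, so constants lie in the kernel; this loss of rank is the 1 of the Euler
   bound. *)
have k0 : (\rank M0 < #|V|)%N.
  have : ((const_mx 1 : 'rV['F_2]_#|V|) <= kermx M0)%MS.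
    apply/sub_kermxP/rowP => j; rewrite !mxE.
    have eE := enum_valP j; have [e2 eV] := sub_e _ eE.
    transitivity (\sum_(u in V) if u \in (enum_val j : {set W}) then 1 else 0 : 'F_2).
      by rewrite [RHS]big_enum_val /=; apply: eq_bigr => i _; rewrite !mxE mul1r; case: ifP.
    rewrite -big_mkcondr /=.
    rewrite (eq_bigl (fun u => u \in enum_val j)) => [|u]; last first.
      by case: (boolP (u \in enum_val j)) => [/(subsetP eV) ->|]; rewrite ?andbF.
    by rewrite sumr_const e2; apply/val_inj.
  move/mxrankS; rewrite mxrank_ker => h.
  have : (0 < \rank (const_mx 1%R : 'rV['F_2]_#|V|))%N.
    rewrite lt0n mxrank_eq0; apply/eqP => /rowP.
    by have [v vV] := set0Pn _ V0; move/(_ (enum_rank_in vV v)); rewrite !mxE.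
  by move: h; lia.
have := mxrankS k1; rewrite mxrank_ker; have := rank_leq_col M1; have := rank_leq_row M1; lia.
Qed.

End Chains.

Section TriangleEdges.
Variable W : finType.
Implicit Types (T e : {set W}) (x y z u : W).

Lemma pair_of_triple x y z e : x != y -> y != z -> x != z ->
  (e \subset [set x; y; z]) && (#|e| == 2%N) =
  [|| e == [set x; y], e == [set y; z] | e == [set x; z]].
Proof.
move=> xy yz xz; apply/andP/idP => [[eT /cards2P[a [b [ab eab]]]]|].
  have : a \in [set x; y; z] by rewrite (subsetP eT) // eab !inE eqxx.
  have : b \in [set x; y; z] by rewrite (subsetP eT) // eab !inE eqxx orbT.
  rewrite eab {eT eab}; move: ab; rewrite !inE => ab /orP[/orP[]|] /eqP hb /orP[/orP[]|] /eqP ha; subst;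
    by [rewrite eqxx in ab | rewrite eqxx ?orbT | rewrite setUC eqxx ?orbT].
by case/or3P => /eqP ->; rewrite cards2 ?xy ?yz ?xz; split=> //;
  apply/subsetP => v; rewrite !inE => /orP[] ->; rewrite ?orbT.
Qed.

Lemma sum_pairs_of_triple (G : nmodType) (F : {set W} -> G) x y z :
  x != y -> y != z -> x != z ->
  \sum_(e : {set W} | (e \subset [set x; y; z]) && (#|e| == 2%N)) F e =
  F [set x; y] + F [set y; z] + F [set x; z].
Proof.
move=> xy yz xz; rewrite (eq_bigl _ _ (fun e => pair_of_triple e xy yz xz)).
have ne (a b c d v : W) : (v \in [set a; b]) != (v \in [set c; d]) -> [set a; b] != [set c; d].
  by apply: contraNneq => ->; rewrite eqxx.
have ne1 : [set y; z] != [set x; y].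
  by apply: (ne _ _ _ _ x); rewrite !inE eqxx (negPf xy) (negPf xz).
have ne2 : [set x; z] != [set x; y].
  by apply: (ne _ _ _ _ y); rewrite !inE eqxx (eq_sym y x) (negPf xy) (negPf yz) orbT.
have ne3 : [set x; z] != [set y; z].
  by apply: (ne _ _ _ _ x); rewrite !inE eqxx (negPf xy) (negPf xz).
rewrite (bigD1 [set x; y]) ?eqxx //= (bigD1 [set y; z]) ?ne1 ?eqxx ?orbT //=.
rewrite (bigD1 [set x; z]) ?ne2 ?ne3 ?eqxx ?orbT //= big1 ?addr0 ?addrA //.
by move=> e /andP[/andP[/andP[/or3P[] /eqP ->]]]; rewrite eqxx.
Qed.

Lemma cards3P T : #|T| = 3%N -> exists x y z, [/\ x != y, y != z, x != z & T = [set x; y; z]].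
Proof.
move/eqP; have [[|x [|y [|z []]]] //=] := cards_eqP; rewrite !inE andbT negb_or.
case/andP => /andP[xy xz] yz _; exists x, y, z; split=> //.
by apply/setP => v; rewrite !inE orbA.
Qed.

End TriangleEdges.

Lemma coboundary2 (W : finType) (phi : W -> 'F_2) x y : x != y ->
  coboundary phi [set x; y] = phi x + phi y.
Proof. by move=> xy; rewrite /coboundary big_setU1 ?inE //= big_set1. Qed.

Definition tri (W : finType) (Tr : {set {set W}}) (x y z : W) : bool :=
  [&& x != y, y != z, x != z & [set x; y; z] \in Tr].

(* The surface may have boundary, and simple connectedness is only used through its
   mod-2 cohomology.  The last field says that a cycle in a vertex link has length at least 6:
   it is tested on the sets Z in which every vertex has two link neighbours. *)
Record systolic_surface (W : finType) (Tr Ed : {set {set W}}) : Prop := SystolicSurface {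
  card_triangle : forall T, T \in Tr -> #|T| = 3%N;
  card_edge : forall e, e \in Ed -> #|e| = 2%N;
  triangle_edge : forall T e : {set W}, T \in Tr -> e \subset T -> #|e| = 2%N -> e \in Ed;
  edge_thin : forall e, e \in Ed -> (incident Tr e <= 2)%N;
  surface_acyclic : acyclic Tr Ed;
  link_girth : forall x (Z : {set W}), Z != set0 ->
    (forall y, y \in Z -> (2 <= #|[set z in Z | tri Tr x y z]|)%N) -> (6 <= #|Z|)%N }.

Section GaussBonnet.
Variables (W : finType) (Tr Ed : {set {set W}}).
Implicit Types (A C : {set {set W}}) (T e Z : {set W}) (u x y z : W).
Hypothesis surf : systolic_surface Tr Ed.

Let Tr3 := card_triangle surf.
Let Ed2 := card_edge surf.
Let TrEd := triangle_edge surf.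
Let thin := edge_thin surf.
Let H1 := surface_acyclic surf.

Let EdT T e : T \in Tr -> (e \in Ed) && (e \subset T) = (e \subset T) && (#|e| == 2%N).
Proof.
move=> TTr; apply/andP/andP => [[/Ed2 -> ->] //|[eT /eqP e2]].
by split=> //; exact: TrEd TTr eT e2.
Qed.

Lemma coboundary_cocycle T phi : T \in Tr ->
  \sum_(e in Ed | e \subset T) coboundary phi e = 0.
Proof.
move=> TTr; rewrite (eq_bigl _ _ (fun e => EdT e TTr)).
have [x [y [z [xy yz xz ->]]]] := cards3P (Tr3 TTr).
rewrite sum_pairs_of_triple // !coboundary2 //.
transitivity ((phi x + phi x) + (phi y + phi y) + (phi z + phi z)); first by ring.
by rewrite !F2_addrr.
Qed.

Section Region.
Variables (A C : {set {set W}}) (VC : {set W}).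
Hypotheses (ATr : A \subset Tr) (CEd : C \subset Ed) (bAC : bounds Ed A C).
Hypothesis VCP : forall u, reflect (exists2 e, e \in C & u \in e) (u \in VC).
Hypothesis card_VC : #|VC| = #|C|.
Hypothesis C0 : C != set0.
(** Connectedness of the boundary curve, in cohomological form: it holds for one circuit and fails
    for a disjoint union of circuits. *)
Hypothesis C_exact : forall z : {set W} -> 'F_2, \sum_(e in C) z e = 0 ->
  exists h, forall e, e \in C -> z e = coboundary h e.

Let EA := [set e in Ed | (0 < incident A e)%N].
Let VA := [set u | (0 < corner_count A u)%N].

Let subTr T : T \in A -> T \in Tr. Proof. exact: (subsetP ATr). Qed.

Let EAT T e : T \in A -> (e \in EA) && (e \subset T) = (e \in Ed) && (e \subset T).
Proof.
move=> TA; rewrite inE; case: (boolP (e \subset T)) => eT; rewrite ?andbF //.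
rewrite !andbT; case: (e \in Ed) => //=.
by apply/card_gt0P; exists T; rewrite inE TA.
Qed.

Let incident_le A' e : A' \subset Tr -> (incident A' e <= incident Tr e)%N.
Proof.
move=> h; apply/subset_leq_card/subsetP => T; rewrite !inE => /andP[/(subsetP h) -> ->] //.
Qed.

(** Thinness allows at most two triangles of [A] at an edge, and the parity prescribed by [C] tells
    one from two. *)
Let incidentEA e : e \in EA -> (incident A e + (e \in C) = 2)%N.
Proof.
rewrite inE => /andP[eE]; have := incident_le e ATr; have := thin eE.
by rewrite (bAC eE); case: (incident A e) => [|[|[|n]]] //=; lia.
Qed.

Let CEA e : e \in C -> e \in EA.
Proof.
move=> eC; have eE := subsetP CEd _ eC; rewrite inE eE /=.
by move: eC; rewrite (bAC eE); case: (incident A e).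
Qed.

(** Summing a cocycle over the triangles of [A] leaves its total over [C], which is therefore 0, so
    the cocycle is a coboundary [h] on [C]. After subtracting the coboundary of [h] it extends by 0
    to the whole surface: a triangle outside [A] can share with the region only edges of [C], the
    other edges of the region being already full. *)
Lemma region_acyclic : acyclic A EA.
Proof.
move=> z zc.
have zC : \sum_(e in C) z e = 0.
  transitivity (\sum_(T in A) \sum_(e in EA | e \subset T) z e); last first.
    by apply: big1 => T TA; exact: zc.
  rewrite [RHS](eq_bigr (fun T => \sum_(e in EA) z e *+ (e \subset T))); last first.
    by move=> T _; rewrite big_mkcondr; apply: eq_bigr => e _; case: (e \subset T).
  rewrite [RHS]exchange_big /= [LHS](eq_bigl (fun e => (e \in EA) && (e \in C))) => [|e]; last first.
    by case: (boolP (e \in C)) => [/CEA ->|]; rewrite ?andbF.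
  rewrite [LHS]big_mkcondr; apply: eq_bigr => e; rewrite inE => /andP[eE _].
  under [RHS]eq_bigr => T _ do rewrite -mulr_natr.
  rewrite (bAC eE) -mulr_sumr -natr_incident F2_natr.
  by case: odd; rewrite ?mulr1 ?mulr0.
have [h hC] := C_exact zC.
pose z' e := if e \in EA then z e - coboundary h e else 0.
have [phi hphi] : exists phi, forall e, e \in Ed -> z' e = coboundary phi e.
  apply: H1 => T TTr; case: (boolP (T \in A)) => TA.
    transitivity (\sum_(e in EA | e \subset T) (z e - coboundary h e)).
      rewrite -(eq_bigl _ _ (fun e => EAT e TA)); apply: eq_bigr => e /andP[eE _].
      by rewrite /z' eE.
    by rewrite sumrB zc // (eq_bigl _ _ (fun e => EAT e TA)) coboundary_cocycle // subr0.
  apply: big1 => e /andP[eE eT]; rewrite /z'; case: ifP => // eA.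
  case: (boolP (e \in C)) => eC; first by rewrite hC // subrr.
  have := incidentEA eA; rewrite (negPf eC) addn0 => i2.
  have : (incident A e < incident Tr e)%N.
    apply/proper_card/properP; split.
      by apply/subsetP => T'; rewrite !inE => /andP[/subTr -> ->].
    by exists T; rewrite !inE ?TTr ?eT // (negPf TA).
  by rewrite i2 ltnNge thin.
exists (fun u => h u + phi u) => e eA.
have eE : e \in Ed by move: eA; rewrite inE => /andP[].
by have := hphi e eE; rewrite /z' eA /coboundary big_split /= => <-; rewrite addrC subrK.
Qed.

Let corner_countE A' u : corner_count A' u = (\sum_(T in A') (u \in T))%N.
Proof.
rewrite /corner_count -sum1_card big_mkcond [RHS]big_mkcond /=.
by apply: eq_bigr => T _; rewrite inE; case: (T \in A'); case: (u \in T).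
Qed.

Let incidentE A' e : incident A' e = (\sum_(T in A') (e \subset T))%N.
Proof.
rewrite /incident -sum1_card big_mkcond [RHS]big_mkcond /=.
by apply: eq_bigr => T _; rewrite inE; case: (T \in A'); case: (e \subset T).
Qed.

Let sum_corner : (\sum_(u in VA) corner_count A u = 3 * #|A|)%N.
Proof.
transitivity (\sum_u \sum_(T in A) (u \in T))%N.
  rewrite big_mkcond; apply: eq_bigr => u _; rewrite inE -corner_countE.
  by case: (corner_count A u).
rewrite exchange_big /= mulnC -sum_nat_const; apply: eq_bigr => T /subTr/Tr3 <-.
by rewrite -sum1_card [RHS]big_mkcond; apply: eq_bigr => u _; case: (u \in T).
Qed.

Let sum_incident : (\sum_(e in EA) incident A e = 3 * #|A|)%N.
Proof.
under eq_bigr => e _ do rewrite incidentE.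
rewrite exchange_big /= mulnC -sum_nat_const; apply: eq_bigr => T TA.
transitivity (\sum_(e in EA | e \subset T) 1)%N.
  by rewrite big_mkcondr; apply: eq_bigr => e _; case: (e \subset T).
rewrite (eq_bigl _ _ (fun e => EAT e TA)) (eq_bigl _ _ (fun e => EdT e (subTr TA))).
have [x [y [z [xy yz xz ->]]]] := cards3P (Tr3 (subTr TA)).
exact: (sum_pairs_of_triple (fun _ => 1%N)).
Qed.

Let double_EA : (3 * #|A| + #|C| = 2%N * #|EA|)%N.
Proof.
rewrite -sum_incident mulnC -sum_nat_const.
have -> : #|C| = (\sum_(e in EA) (e \in C))%N.
  rewrite -sum1_card [RHS]big_mkcond [LHS]big_mkcond; apply: eq_bigr => e _ /=.
  by case: (boolP (e \in C)) => [/CEA ->|]; case: (e \in EA).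
by rewrite -big_split; apply: eq_bigr => e eA; exact: incidentEA.
Qed.

Let VCA u : u \in VC -> u \in VA.
Proof.
case/VCP => e /CEA; rewrite !inE => /andP[_ /card_gt0P[T]]; rewrite inE => /andP[TA eT] ue.
by apply/card_gt0P; exists T; rewrite inE TA (subsetP eT).
Qed.

(** Off the boundary each edge at [u] lies in two triangles of [A], so the neighbours of [u] in the
    region satisfy the condition of [link_girth]. Double counting shows that there are as many of
    them as corners. *)
Let interior_corner u : u \in VA -> u \notin VC -> (6 <= corner_count A u)%N.
Proof.
rewrite inE => uA uC.
pose Z := [set y | (y != u) && ([set u; y] \in EA)].
have inc2 y : y \in Z -> incident A [set u; y] = 2%N.
  rewrite inE => /andP[yu eA]; rewrite -(incidentEA eA) addnC.
  by case: (boolP (_ \in C)) => // eC; case/negP: uC; apply/VCP; exists [set u; y]; rewrite ?inE ?eqxx.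
have ZT T y : T \in A -> u \in T -> (y \in Z) && (y \in T) = (y \in T :\ u).
  move=> TA uT; rewrite !inE; case: (y != u) / boolP => yu; rewrite ?andbF //=.
  case: (boolP (y \in T)) => yT; rewrite ?andbF // andbT.
  have eT : [set u; y] \subset T by apply/subsetP => v; rewrite !inE => /orP[] /eqP ->.
  rewrite (TrEd (subTr TA) eT) ?cards2 1?eq_sym ?yu //=.
  by apply/card_gt0P; exists T; rewrite inE TA.
have sumZ : (\sum_(y in Z) incident A [set u; y] = 2 * corner_count A u)%N.
  under eq_bigr => y _ do rewrite incidentE.
  rewrite exchange_big /= corner_countE big_distrr /=; apply: eq_bigr => T TA.
  case: (boolP (u \in T)) => uT /=; last first.
    rewrite muln0 big1 // => y _; case: (boolP (_ \subset T)) => // /subsetP/(_ u).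
    by rewrite !inE eqxx (negPf uT) => /(_ isT).
  have := Tr3 (subTr TA); rewrite (cardsD1 u) uT muln1 => -[<-].
  rewrite -sum1_card -(eq_bigl _ _ (fun y => ZT T y TA uT)) big_mkcondr.
  apply: eq_bigr => y _; case: (boolP (y \in T)) => yT; last first.
    by case: (boolP (_ \subset T)) => // /subsetP/(_ y); rewrite !inE eqxx orbT (negPf yT) => /(_ isT).
  by rewrite (_ : _ \subset T) //; apply/subsetP => v; rewrite !inE => /orP[] /eqP ->.
have {}sumZ : #|Z| = corner_count A u.
  move/eqP: sumZ; rewrite (eq_bigr (fun=> 2%N)) => [|y /inc2 //].
  by rewrite sum_nat_const mulnC eqn_pmul2l // => /eqP.
rewrite -sumZ; apply: (link_girth surf (x := u)).
  by rewrite -cards_eq0 sumZ -lt0n.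
move=> y yZ; rewrite -(inc2 y yZ) /incident.
have yu : y != u by move: yZ; rewrite inE => /andP[].
apply: leq_trans (leq_imset_card (fun z => [set u; y; z]) _).
apply/subset_leq_card/subsetP => T; rewrite inE => /andP[TA eT].
have [z zD] : exists z, z \in T :\: [set u; y].
  apply/set0Pn; rewrite -card_gt0 cardsD (setIidPr eT) cards2 (Tr3 (subTr TA)).
  by rewrite eq_sym yu.
move: zD; rewrite !inE negb_or => /andP[/andP[zu zy] zT].
have uT : u \in T by rewrite (subsetP eT) // !inE eqxx.
have defT : [set u; y; z] = T.
  apply/eqP; rewrite eqEcard (Tr3 (subTr TA)); apply/andP; split.
    by apply/subsetP => v; rewrite in_setU => /orP[/(subsetP eT)|] //; rewrite inE => /eqP ->.
  by rewrite -setUA cardsU1 cards2 !inE negb_or eq_sym yu (eq_sym u z) zu (eq_sym y z) zy.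
apply/imsetP; exists z; last by rewrite defT.
have : (z \in Z) && (z \in T) by rewrite (ZT T z TA uT) !inE zu zT.
case/andP=> zZ _; rewrite inE zZ /tri defT (subTr TA).
by rewrite eq_sym yu (eq_sym y z) zy (eq_sym u z) zu.
Qed.

(** With turning 3 - c at a boundary vertex with c corners, curvature 6 - c at the other vertices,
    and chi the Euler characteristic, total curvature plus total turning is 6 chi. Since chi >= 1
    and the curvatures are nonpositive, the total turning is at least 6. *)
Lemma gauss_bonnet : (\sum_(u in VC) corner_count A u + 6 <= 3 * #|VC|)%N.
Proof.
have VA0 : VA != set0.
  have [e eC] := set0Pn _ C0; have eE := subsetP CEd _ eC.
  have /card_gt0P[u ue] : (0 < #|e|)%N by rewrite (Ed2 eE).
  by apply/set0Pn; exists u; apply: VCA; apply/VCP; exists e.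
have euler : (#|EA| + 1 <= #|VA| + #|A|)%N.
  apply: euler_ge1 region_acyclic VA0 _ => e.
  rewrite inE => /andP[eE /card_gt0P[T]]; rewrite inE => /andP[TA eT].
  split; first exact: Ed2.
  apply/subsetP => u ue; rewrite inE; apply/card_gt0P; exists T.
  by rewrite inE TA (subsetP eT).
have := sum_corner; rewrite (big_setID VC) /=.
have -> : VA :&: VC = VC by apply/setIidPr/subsetP => u; exact: VCA.
have : (6 * #|VA :\: VC| <= \sum_(u in VA :\: VC) corner_count A u)%N.
  rewrite mulnC -sum_nat_const; apply: leq_sum => u; rewrite inE => /andP[uC uA].
  exact: interior_corner.
have := cardsID VC VA.
have -> : VA :&: VC = VC by apply/setIidPr/subsetP => u; exact: VCA.
have := double_EA; rewrite -card_VC => h1 h2 h3 h4.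
move: euler h1 h2 h3 h4; set b := (\sum_(u in _ :\: _) _)%N; set c := (\sum_(u in VC) _)%N.
set v := #|VA|; set d := #|VA :\: VC|; set e := #|EA|; set f := #|A|; set l := #|VC|.
clearbody b c v d e f l; clear; lia.
Qed.

End Region.
End GaussBonnet.

(** * Circuits of edges and the regions they bound *)

Section CycleEdges.
Variable W : finType.
Implicit Types (c : seq W) (e : {set W}) (x y a b d : W).

Lemma next_split (s1 s2 : seq W) b d :
  uniq (s1 ++ [:: b, d & s2]) -> next (s1 ++ [:: b, d & s2]) b = d.
Proof.
move=> u; have bc : b \in s1 ++ [:: b, d & s2] by rewrite mem_cat inE eqxx orbT.
have ib : index b (s1 ++ [:: b, d & s2]) = size s1.
  rewrite index_cat; case: ifP => [bs1|_]; last by rewrite /= eqxx addn0.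
  by move: u; rewrite cat_uniq => /and3P[_ /hasPn/(_ b)]; rewrite inE eqxx bs1 => /(_ isT).
rewrite next_nth bc ib; case: s1 {u bc ib} => //= y s1.
by rewrite nth_cat ltnNge leqnSn subSnn.
Qed.

Lemma next_neq c x : uniq c -> (2 <= size c)%N -> x \in c -> next c x != x.
Proof.
move=> uc sc xc; have [i q rc] := rot_to xc.
have nr := next_rot i uc; rewrite -nr rc; have := sc; rewrite -(size_rot i) rc.
have : uniq (x :: q) by rewrite -rc rot_uniq.
by case: q {rc} => [|y q] //=; rewrite eqxx inE negb_or eq_sym => /andP[/andP[->]].
Qed.

Lemma next_next_neq c x : uniq c -> (3 <= size c)%N -> x \in c -> next c (next c x) != x.
Proof.
move=> uc sc xc; have [i q rc] := rot_to xc.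
have nr := next_rot i uc; rewrite -!nr rc; have := sc; rewrite -(size_rot i) rc.
have u : uniq (x :: q) by rewrite -rc rot_uniq.
case: q {rc} u => [|y [|z q]] // u _.
have -> : next [:: x, y, z & q] x = y by exact: (@next_split [::]).
have -> : next [:: x, y, z & q] y = z by exact: (@next_split [:: x]).
by move: u; rewrite /= !inE !negb_or => /andP[/and3P[_ xz _] _]; rewrite eq_sym.
Qed.

Definition cycle_edges c : {set {set W}} := [set [set x; next c x] | x in c].

Lemma cycle_edges_at c e b : uniq c -> b \in c -> b \in e ->
  (e \in cycle_edges c) = (e == [set prev c b; b]) || (e == [set b; next c b]).
Proof.
move=> uc bc be; apply/imsetP/orP => [[x xc defe]|[] /eqP ->].
- move: be; rewrite defe !inE => /orP[] /eqP ->; first by right.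
  by left; rewrite prev_next.
- by exists (prev c b); rewrite ?mem_prev // next_prev.
- by exists b.
Qed.

Lemma cycle_edges_inj c : uniq c -> (3 <= size c)%N ->
  {in c &, injective (fun x => [set x; next c x])}.
Proof.
move=> uc sc x y xc yc /= exy; apply/eqP/negPn/negP => xy.
have xy' : x = next c y.
  have : x \in [set y; next c y] by rewrite -exy !inE eqxx.
  by rewrite !inE (negPf xy) => /eqP.
have : y \in [set x; next c x] by rewrite exy !inE eqxx.
rewrite !inE eq_sym (negPf xy) /= xy' => /eqP/esym/eqP.
by rewrite (negPf (next_next_neq uc sc yc)).
Qed.

Lemma sum_cycle_edges (G : nmodType) (F : {set W} -> G) c : uniq c -> (3 <= size c)%N ->
  \sum_(e in cycle_edges c) F e = \sum_(x in c) F [set x; next c x].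
Proof. by move=> uc sc; rewrite big_imset //; exact: cycle_edges_inj. Qed.

Lemma card_cycle_edges c : uniq c -> (3 <= size c)%N -> #|cycle_edges c| = size c.
Proof.
move=> uc sc; rewrite card_in_imset; last exact: cycle_edges_inj.
exact/card_uniqP.
Qed.

Lemma cycle_edges_closed c (phi : W -> 'F_2) : uniq c -> (3 <= size c)%N ->
  \sum_(e in cycle_edges c) coboundary phi e = 0.
Proof.
move=> uc sc; rewrite sum_cycle_edges //.
transitivity (\sum_(x in c) phi x + \sum_(x in c) phi (next c x)).
  rewrite -big_split; apply: eq_bigr => x xc /=.
  by rewrite coboundary2 // eq_sym next_neq // ltnW.
rewrite (reindex_onto (next c) (prev c)) /=; last by move=> x xc; rewrite next_prev.
rewrite (eq_bigl (mem c)) ?F2_addrr // => x /=.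
by rewrite mem_next; case: (boolP (x \in c)) => //= xc; rewrite prev_next ?eqxx.
Qed.

(** The potential is given by partial sums along the list. *)
Lemma cycle_edges_exact c (z : {set W} -> 'F_2) : uniq c -> (3 <= size c)%N ->
  \sum_(e in cycle_edges c) z e = 0 ->
  exists h, forall e, e \in cycle_edges c -> z e = coboundary h e.
Proof.
move=> uc sc; rewrite sum_cycle_edges //.
case: c uc sc => [|x0 p] // uc sc; set c := x0 :: p in uc sc *.
pose E j := z [set nth x0 c j; next c (nth x0 c j)].
have -> : \sum_(x in c) z [set x; next c x] = \sum_(j < size c) E j.
  rewrite -big_uniq //= (big_nth x0) big_mkord //.
move=> tot; pose h u := \sum_(j < index u c) E j.
exists h => e /imsetP[x xc ->].
rewrite coboundary2; last by rewrite eq_sym next_neq // ltnW.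
have ix : (index x c < size c)%N by rewrite index_mem.
have Ex : E (index x c) = z [set x; next c x] by rewrite /E nth_index.
have hx : h x + z [set x; next c x] = \sum_(j < (index x c).+1) E j.
  by rewrite big_ord_recr /= Ex.
have nx : next c x = nth x0 p (index x c) by rewrite next_nth xc.
have [lt|ge] := ltnP (index x c) (size p).
  have -> : h (next c x) = h x + z [set x; next c x].
    suff i1 : index (nth x0 p (index x c)) c = (index x c).+1 by rewrite hx /h nx i1.
    by rewrite -[nth x0 p _]/(nth x0 c (index x c).+1) index_uniq.
  by rewrite addrA F2_addrr add0r.
have isz : (index x c).+1 = size c by apply/eqP; rewrite eqn_leq ix /= ltnS.
(* The closing edge returns to index 0, where the partial sum is empty; the vanishing total makes
   the two ends agree. *)
have -> : h (next c x) = 0 by rewrite nx nth_default // /h /c /= eqxx big_ord0.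
by move: hx; rewrite isz tot => /(congr1 (fun t => h x + t)); rewrite addrA F2_addrr add0r addr0.
Qed.

Lemma cycle_edges_subst c a b b' d e : uniq c -> (3 <= size c)%N -> b \in c -> b' \notin c ->
  a = prev c b -> d = next c b ->
  (e \in cycle_edges (map (fun u => if u == b then b' else u) c)) =
  [|| (e \in cycle_edges c) && (b \notin e), e == [set a; b'] | e == [set b'; d]].
Proof.
move=> uc sc bc b'c defa defd; set c' := map _ c.
have ac : a \in c by rewrite defa mem_prev.
have b'b : b' != b by apply: contraNneq b'c => ->.
(* On [c] the renaming agrees with a transposition, whose injectivity makes [next] commute with
   [map]. *)
have tp u : u \in c -> tperm b b' u = if u == b then b' else u.
  by move=> uc'; case: tpermP => [->|e'|/eqP/negPf ->]; rewrite ?eqxx //; move: b'c; rewrite -e' uc'.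
have c'E : c' = map (tperm b b') c by apply/eq_in_map => u /tp ->.
have nxt u : u \in c -> next c' (tperm b b' u) = tperm b b' (next c u).
  by move=> _; rewrite c'E next_map //; exact: perm_inj.
have na : next c a = b by rewrite defa next_prev.
have db : d != b by rewrite defd next_neq // ltnW.
have ab : a != b by rewrite -na eq_sym next_neq // ltnW.
apply/imsetP/idP.
  case=> x'; rewrite c'E => /mapP[x xc ->]; rewrite -c'E nxt // => ->.
  have nc : next c x \in c by rewrite mem_next.
  rewrite !tp //; case: eqP => [->|/eqP xb].
    by rewrite -defd (negPf db) eqxx !orbT.
  case: eqP => [nb|/eqP nb].
    have -> : x = a by rewrite defa -nb prev_next.
    by rewrite eqxx !orbT.
  apply/orP; left; apply/andP; split; first exact: imset_f.
  by rewrite !inE negb_or eq_sym xb eq_sym nb.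
case/or3P => [/andP[/imsetP[x xc ->]]|/eqP ->|/eqP ->].
- rewrite !inE negb_or eq_sym (eq_sym b) => /andP[xb nb]; exists x.
    by rewrite c'E; apply/mapP; exists x; rewrite // tp // (negPf xb).
  have := nxt x xc; rewrite !tp ?mem_next // (negPf xb) (negPf nb) => -> //.
- exists a; first by rewrite c'E; apply/mapP; exists a; rewrite // tp // (negPf ab).
  by have := nxt a ac; rewrite na !tp // (negPf ab) eqxx => ->.
- exists b'; first by rewrite c'E; apply/mapP; exists b; rewrite // tp // eqxx.
  by have := nxt b bc; rewrite -defd !tp // ?eqxx ?(negPf db) => [->|] //; rewrite defd mem_next.
Qed.

End CycleEdges.

Section CyclesInSurface.
Variables (W : finType) (Tr Ed : {set {set W}}).
Implicit Types (A : {set {set W}}) (T e : {set W}) (c : seq W) (a b d u x y z : W).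
Hypothesis surf : systolic_surface Tr Ed.

Definition edge x y : bool := [set x; y] \in Ed.

Lemma edge_sym x y : edge x y = edge y x.
Proof. by rewrite /edge setUC. Qed.

Lemma edge_neq x y : edge x y -> x != y.
Proof. by move/(card_edge surf); rewrite cards2; case: (x != y). Qed.

Lemma triC12 x y z : tri Tr x y z = tri Tr y x z.
Proof. by rewrite /tri eq_sym [[set x; y]]setUC; case: (y != x); rewrite //= andbCA. Qed.

Lemma triC23 x y z : tri Tr x y z = tri Tr x z y.
Proof.
rewrite /tri (eq_sym y) setUAC; case: (x != y); case: (z != y); case: (x != z); rewrite ?andbF //.
Qed.

Lemma tri_perm x y z : tri Tr x y z ->
  [/\ tri Tr x z y, tri Tr y x z, tri Tr y z x, tri Tr z x y & tri Tr z y x].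
Proof.
move=> t; have a : tri Tr x z y by rewrite triC23.
have b : tri Tr y x z by rewrite triC12.
have c : tri Tr y z x by rewrite triC23.
by split=> //; rewrite triC12.
Qed.

Lemma tri_edge x y z : tri Tr x y z -> edge x y.
Proof.
case/and4P => xy _ _ /(triangle_edge surf); apply; last by rewrite cards2 xy.
exact: subsetUl.
Qed.

Section OneCycle.
Variables (c : seq W) (A : {set {set W}}).
Hypotheses (uc : uniq c) (sc : (3 <= size c)%N) (cE : cycle edge c).

Lemma cycle_edges_sub : cycle_edges c \subset Ed.
Proof. by apply/subsetP => e /imsetP[x xc ->]; exact: (next_cycle cE). Qed.

Lemma cycle_filling : exists2 B : {set {set W}}, B \subset Tr & bounds Ed B (cycle_edges c).
Proof.
apply: filling_exists; [exact: (surface_acyclic surf) | exact: cycle_edges_sub |].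
by move=> phi; exact: cycle_edges_closed.
Qed.

Hypotheses (ATr : A \subset Tr) (bA : bounds Ed A (cycle_edges c)).

Lemma cycle_gauss_bonnet : (\sum_(u <- c) corner_count A u + 6 <= 3 * size c)%N.
Proof.
have VP u : reflect (exists2 e, e \in cycle_edges c & u \in e) (u \in [set x in c]).
  rewrite inE; apply: (iffP idP) => [ucc|[e /imsetP[x xc ->]]].
    by exists [set u; next c u]; [exact: imset_f | rewrite !inE eqxx].
  by rewrite !inE => /orP[] /eqP ->; rewrite ?mem_next.
have cardV : #|[set x in c]| = size c by rewrite cardsE; apply/card_uniqP.
have C0 : cycle_edges c != set0.
  by rewrite -cards_eq0 card_cycle_edges // -lt0n (leq_trans _ sc).
have := gauss_bonnet surf ATr cycle_edges_sub bA VP _ C0.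
rewrite cardV card_cycle_edges // => /(_ erefl) h.
rewrite big_uniq //; apply: leq_trans (h _).
  by rewrite leq_add2r leq_eqVlt; apply/orP; left; apply/eqP; apply: eq_bigl => x; rewrite inE.
by move=> z; exact: cycle_edges_exact.
Qed.

Let inc_gt0 e : e \in cycle_edges c -> exists2 T, T \in A & e \subset T.
Proof.
move=> eC; have eE := subsetP cycle_edges_sub _ eC.
have : (0 < incident A e)%N by move: eC; rewrite (bA eE); case: (incident A e).
by case/card_gt0P => T; rewrite inE => /andP[]; exists T.
Qed.

Lemma cycle_corner_gt0 u : u \in c -> (0 < corner_count A u)%N.
Proof.
move=> ucc; have [|T TA eT] := @inc_gt0 [set u; next c u]; first exact: imset_f.
by apply/card_gt0P; exists T; rewrite inE TA (subsetP eT) // !inE eqxx.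
Qed.

Variables a b d : W.
Hypotheses (bc : b \in c) (abE : a = prev c b) (bdE : d = next c b).

Let ac : a \in c. Proof. by rewrite abE mem_prev. Qed.
Let dc : d \in c. Proof. by rewrite bdE mem_next. Qed.
Let ab : a != b. Proof.
have := @next_neq _ c (prev c b) uc (ltnW sc).
by rewrite mem_prev next_prev // -abE eq_sym => /(_ bc).
Qed.
Let db : d != b. Proof. by rewrite bdE next_neq // ltnW. Qed.
Let ad : a != d.
Proof.
have nb : next c a = b by rewrite abE next_prev.
by rewrite bdE -{1}nb eq_sym next_next_neq.
Qed.

Let third T x y z : T \in A -> x != y -> y != z -> x != z ->
  x \in T -> y \in T -> z \in T -> T = [set x; y; z].
Proof.
move=> TA xy yz xz xT yT zT; apply/esym/eqP.
rewrite eqEcard (card_triangle surf (subsetP ATr _ TA)); apply/andP; split.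
  by apply/subsetP => v; rewrite !inE => /orP[/orP[]|] /eqP ->.
by rewrite -setUA cardsU1 cards2 !inE negb_or xy yz xz.
Qed.

(** The circuit edges at [b] each lie in a triangle of [A]. If these two triangles differ, they are
    all the triangles of [A] at [b]. The inner edge from [b] to the third vertex of the first is not
    on the circuit, so it has even incidence, and the second triangle must contain it. *)
Lemma cycle_corner_le2 : (corner_count A b <= 2)%N ->
  [set a; b; d] \in A \/
  (corner_count A b = 2%N /\ exists b', [/\ b' != a, b' != b, b' != d,
     [set a; b; b'] \in A & [set b'; b; d] \in A]).
Proof.
move=> cb.
have [|T1 T1A /subsetP e1] := @inc_gt0 [set a; b].
  by rewrite (@cycle_edges_at _ _ _ b) ?inE ?eqxx ?orbT // -abE eqxx.
have [|T2 T2A /subsetP e2] := @inc_gt0 [set b; d].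
  by rewrite (@cycle_edges_at _ _ _ b) ?inE ?eqxx ?orbT // -bdE eqxx orbT.
have aT1 : a \in T1 by rewrite e1 // !inE eqxx.
have bT1 : b \in T1 by rewrite e1 // !inE eqxx orbT.
have bT2 : b \in T2 by rewrite e2 // !inE eqxx.
have dT2 : d \in T2 by rewrite e2 // !inE eqxx orbT.
have [dT1|dT1] := boolP (d \in T1).
  by left; rewrite -(third T1A ab _ ad) // eq_sym.
have T12 : T1 != T2 by apply: contraNneq dT1 => ->.
have cb2 : [set T in A | b \in T] = [set T1; T2].
  apply/esym/eqP; rewrite eqEcard cards2 T12 cb andbT.
  by apply/subsetP => T; rewrite !inE => /orP[] /eqP ->; rewrite ?T1A ?T2A.
right; split; first by rewrite /corner_count cb2 cards2 T12.
have [b' b'D] : exists b', b' \in T1 :\: [set a; b].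
  apply/set0Pn; rewrite -card_gt0 cardsD (card_triangle surf (subsetP ATr _ T1A)).
  rewrite (setIidPr _) ?cards2 ?ab //; by apply/subsetP.
move: b'D; rewrite !inE negb_or => /andP[/andP[b'a b'b] b'T1].
have b'd : b' != d by apply: contraNneq dT1 => <-.
have T1E : T1 = [set a; b; b'] by apply: third; rewrite // eq_sym.
have eE : [set b; b'] \in Ed.
  apply: (triangle_edge surf (subsetP ATr _ T1A)); last by rewrite cards2 eq_sym b'b.
  by apply/subsetP => v; rewrite !inE => /orP[] /eqP ->.
have : ~~ odd (incident A [set b; b']).
  rewrite -(bA eE) (@cycle_edges_at _ _ _ b) ?inE ?eqxx // -abE -bdE negb_or.
  apply/andP; split; apply/eqP => /setP/(_ b'); rewrite !inE eqxx (negPf b'b) ?orbT.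
    by rewrite (negPf b'a).
  by rewrite (negPf b'd).
have [b'T2 _|b'T2] := boolP (b' \in T2).
  by exists b'; split; rewrite -?T1E // -(third T2A b'b _ b'd) // eq_sym.
suff -> : incident A [set b; b'] = 1%N by [].
rewrite /incident (_ : [set T in A | _] = [set T1]) ?cards1 //.
apply/setP => T; rewrite !inE; apply/andP/eqP => [[TA /subsetP eT]|->]; last first.
  by split=> //; apply/subsetP => v; rewrite !inE => /orP[] /eqP ->.
have : T \in [set T1; T2] by rewrite -cb2 inE TA eT // !inE eqxx.
rewrite !inE => /orP[/eqP //|/eqP TT2].
by move: b'T2; rewrite -TT2 eT // !inE eqxx orbT.
Qed.

(** Removing the two triangles at [b] moves the boundary to their far side: their common edge
    cancels mod 2, and the two edges at [b] are traded for the two at [b']. *)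
Lemma cycle_push b' : b' != a -> b' != b -> b' != d ->
  [set a; b; b'] \in A -> [set b'; b; d] \in A -> b' \notin c ->
  exists A' : {set {set W}}, [/\ A' \subset Tr, (#|A'| < #|A|)%N &
    bounds Ed A' (cycle_edges (map (fun u => if u == b then b' else u) c))].
Proof.
set T1 := [set a; b; b']; set T2 := [set b'; b; d] => b'a b'b b'd T1A T2A b'c.
have aT2 : a \notin T2 by rewrite !inE !negb_or eq_sym b'a ab ad.
have T12 : T1 != T2 by apply: contraNneq aT2 => <-; rewrite !inE eqxx.
exists (A :\ T1 :\ T2); split.
- by rewrite (subset_trans _ ATr) // (subset_trans (subsetDl _ _)) // subsetDl.
- by rewrite (cardsD1 T1 A) T1A (cardsD1 T2 (A :\ T1)) !inE T2A eq_sym T12 /= add1n ltnS leq_addl.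
move=> e eE; rewrite (@cycle_edges_subst _ _ a _ _ d) //.
have inc : (incident A e = incident (A :\ T1 :\ T2) e + (e \subset T1) + (e \subset T2))%N.
  have incD (B : {set {set W}}) T : T \in B -> (incident B e = incident (B :\ T) e + (e \subset T))%N.
    move=> TB; rewrite /incident (cardsD1 T) !inE TB /= addnC; congr (_ + _)%N.
    by apply: eq_card => T'; rewrite !inE andbA.
  by rewrite (incD A T1) // (incD (A :\ T1) T2) ?inE ?T2A ?[T2 == _]eq_sym ?T12 // addnAC.
have {inc} oddE : odd (incident (A :\ T1 :\ T2) e) = (e \in cycle_edges c) (+) (e \subset T1) (+) (e \subset T2).
  by rewrite (bA eE) inc !oddD; case: odd; case: (_ \subset _); case: (_ \subset _).
have [e2 eT] := (card_edge surf eE, @pair_of_triple).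
have E1 : (e \subset T1) = [|| e == [set a; b], e == [set b; b'] | e == [set a; b']].
  by rewrite -eT ?[b == _]eq_sym ?[a == b']eq_sym // e2 andbT.
have E2 : (e \subset T2) = [|| e == [set b'; b], e == [set b; d] | e == [set b'; d]].
  by rewrite -eT ?[b == d]eq_sym // e2 andbT.
have Eb : (e \in cycle_edges c) = ((e \in cycle_edges c) && (b \notin e)) || (e == [set a; b]) || (e == [set b; d]).
  have [be|be] := boolP (b \in e).
    by rewrite andbF (@cycle_edges_at _ _ _ b) // -abE -bdE.
  rewrite andbT -orbA; case: (e \in _) => //=; apply/esym/negbTE; rewrite negb_or.
  by apply/andP; split; apply: contraNneq be => ->; rewrite !inE eqxx ?orbT.
rewrite oddE E1 E2 [in RHS]Eb (setUC [set b'] [set b]).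
have V1 : (e == [set a; b]) ==> [&& a \in e, b \in e, b' \notin e & d \notin e].
  by apply/implyP => /eqP ->; rewrite !inE !eqxx orbT !negb_or b'a b'b (eq_sym d a) ad db.
have V2 : (e == [set b; d]) ==> [&& a \notin e, b \in e, b' \notin e & d \in e].
  by apply/implyP => /eqP ->; rewrite !inE !eqxx orbT !negb_or ab ad b'b b'd.
have V3 : (e == [set b; b']) ==> [&& a \notin e, b \in e, b' \in e & d \notin e].
  by apply/implyP => /eqP ->; rewrite !inE !eqxx orbT !negb_or ab (eq_sym a b') b'a db (eq_sym d b') b'd.
have V4 : (e == [set a; b']) ==> [&& a \in e, b \notin e, b' \in e & d \notin e].
  by apply/implyP => /eqP ->; rewrite !inE !eqxx orbT !negb_or (eq_sym b a) ab (eq_sym b b') b'b (eq_sym d a) ad (eq_sym d b') b'd.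
have V5 : (e == [set b'; d]) ==> [&& a \notin e, b \notin e, b' \in e & d \in e].
  by apply/implyP => /eqP ->; rewrite !inE !eqxx orbT !negb_or (eq_sym a b') b'a ad (eq_sym b b') b'b (eq_sym b d) db.
have V0 : (e \in cycle_edges c) && (b \notin e) ==> (b \notin e) && (b' \notin e).
  apply/implyP => /andP[/imsetP[x xc ->] ->] /=; rewrite !inE negb_or.
  by rewrite !(contraNneq _ b'c) // => ->; rewrite ?mem_next.
(* [V0] to [V5] record which of a, b, b', d each kind of edge contains. This makes the kinds
   mutually exclusive, and the parity identity becomes a Boolean check. *)
move: V0 V1 V2 V3 V4 V5.
move: (_ && (b \notin e)) (e == [set a; b]) (e == [set b; d]) (e == [set b; b']) (e == [set a; b']) (e == [set b'; d]).
move: (a \in e) (b \in e) (b' \in e) (d \in e).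
by do 4 case; do 6 case.
Qed.

End OneCycle.
End CyclesInSurface.

(** * Geodesics and spheres *)

Section Levels.
Variables (W : finType) (Tr Ed : {set {set W}}).
Implicit Types (A : {set {set W}}) (p q c al be mid : seq W) (a b d u x y z : W).
Hypothesis surf : systolic_surface Tr Ed.
Variables (lvl : W -> nat) (N : nat) (v0 : W).
Notation edge := (edge Ed).
Notation tri := (tri Tr).

Hypothesis lvl_edge : forall x y, edge x y -> (lvl y <= (lvl x).+1)%N.
(** Levels from [N] on carry no information: in the application [N] is [#|W|], the default value of
    [dist]. *)
Hypothesis lvl_pred : forall x, (0 < lvl x)%N -> (lvl x < N)%N ->
  exists2 y, edge y x & lvl x = (lvl y).+1.
Hypothesis lvl0 : forall x, lvl x = 0%N -> x = v0.

Definition up x y : bool := edge x y && (lvl y == (lvl x).+1).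

Lemma upE x y : up x y -> lvl y = (lvl x).+1.
Proof. by case/andP => _ /eqP. Qed.

Lemma geodesic x : (lvl x < N)%N -> exists2 p, path up v0 p & last v0 p = x.
Proof.
move: {2}(lvl x) (erefl (lvl x)) => n; elim: n x => [|n IH] x lx xN.
  by exists [::]; rewrite // (lvl0 lx).
have [|y yx ly] := lvl_pred _ xN; first by rewrite lx.
have ly' : lvl y = n by apply/eqP; rewrite -eqSS -ly lx.
have [|p pp lp] := IH y ly'; first by rewrite ly' (leq_trans _ xN) // lx.
exists (rcons p x); last by rewrite last_rcons.
by rewrite rcons_path pp lp /up yx ly eqxx.
Qed.

Lemma up_path_lvl a p : path up a p -> map lvl p = iota (lvl a).+1 (size p).
Proof. by elim: p a => //= b p IH a /andP[/upE ab /IH ->]; rewrite ab. Qed.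

Lemma up_path_last a p : path up a p -> lvl (last a p) = (lvl a + size p)%N.
Proof. by elim: p a => [|b p IH] a /=; rewrite ?addn0 // => /andP[/upE ab /IH ->]; rewrite ab addSnnS. Qed.

Lemma up_path_inj a p : path up a p -> {in p &, injective lvl}.
Proof.
move=> /up_path_lvl lp x y xp yp lxy.
have : index x p = index y p.
  have nx : nth 0%N (map lvl p) (index x p) = lvl x by rewrite (nth_map a) ?index_mem // nth_index.
  have ny : nth 0%N (map lvl p) (index y p) = lvl y by rewrite (nth_map a) ?index_mem // nth_index.
  move: nx ny; rewrite lp !nth_iota ?index_mem // => nx ny.
  by apply/eqP; rewrite -(eqn_add2l (lvl a).+1) nx ny lxy.
by move=> ixy; rewrite -(nth_index a xp) ixy nth_index.
Qed.

Lemma up_path_mem a p x : path up a p -> x \in p -> (lvl a < lvl x <= lvl a + size p)%N.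
Proof.
move=> pp xp; have : lvl x \in map lvl p by rewrite map_f.
by rewrite (up_path_lvl pp) mem_iota addSn ltnS.
Qed.

Lemma up_path_uniq a p : path up a p -> uniq (a :: p).
Proof.
move=> pp; rewrite /=; apply/andP; split.
  by apply/negP => /(up_path_mem pp); rewrite ltnn.
by apply: (@map_uniq _ _ lvl); rewrite (up_path_lvl pp) iota_uniq.
Qed.

Lemma up_path_edge a p : path up a p -> path edge a p.
Proof. by apply: sub_path => x y /andP[]. Qed.

(** Up along [al], across [mid], down along [be]. The list [mid] is empty when the two ends are
    adjacent, and is the common child when they are parents of one vertex. *)
Lemma bigon_cycle x al mid be : path up x al -> path up x be ->
  path edge (last x al) (rcons mid (last x be)) -> cycle edge (x :: al ++ mid ++ rev be).
Proof.
move=> /up_path_edge pa /up_path_edge pb; rewrite rcons_path => /andP[pm lm].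
rewrite /= rcons_cat cat_path pa rcons_cat cat_path pm /= -rev_cons lastI rev_rcons /= lm.
by rewrite rev_path (eq_path (e' := edge)) // => u v; rewrite edge_sym.
Qed.

Lemma bigon_uniq x al mid be : path up x al -> path up x be -> ~~ has (mem al) be ->
  uniq mid -> (forall u, u \in mid -> (lvl x + size al < lvl u)%N) -> size al = size be ->
  uniq (x :: al ++ mid ++ rev be).
Proof.
move=> pa pb dis um lm sab.
have := up_path_uniq pa; have := up_path_uniq pb; rewrite /= => /andP[xb ub] /andP[xa ua].
rewrite !cat_uniq ua um rev_uniq ub !mem_cat mem_rev !negb_or xa xb /= !andbT.
rewrite has_cat has_rev negb_or dis andbT.
apply/and3P; split; last first.
- rewrite has_rev; apply/hasPn => u ub'; apply/negP => /lm; rewrite sab.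
  by have /andP[_] := up_path_mem pb ub'; rewrite leqNgt => /negPf ->.
- apply/hasPn => u /lm; apply: contraL => ua'; rewrite -leqNgt.
  by have /andP[] := up_path_mem pa ua'.
- by apply/negP => /lm; rewrite ltnNge leq_addr.
Qed.

Lemma cycle_edges_rot n c : uniq c -> cycle_edges (rot n c) = cycle_edges c.
Proof.
move=> uc; apply/setP => e; apply/imsetP/imsetP => -[x xc ->]; exists x; rewrite ?mem_rot // ?next_rot //.
by move: xc; rewrite mem_rot.
Qed.

Lemma cycle_edges_rev c : uniq c -> cycle_edges (rev c) = cycle_edges c.
Proof.
move=> uc; apply/setP => e; apply/imsetP/imsetP => -[x xc ->].
  exists (prev c x); first by rewrite mem_prev -mem_rev.
  by rewrite next_prev // next_rev // setUC.
exists (next c x); rewrite ?mem_rev ?mem_next //.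
by rewrite next_rev // prev_next // setUC.
Qed.

(** The same region with its sides exchanged, so that a push stated for the first side serves
    both. *)
Lemma cycle_edges_flip x al mid be : uniq (x :: al ++ mid ++ rev be) ->
  cycle_edges (x :: be ++ rev mid ++ rev al) = cycle_edges (x :: al ++ mid ++ rev be).
Proof.
set c := x :: al ++ _ => uc; rewrite -(cycle_edges_rev uc) -(@cycle_edges_rot 1 (x :: be ++ _)).
  by rewrite /c rot1_cons rev_cons !rev_cat revK -catA.
have : uniq (rev c) by rewrite rev_uniq.
by rewrite /c rev_cons !rev_cat revK -rot1_cons rot_uniq -catA.
Qed.

(** The levels of [a] and [d] differ by 2, so a, b, d span no triangle and the two-triangle
    alternative holds. Adjacent to both [a] and [d], the vertex [b'] is on the level of [b], and the
    path through it is again a geodesic, with a smaller region. *)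
Lemma geodesic_push A (s1 s2 : seq W) a b d :
  let c := s1 ++ [:: a, b, d & s2] in
  uniq c -> cycle edge c -> A \subset Tr -> bounds Ed A (cycle_edges c) ->
  up a b -> up b d -> (corner_count A b <= 2)%N ->
  exists b', [/\ tri b a b', tri b b' d, up a b', up b' d &
    b' \notin c -> exists A' : {set {set W}}, [/\ A' \subset Tr, (#|A'| < #|A|)%N &
      bounds Ed A' (cycle_edges (s1 ++ [:: a, b', d & s2]))]].
Proof.
move=> c uc cE ATr bA ab bd cb.
have sc : (3 <= size c)%N by rewrite size_cat /= !addnS.
have bc : b \in c by rewrite mem_cat !inE eqxx !orbT.
have defd : d = next c b.
  by rewrite /c -cat_rcons next_split // cat_rcons.
have defa : a = prev c b.
  have <- : next c a = b by apply: next_split.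
  by rewrite prev_next.
have [lb ld] := (upE ab, upE bd).
have [abE bdE] : edge a b /\ edge b d by case/andP: ab; case/andP: bd.
have trA x y z : x != y -> y != z -> x != z -> [set x; y; z] \in A -> tri x y z.
  by move=> xy yz xz /(subsetP ATr) TA; rewrite /tri xy yz xz TA.
have nab := edge_neq surf abE; have nbd := edge_neq surf bdE.
have nad : a != d by apply/eqP => ad; move: ld; rewrite -ad lb; clear; lia.
case: (cycle_corner_le2 surf uc sc cE ATr bA bc defa defd cb) => [T|[_ [b' [b'a b'b b'd T1 T2]]]].
  have : edge a d by apply: (tri_edge surf (z := b)); rewrite triC23; apply: trA.
  by move/lvl_edge; rewrite ld lb ltnn.
have t1 : tri a b b' by apply: trA; rewrite // eq_sym.
have t2 : tri b' b d by apply: trA.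
have e1 : edge a b' by apply: (tri_edge surf (z := b)); rewrite triC23.
have e2 : edge b' d by apply: (tri_edge surf (z := b)); rewrite triC23.
have lb' : lvl b' = lvl b.
  by have := lvl_edge e1; have := lvl_edge e2; rewrite ld lb; clear; lia.
exists b'; split.
- by rewrite triC12.
- by rewrite triC12.
- by rewrite /up e1 lb' lb eqxx.
- by rewrite /up e2 lb' ld eqxx.
move=> b'c; have [A' [h1 h2 h3]] := cycle_push surf uc sc ATr bA bc defa defd b'a b'b b'd T1 T2 b'c.
exists A'; split=> //; move: h3; congr (bounds _ _ (cycle_edges _)).
have fid s : b \notin s -> map (fun u => if u == b then b' else u) s = s.
  by move=> bs; rewrite map_id_in // => u us; case: eqP us bs => // -> ->.
have := uc; rewrite /c cat_uniq => /and3P[_ h].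
rewrite 3!cons_uniq => /and4P[_ + _ _]; rewrite inE negb_or => /andP[_ bs2].
rewrite map_cat /= (negPf nab) eqxx eq_sym (negPf nbd) !fid //.
by apply: contraNN h => bs1; apply/hasP; exists b; rewrite // !inE eqxx orbT.
Qed.

Lemma sum_corner_ge A p : (forall u, u \in p -> (3 <= corner_count A u)%N) ->
  (3 * size p <= \sum_(u <- p) corner_count A u)%N.
Proof.
elim: p => [|u p IH] h; first by rewrite big_nil.
rewrite big_cons mulnS leq_add ?h ?mem_head ?IH // => w wp.
by rewrite h // inE wp orbT.
Qed.

Lemma has_split (s1 s2 : seq W) : has (mem s1) s2 -> exists p1 p2 q1 q2 x,
  s1 = p1 ++ x :: p2 /\ s2 = q1 ++ x :: q2.
Proof.
case/hasP => x /splitPr[q1 q2] /splitPr[p1 p2].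
by exists p1, p2, q1, q2, x.
Qed.

Lemma bigon_size x y v al be : path up v al -> path up v be -> last v al = x -> last v be = y ->
  lvl x = lvl y -> size al = size be.
Proof.
by move=> /up_path_last pa /up_path_last pb la lb; rewrite -la -lb pa pb => /addnI.
Qed.

(* Induction on the length of the sides and then on the area of a region they bound:
   either the sides meet, or one of them can be pushed, or Gauss-Bonnet makes the
   region a single triangle. *)
Lemma triangle_condition_path l v al be x y : (size al < l)%N -> edge x y ->
  lvl x = lvl y -> path up v al -> path up v be -> last v al = x -> last v be = y ->
  exists2 a, tri a x y & lvl x = (lvl a).+1.
Proof.
elim: l v al be x y => [//|l IHl] v.
pose cyc al' be' := v :: al' ++ [::] ++ rev be'.
have meet al' be' x' y' : (size al' < l.+1)%N -> edge x' y' -> lvl x' = lvl y' ->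
    path up v al' -> path up v be' -> last v al' = x' -> last v be' = y' -> has (mem al') be' ->
    exists2 a, tri a x' y' & lvl x' = (lvl a).+1.
  move=> ss xy lxy pa pb la lb /has_split[p1 [p2 [q1 [q2 [w [ea eb]]]]]].
  move: pa pb la lb ss; rewrite ea eb !cat_path !last_cat /= => /and3P[_ _ pp] /and3P[_ _ pq] lp lq.
  rewrite size_cat /= => ss; apply: (IHl w p2 q2) => //.
  by move: ss; clear; lia.
suff IHA n A al' be' x' y' : (#|A| < n)%N -> A \subset Tr ->
    (size al' < l.+1)%N -> edge x' y' -> lvl x' = lvl y' -> path up v al' -> path up v be' ->
    last v al' = x' -> last v be' = y' -> ~~ has (mem al') be' ->
    bounds Ed A (cycle_edges (cyc al' be')) ->
    exists2 a, tri a x' y' & lvl x' = (lvl a).+1.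
  move=> al be x y sal xy lxy pa pb la lb; have sab := bigon_size pa pb la lb lxy.
  have [me|dis] := boolP (has (mem al) be); first exact: meet me.
  case: al be => [|a1 al] [|b1 be] // in sal pa pb la lb sab dis *.
    by move: xy; rewrite -la -lb => /(edge_neq surf); rewrite eqxx.
  have cE : cycle edge (cyc (a1 :: al) (b1 :: be)).
    by apply: bigon_cycle; rewrite // /= in la lb *; rewrite la lb xy.
  have cU : uniq (cyc (a1 :: al) (b1 :: be)) by apply: bigon_uniq.
  have sc : (3 <= size (cyc (a1 :: al) (b1 :: be)))%N by rewrite /= size_cat size_rev /= addnS.
  have [A ATr bA] := cycle_filling surf cU sc cE.
  exact: (IHA #|A|.+1 A _ _ _ _ (ltnSn _) ATr sal xy lxy pa pb la lb dis bA).
elim: n A al' be' x' y' => [//|n IHn] A al' be' x' y' An ATr sal xy lxy pa pb la lb dis bA.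
have sab := bigon_size pa pb la lb lxy.
have cE : cycle edge (cyc al' be') by apply: bigon_cycle; rewrite // /= la lb xy.
have cU : uniq (cyc al' be') by apply: bigon_uniq.
have push (al be : seq W) (p q b : W) : (size al < l.+1)%N -> edge p q -> lvl p = lvl q ->
    path up v al -> path up v be -> last v al = p -> last v be = q -> ~~ has (mem al) be ->
    bounds Ed A (cycle_edges (cyc al be)) -> b \in al -> b != p -> (corner_count A b <= 2)%N ->
    exists2 a, tri a p q & lvl p = (lvl a).+1.
  move=> ssa pq lpq pal pbe lal lbe dsj bAc bal bp cb.
  have ssb := bigon_size pal pbe lal lbe lpq.
  have cEc : cycle edge (cyc al be) by apply: bigon_cycle; rewrite // /= lal lbe pq.
  have cUc : uniq (cyc al be) by apply: bigon_uniq.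
  have [a1 [a2 eal]] : exists a1 a2 : seq W, al = a1 ++ b :: a2 by case/splitPr: bal => a1 a2; exists a1, a2.
  case: a2 eal => [|d a2] eal; first by move: bp; rewrite -lal eal last_cat eqxx.
  have cycE u : cyc (a1 ++ [:: u, d & a2]) be = belast v a1 ++ [:: last v a1, u, d & a2 ++ rev be].
    by rewrite -[RHS]cat_rcons -lastI /cyc /= -catA.
  move: pal; rewrite eal cat_path /= => /and4P[pa1 ab bd pa2].
  have := @geodesic_push A (belast v a1) (a2 ++ rev be) (last v a1) b d.
  rewrite -cycE -eal => /(_ cUc cEc ATr bAc ab bd cb)[b' [t1 _ ab' b'd h]].
  have pal' : path up v (a1 ++ [:: b', d & a2]) by rewrite cat_path /= pa1 ab' b'd.
  have lal' : last v (a1 ++ [:: b', d & a2]) = p by rewrite -lal eal !last_cat.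
  have ssa' : (size (a1 ++ [:: b', d & a2]) < l.+1)%N.
    by apply: leq_trans ssa; rewrite eal !size_cat.
  have [me|dis'] := boolP (has (mem (a1 ++ [:: b', d & a2])) be).
    exact: meet ssa' pq lpq pal' pbe lal' lbe me.
  (* The vertex [b'] is not on the circuit: its level excludes [v], on its own side it could only be
     [b], and on the other side it would make the new sides meet. *)
  have [|A' [A'Tr A'A bA']] := h.
    rewrite /cyc inE !mem_cat !negb_or in_nil mem_rev; apply/and3P; split.
    - apply: contraTneq ab' => ->; apply/negP => /upE.
      by rewrite (up_path_last pa1); clear; lia.
    - have pal : path up v al by rewrite eal cat_path /= pa1 ab bd.
      apply/negP => b'al; have := up_path_inj pal b'al bal; rewrite (upE ab) (upE ab').
      by move=> /(_ erefl) bb; move: t1; rewrite /tri bb eqxx /= !andbF.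
    - apply/negP => b'be; case/negP: dis'; apply/hasP; exists b' => //=.
      by rewrite mem_cat inE eqxx orbT.
  apply: (IHn A' (a1 ++ [:: b', d & a2]) be) => //; last by rewrite cycE.
  exact: leq_trans A'A _.
have [/allP ga|/allPn[b ba]] := boolP (all (fun b => (b == x') || (3 <= corner_count A b)%N) al'); last first.
  by rewrite negb_or -ltnNge => /andP[bx cb]; apply: (push al' be' x' y' b).
have [/allP gb|/allPn[b bb]] := boolP (all (fun b => (b == y') || (3 <= corner_count A b)%N) be'); last first.
  rewrite negb_or -ltnNge => /andP[bx cb].
  have [|||||a t la'] := push be' al' y' x' b _ _ _ pb pa lb la _ _ bb bx cb => //.
  - by rewrite -sab.
  - by rewrite edge_sym.
  - by rewrite has_sym.
  - by rewrite -(@cycle_edges_flip v be' [::] al') //; apply: bigon_uniq; rewrite // has_sym.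
  by exists a; rewrite ?lxy // triC23.
have al0 : al' != [::].
  apply: contraTneq xy => al0; move: sab; rewrite -la -lb al0 /= => /esym/size0nil ->.
  by apply/negP => /(edge_neq surf); rewrite eqxx.
have be0 : be' != [::] by rewrite -size_eq0 -sab size_eq0.
case: (lastP al') al0 => [|al x1] // _ in la pa sal dis bA sab cE cU ga *.
case: (lastP be') be0 => [|be y1] // _ in lb pb dis bA sab cE cU gb *.
move: la lb; rewrite !last_rcons => ? ?; subst x1 y1.
have cycE : cyc (rcons al x') (rcons be y') = belast v al ++ [:: last v al, x', y' & rev be].
  by rewrite -[RHS]cat_rcons -lastI /cyc rev_rcons /= -cats1 -catA.
have sc : (3 <= size (cyc (rcons al x') (rcons be y')))%N by rewrite cycE size_cat /= !addnS.
(* All vertices but [v], [x'] and [y'] have at least 3 corners and these three at least 1, so the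
   sum is at least 3 size - 6. Gauss-Bonnet gives the opposite inequality, hence equality in every
   term. *)
have c1 : corner_count A x' = 1%N.
  have := cycle_gauss_bonnet surf cU sc cE ATr bA.
  have posc u : u \in cyc (rcons al x') (rcons be y') -> (0 < corner_count A u)%N.
    by move=> hu; exact: (cycle_corner_gt0 cE bA hu).
  have p1 := posc v (mem_head _ _).
  have p2 : (0 < corner_count A x')%N by apply: posc; rewrite cycE mem_cat !inE eqxx !orbT.
  have p3 : (0 < corner_count A y')%N by apply: posc; rewrite cycE mem_cat !inE eqxx !orbT.
  have := up_path_uniq pa; have := up_path_uniq pb.
  rewrite /= !rcons_uniq => /and3P[_ yb _] /and3P[_ xa _].
  have {}ga : (3 * size al <= \sum_(u <- al) corner_count A u)%N.
    apply: sum_corner_ge => u ua; have := ga u; rewrite mem_rcons inE ua orbT => /(_ isT).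
    by case: eqP ua xa => [-> ->|].
  have {}gb : (3 * size be <= \sum_(u <- be) corner_count A u)%N.
    apply: sum_corner_ge => u ub; have := gb u; rewrite mem_rcons inE ub orbT => /(_ isT).
    by case: eqP ub yb => [-> ->|].
  rewrite /cyc big_cons !big_cat big_nil (perm_big _ (permEl (perm_rev _))) /=.
  rewrite -!cats1 !big_cat !big_seq1 /= size_cat size_rev !size_cat /=.
  move: p1 p2 p3 ga gb; clear; move: (corner_count A v) (corner_count A x') (corner_count A y').
  by move: (\sum_(u <- al) _)%N (\sum_(u <- be) _)%N (size al) (size be); lia.
have xc : x' \in cyc (rcons al x') (rcons be y') by rewrite cycE mem_cat !inE eqxx !orbT.
have nx : y' = next (cyc (rcons al x') (rcons be y')) x'.
  rewrite cycE -cat_rcons next_split // cat_rcons -cycE //.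
have px : last v al = prev (cyc (rcons al x') (rcons be y')) x'.
  have nl : next (cyc (rcons al x') (rcons be y')) (last v al) = x'.
    by move: cU; rewrite cycE; exact: next_split.
  by have := prev_next cU (last v al); rewrite nl => ->.
have upx : up (last v al) x' by move: pa; rewrite rcons_path => /andP[].
have := cycle_corner_le2 surf cU sc cE ATr bA xc px nx; rewrite c1 => /(_ isT)[T|[] //].
exists (last v al); last exact: upE.
have /andP[ax _] := upx; rewrite /tri (edge_neq surf ax) (edge_neq surf xy) (subsetP ATr _ T) andbT /=.
by apply/eqP => ay; move: (upE upx); rewrite lxy -ay; clear; lia.
Qed.

Lemma triangle_condition x y : edge x y -> lvl x = lvl y -> (lvl x < N)%N ->
  exists2 a, tri a x y & lvl x = (lvl a).+1.
Proof.
move=> xy lxy xN; have [p pp lp] := geodesic xN.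
have [|q pq lq] := @geodesic y; first by rewrite -lxy.
exact: (triangle_condition_path (ltnSn _) xy lxy pp pq lp lq).
Qed.

Lemma tri_neq x y z : tri x y z -> [/\ x != y, y != z & x != z].
Proof. by case/and4P. Qed.

Lemma two_in_link (Z : {set W}) u y i j : i != j -> i \in Z -> j \in Z -> tri u y i -> tri u y j ->
  (2 <= #|[set z in Z | tri u y z]|)%N.
Proof.
move=> ij iZ jZ ti tj; have <- : #|[set i; j]| = 2%N by rewrite cards2 ij.
by apply/subset_leq_card/subsetP => z; rewrite !inE => /orP[] /eqP ->; apply/andP.
Qed.

Lemma up_tri a x y : tri a x y -> lvl x = (lvl a).+1 -> up a x.
Proof. by move=> t l; rewrite /up (tri_edge surf t) l eqxx. Qed.

(* Three consecutive parents of x would close, through the parents of the middle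
   one, a link cycle of length at most 5. *)
Lemma no_parent_fan x y b z :
  (forall p q : W, up p b -> up q b -> p != q -> tri b p q) ->
  up y x -> up b x -> up z x -> (lvl b < N)%N -> y != z ->
  tri x y b -> tri x b z -> False.
Proof.
move=> IHb yx bx zx bN yz t1 t2.
have lyb : lvl y = lvl b by apply/eqP; rewrite -eqSS -(upE yx) -(upE bx).
have lzb : lvl z = lvl b by apply/eqP; rewrite -eqSS -(upE zx) -(upE bx).
have [_ yxb ybx bxy byx] := tri_perm t1; have [_ bxz bzx _ _] := tri_perm t2.
have yb : edge y b := tri_edge surf ybx.
have bz : edge b z := tri_edge surf bzx.
have [|p tp lp] := triangle_condition yb lyb; first by rewrite lyb.
have [q tq lq] := triangle_condition bz (esym lzb) bN.
have pb : up p b by apply: (up_tri (y := y)); rewrite 1?triC23 // -lyb.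
have qb : up q b by apply: up_tri tq lq.
have px : p != x by apply/eqP => e; move: (upE pb) (upE bx); rewrite e; clear; lia.
have qx : q != x by apply/eqP => e; move: (upE qb) (upE bx); rewrite e; clear; lia.
have py : p != y by apply/eqP => e; move: lp; rewrite e; clear; lia.
have qz : q != z by apply/eqP => e; move: lq; rewrite -lzb e; clear; lia.
have pz : p != z by apply/eqP => e; move: (upE pb); rewrite -lzb e; clear; lia.
have qy : q != y by apply/eqP => e; move: (upE qb); rewrite -lyb e; clear; lia.
have [_ _ _ bpy byp] := tri_perm tp; have [_ bqz bzq _ _] := tri_perm tq.
have [pq|pq] := eqVneq p q.
  have : (6 <= #|[set x; y; z; p]|)%N.
    apply: (link_girth surf (x := b)); first by apply/set0Pn; exists x; rewrite !inE eqxx.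
    move=> u; rewrite !inE => /orP[/orP[/orP[]|]|] /eqP ->.
    - by apply: (@two_in_link _ _ _ y z); rewrite // !inE eqxx ?orbT.
    - by apply: (@two_in_link _ _ _ x p); rewrite 1?eq_sym // !inE eqxx ?orbT.
    - by apply: (@two_in_link _ _ _ x p); rewrite 1?eq_sym ?pq // !inE ?pq eqxx ?orbT.
    - by apply: (@two_in_link _ _ _ y z); rewrite // ?pq // !inE eqxx ?orbT.
  by rewrite leqNgt ltnS; case/negP; rewrite -!setUA !cardsU1 cards1; do !case: (_ \notin _).
have bpq := IHb p q pb qb pq.
have bqp : tri b q p by rewrite triC23.
have : (6 <= #|[set x; y; z; p; q]|)%N.
  apply: (link_girth surf (x := b)); first by apply/set0Pn; exists x; rewrite !inE eqxx.
  move=> u; rewrite !inE => /orP[/orP[/orP[/orP[]|]|]|] /eqP ->.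
  - by apply: (@two_in_link _ _ _ y z); rewrite // !inE eqxx ?orbT.
  - by apply: (@two_in_link _ _ _ x p); rewrite 1?eq_sym // !inE eqxx ?orbT.
  - by apply: (@two_in_link _ _ _ x q); rewrite 1?eq_sym // !inE eqxx ?orbT.
  - by apply: (@two_in_link _ _ _ y q); rewrite 1?eq_sym // !inE eqxx ?orbT.
  - by apply: (@two_in_link _ _ _ z p); rewrite 1?eq_sym // !inE eqxx ?orbT.
by rewrite leqNgt ltnS; case/negP; rewrite -!setUA !cardsU1 cards1; do !case: (_ \notin _).
Qed.

(** The same double induction, now with [x] on top of the bigon. Gauss-Bonnet always leaves a vertex
    to push; a push below the top keeps [y] and shrinks the region. A push of [y] itself yields a
    parent [b'] joined to [y] in the link of [x]: either [b'] is [z], or y, b', z form the fan that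
    [no_parent_fan] excludes. *)
Lemma parents_adjacent_path x l v al be y z :
  (forall b p q : W, (lvl b < lvl x)%N -> up p b -> up q b -> p != q -> tri b p q) -> (lvl x <= N)%N ->
  (size al < l)%N -> up y x -> up z x -> y != z ->
  path up v al -> path up v be -> last v al = y -> last v be = z -> tri x y z.
Proof.
move=> IHx xN; elim: l v al be y z => [//|l IHl] v.
pose cyc al' be' := v :: al' ++ [:: x] ++ rev be'.
have lev y z : up y x -> up z x -> lvl y = lvl z.
  by move=> yx zx; apply/eqP; rewrite -eqSS -(upE yx) -(upE zx).
have meet (al be : seq W) y z : (size al < l.+1)%N -> up y x -> up z x -> y != z ->
    path up v al -> path up v be -> last v al = y -> last v be = z -> has (mem al) be -> tri x y z.
  move=> ss yx zx yz pa pb la lb /has_split[p1 [p2 [q1 [q2 [w [ea eb]]]]]].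
  move: pa pb la lb ss; rewrite ea eb !cat_path !last_cat /= => /and3P[_ _ pp] /and3P[_ _ pq] lp lq.
  rewrite size_cat /= => ss; apply: (IHl w p2 q2) => //.
  by move: ss; clear; lia.
have config (al be : seq W) y z : up y x -> up z x -> y != z -> path up v al -> path up v be ->
    last v al = y -> last v be = z -> ~~ has (mem al) be ->
    [/\ cycle edge (cyc al be), uniq (cyc al be) & (3 <= size (cyc al be))%N].
  move=> yx zx yz pa pb la lb dis; have sab := bigon_size pa pb la lb (lev _ _ yx zx).
  split.
  - apply: bigon_cycle => //; rewrite la lb /= andbT.
    by have /andP[-> _] := yx; rewrite edge_sym; have /andP[-> _] := zx.
  - apply: bigon_uniq => // u; rewrite inE => /eqP ->.
    by rewrite -(up_path_last pa) la (upE yx).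
  - case: al be {dis pb sab pa} la lb => [|a1 al] [|b1 be] /=.
    + by move=> e1 e2; move: yz; rewrite -e1 -e2 eqxx.
    + by rewrite rev_cons size_rcons.
    + by rewrite size_cat /= addnS.
    + by rewrite size_cat /= addnS.
suff IHA n A (al be : seq W) y z : (#|A| < n)%N -> A \subset Tr ->
    (size al < l.+1)%N -> up y x -> up z x -> y != z -> path up v al -> path up v be ->
    last v al = y -> last v be = z -> ~~ has (mem al) be ->
    bounds Ed A (cycle_edges (cyc al be)) -> tri x y z.
  move=> al be y z sal yx zx yz pa pb la lb.
  have [me|dis] := boolP (has (mem al) be); first exact: (meet al be).
  have [cE cU sc] := config al be y z yx zx yz pa pb la lb dis.
  have [A ATr bA] := cycle_filling surf cU sc cE.
  exact: (IHA #|A|.+1 A al be).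
elim: n A al be y z => [//|n IHn] A al' be' y' z' An ATr sal yx zx yz pa pb la lb dis bA.
have sab := bigon_size pa pb la lb (lev _ _ yx zx).
have [cE cU sc] := config al' be' y' z' yx zx yz pa pb la lb dis.
have push (al be : seq W) (y z b : W) : (size al < l.+1)%N -> up y x -> up z x -> y != z ->
    path up v al -> path up v be -> last v al = y -> last v be = z -> ~~ has (mem al) be ->
    bounds Ed A (cycle_edges (cyc al be)) -> b \in al -> (corner_count A b <= 2)%N -> tri x y z.
  move=> ssa yx' zx' yz' pal pbe lal lbe dsj bAc bal cb.
  have [cEc cUc _] := config al be y z yx' zx' yz' pal pbe lal lbe dsj.
  have [a1 [a2 eal]] : exists a1 a2 : seq W, al = a1 ++ b :: a2 by case/splitPr: bal => a1 a2; exists a1, a2.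
  have [d [s eds]] : exists d (s : seq W), rcons a2 x = d :: s.
    by case: (a2) => [|d s]; [exists x, [::] | exists d, (rcons s x)].
  have cycE u : cyc (a1 ++ u :: a2) be = belast v a1 ++ [:: last v a1, u, d & s ++ rev be].
    have e2 : a2 ++ x :: rev be = d :: s ++ rev be by rewrite -cat_rcons eds.
    by rewrite -[RHS]cat_rcons -lastI /cyc /= -!catA /= e2.
  have palx : path up v (rcons al x) by rewrite rcons_path pal lal.
  move: palx; rewrite eal rcons_cat rcons_cons eds cat_path /= => /and4P[pa1 ab bd pds].
  have := @geodesic_push A (belast v a1) (s ++ rev be) (last v a1) b d.
  rewrite -cycE -eal => /(_ cUc cEc ATr bAc ab bd cb)[b' [t1 t2 ab' b'd h]].
  pose y1 := last v (a1 ++ b' :: a2).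
  have : path up v (rcons (a1 ++ b' :: a2) x).
    by rewrite rcons_cat rcons_cons eds cat_path /= pa1 ab' b'd.
  rewrite rcons_path -/y1 => /andP[pal' y1x].
  have ssa' : (size (a1 ++ b' :: a2) < l.+1)%N.
    by apply: leq_trans ssa; rewrite eal !size_cat.
  have key : y1 != z -> tri x y1 z.
    move=> y1z; have [me|dis'] := boolP (has (mem (a1 ++ b' :: a2)) be).
      exact: (meet _ be _ _ ssa' y1x zx' y1z pal' pbe).
    have [|A' [A'Tr A'A bA']] := h.
      rewrite /cyc inE !mem_cat inE !negb_or mem_rev; apply/and4P; split.
      - apply: contraTneq ab' => ->; apply/negP => /upE.
        by rewrite (up_path_last pa1); clear; lia.
      - apply/negP => b'al; have := up_path_inj pal b'al bal; rewrite (upE ab) (upE ab').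
        by move=> /(_ erefl) bb; move: t1; rewrite /tri bb eqxx /= !andbF.
      - apply: contraTneq ab' => ->; apply/negP => /upE.
        have bp : b \in al := bal.
        have /andP[_] := up_path_mem pal bp; rewrite -(up_path_last pal) lal (upE yx') (upE ab) => h1 h2.
        by move: h1 h2; clear; lia.
      - apply/negP => b'be; case/negP: dis'; apply/hasP; exists b' => //=.
        by rewrite mem_cat inE eqxx orbT.
    apply: (IHn A' (a1 ++ b' :: a2) be) => //; last by rewrite cycE.
    exact: leq_trans A'A _.
  (* An empty [a2] means that the pushed vertex is the top one, [y]. *)
  case: a2 eal eds @y1 pal' y1x ssa' key cycE h => [|d' a2] eal eds y1 pal' y1x ssa' key cycE h.
    have yb : y = b by rewrite -lal eal last_cat.
    have y1b : y1 = b' by rewrite /y1 last_cat.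
    have dx : d = x by case: eds.
    have xyb' : tri x y b' by rewrite yb -dx; have [] := tri_perm t2.
    have [b'z|b'z] := eqVneq b' z; first by rewrite -b'z.
    exfalso; apply: (no_parent_fan _ yx' _ zx' _ yz' xyb' _); rewrite -?y1b //.
    - by move=> p q; apply: IHx; rewrite (upE y1x).
    - by rewrite -(upE y1x).
    - by apply: key; rewrite y1b.
  have y1y : y1 = y by rewrite /y1 -lal eal !last_cat.
  by rewrite -y1y; apply: key; rewrite y1y.
have [/allP ga|/allPn[b ba]] := boolP (all (fun b => 3 <= corner_count A b)%N al'); last first.
  by rewrite -ltnNge => cb; apply: (push al' be' y' z' b).
have [/allP gb|/allPn[b bb]] := boolP (all (fun b => 3 <= corner_count A b)%N be'); last first.
  rewrite -ltnNge => cb; rewrite triC23; apply: (push be' al' z' y' b) => //.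
  - by rewrite -sab.
  - by rewrite eq_sym.
  - by rewrite has_sym.
  - rewrite -(@cycle_edges_flip v be' [:: x] al') //.
    have zy : z' != y' by rewrite eq_sym.
    have dis2 : ~~ has (mem be') al' by rewrite has_sym.
    by have [] := config be' al' z' y' zx yx zy pb pa lb la dis2.
(* Only [v] and [x] can now have fewer than 3 corners, and each has at least 1, so the sum is at
   least 3 size - 4: a contradiction. *)
have := cycle_gauss_bonnet surf cU sc cE ATr bA.
have p1 := cycle_corner_gt0 cE bA (mem_head _ _).
have p2 : (0 < corner_count A x)%N by apply: (cycle_corner_gt0 cE bA); rewrite /cyc inE !mem_cat inE eqxx !orbT.
have {}ga := sum_corner_ge ga; have {}gb := sum_corner_ge gb.
rewrite /cyc big_cons !big_cat big_seq1 (perm_big _ (permEl (perm_rev _))) /=.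
rewrite size_cat /= size_rev.
move: p1 p2 ga gb; clear; move: (corner_count A v) (corner_count A x).
by move: (\sum_(u <- al') _)%N (\sum_(u <- be') _)%N (size al') (size be'); lia.
Qed.

Lemma parents_adjacent x y z : (lvl x <= N)%N -> up y x -> up z x -> y != z -> tri x y z.
Proof.
move: {2}(lvl x).+1 (ltnSn (lvl x)) => n; elim: n x y z => // n IH x y z xn xN yx zx yz.
have reach u : up u x -> (lvl u < N)%N by move/upE => e; rewrite -e.
have [p pp lp] := geodesic (reach y yx); have [q pq lq] := geodesic (reach z zx).
apply: (parents_adjacent_path _ xN (ltnSn _) yx zx yz pp pq lp lq) => b p' q' bx p'b q'b pq'.
by apply: IH => //; [exact: leq_trans bx _ | exact: leq_trans (ltnW bx) xN].
Qed.

Lemma card_set_sum (P : pred W) : #|[set z | P z]| = (\sum_z P z)%N.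
Proof. by rewrite -sum1_card big_mkcond; apply: eq_bigr => z _; rewrite inE; case: (P z). Qed.

Definition parents x : {set W} := [set y | up y x].
Definition siblings x : {set W} := [set y | edge x y & lvl y == lvl x].

Lemma level_near x y : edge x y -> [|| (lvl y).+1 == lvl x, lvl y == lvl x | lvl y == (lvl x).+1].
Proof.
move=> xy; have := lvl_edge xy; have := xy; rewrite edge_sym => /lvl_edge.
by move: (lvl x) (lvl y); clear; lia.
Qed.

Section SphereVertex.
Variable x : W.
Hypotheses (x_gt0 : (0 < lvl x)%N) (x_N : (lvl x < N)%N).
Hypothesis x_full : forall y, edge x y -> #|[set z | tri x y z]| = 2%N.

Let xN : (lvl x <= N)%N. Proof. exact: ltnW. Qed.

Let clique_parents y z : y \in parents x -> z \in parents x -> y != z -> tri x y z.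
Proof. by rewrite !inE; exact: parents_adjacent. Qed.

(** One parent comes from [triangle_condition]. Two would close with [y] a link cycle of length
    3. *)
Lemma sibling_apex_down y : y \in siblings x -> #|[set z in parents x | tri x y z]| = 1%N.
Proof.
rewrite inE => /andP[xy /eqP lyx].
have [p tp lp] := triangle_condition xy (esym lyx) x_N.
have [_ _ xyp _ _] := tri_perm tp.
have pP : p \in parents x by rewrite inE (up_tri tp lp).
apply/eqP/cards1P; exists p; apply/setP => q; rewrite !inE; apply/andP/eqP => [[qx xyq]|->]; last first.
  by rewrite inE in pP.
apply/eqP/negPn/negP => qp.
have qP : q \in parents x by rewrite inE.
have xqp := clique_parents qP pP qp.
have [xpq _ _ _ _] := tri_perm xqp; have [xqy _ _ _ _] := tri_perm xyq.
have [xpy _ _ _ _] := tri_perm xyp.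
have [_ yq _] := tri_neq xyq; have [_ yp _] := tri_neq xyp.
have : (6 <= #|[set y; p; q]|)%N.
  apply: (link_girth surf (x := x)); first by apply/set0Pn; exists y; rewrite !inE eqxx.
  move=> u; rewrite !inE => /orP[/orP[]|] /eqP ->.
  - by apply: (@two_in_link _ _ _ p q); rewrite 1?eq_sym // !inE eqxx ?orbT.
  - by apply: (@two_in_link _ _ _ y q); rewrite // !inE eqxx ?orbT.
  - by apply: (@two_in_link _ _ _ y p); rewrite // !inE eqxx ?orbT.
by rewrite leqNgt ltnS; case/negP; rewrite -!setUA !cardsU1 cards1; do !case: (_ \notin _).
Qed.

(** The parents attached to the edges from [x] to [y] and to [z], equal or adjacent, would close a
    link cycle of length 3 or 4. *)
Lemma no_flat_triangle y z : y \in siblings x -> z \in siblings x -> ~~ tri x y z.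
Proof.
move=> ys zs; apply/negP => xyz; have [_ yz _] := tri_neq xyz.
have [xzy _ _ _ _] := tri_perm xyz.
have ap u : u \in siblings x -> exists p : W, [/\ p \in parents x, tri x u p & p != u].
  move=> us; have := sibling_apex_down us => /eqP/cards1P[p /setP/(_ p)].
  rewrite !inE eqxx => /andP[px xup]; exists p; rewrite inE px; split=> //.
  by have [_ up _] := tri_neq xup; rewrite eq_sym.
have [p [pP xyp py]] := ap _ ys; have [q [qP xzq qz]] := ap _ zs.
have [xpy _ _ _ _] := tri_perm xyp; have [xqz _ _ _ _] := tri_perm xzq.
have diff u v : u \in parents x -> v \in siblings x -> u != v.
  rewrite !inE => /upE ux /andP[_ /eqP vx]; apply/eqP => uv.
  by move: ux; rewrite uv vx; clear; lia.
have [pq|pq] := eqVneq p q.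
  have : (6 <= #|[set y; z; p]|)%N.
    apply: (link_girth surf (x := x)); first by apply/set0Pn; exists y; rewrite !inE eqxx.
    move=> u; rewrite !inE => /orP[/orP[]|] /eqP ->.
    - by apply: (@two_in_link _ _ _ p z); rewrite ?diff // !inE eqxx ?orbT.
    - by apply: (@two_in_link _ _ _ p y); rewrite ?diff ?pq // !inE ?eqxx ?orbT.
    - by apply: (@two_in_link _ _ _ y z); rewrite ?pq // ?inE -?pq ?eqxx ?orbT.
  by rewrite leqNgt ltnS; case/negP; rewrite -!setUA !cardsU1 cards1; do !case: (_ \notin _).
have xpq := clique_parents pP qP pq; have [xqp _ _ _ _] := tri_perm xpq.
have : (6 <= #|[set y; z; p; q]|)%N.
  apply: (link_girth surf (x := x)); first by apply/set0Pn; exists y; rewrite !inE eqxx.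
  move=> u; rewrite !inE => /orP[/orP[/orP[]|]|] /eqP ->.
  - by apply: (@two_in_link _ _ _ p z); rewrite ?diff // !inE eqxx ?orbT.
  - by apply: (@two_in_link _ _ _ q y); rewrite ?diff // !inE eqxx ?orbT.
  - by apply: (@two_in_link _ _ _ q y); rewrite ?diff // !inE eqxx ?orbT.
  - by apply: (@two_in_link _ _ _ p z); rewrite ?diff // !inE eqxx ?orbT.
by rewrite leqNgt ltnS; case/negP; rewrite -!setUA !cardsU1 cards1; do !case: (_ \notin _).
Qed.

Let split_full (y : W) : edge x y ->
  (#|[set z in parents x | tri x y z]| + #|[set z in siblings x | tri x y z]|
   + #|[set z | (lvl z == (lvl x).+1) && tri x y z]|)%N = 2%N.
Proof.
move=> xy; rewrite -(x_full xy) !card_set_sum -!big_split.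
apply: eq_bigr => z _; rewrite !inE; case: (boolP (tri x y z)) => xyz; rewrite ?andbF // !andbT.
have xz : edge x z by have [xzy _ _ _ _] := tri_perm xyz; exact: (tri_edge surf xzy).
rewrite /up [edge z x]edge_sym xz /= eq_sym; have := level_near xz.
by move: (lvl x) (lvl z); clear; lia.
Qed.

Lemma sibling_apex_up y : y \in siblings x -> #|[set z | (lvl z == (lvl x).+1) && tri x y z]| = 1%N.
Proof.
move=> ys; have xy : edge x y by move: ys; rewrite inE => /andP[].
have := split_full xy; rewrite sibling_apex_down // (_ : [set z in siblings x | _] = set0) ?cards0.
  by move/eqP; rewrite addn0 eqSS => /eqP.
by apply/setP => z; rewrite in_set0 in_set; apply/negP => /andP[zs]; apply/negP; exact: no_flat_triangle.
Qed.

Let other_parents (q : W) : q \in parents x -> [set z in parents x | tri x q z] = parents x :\ q.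
Proof.
move=> qP; apply/setP => z; rewrite in_setD1 in_set; apply/andP/andP => [[zP /tri_neq[_ qz _]]|[zq zP]].
  by rewrite eq_sym.
by split=> //; apply: clique_parents; rewrite // eq_sym.
Qed.

(** Parents are pairwise joined in the link of [x]. Three of them would satisfy the condition of
    [link_girth] and force six, whereas [x_full] leaves each parent at most two others. *)
Lemma card_parents : (0 < #|parents x| <= 2)%N.
Proof.
have [p px lp] := lvl_pred x_gt0 x_N.
have pP : p \in parents x by rewrite inE /up px lp eqxx.
have pE : edge x p by rewrite edge_sym.
apply/andP; split; first by apply/card_gt0P; exists p.
have nb := other_parents.
rewrite leqNgt; apply/negP => P3.
have : (6 <= #|parents x|)%N.
  apply: (link_girth surf (x := x)); first by apply/set0Pn; exists p.
  by move=> q qP; rewrite nb // -ltnS; move: P3; rewrite (cardsD1 q) qP.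
have : (#|parents x :\ p| <= 2)%N by rewrite -(x_full pE) -nb //; apply/subset_leq_card/subsetP => z; rewrite !inE => /andP[].
by rewrite (cardsD1 p (parents x)) pP; case: #|_| => [|[|[|]]].
Qed.

(** Triangles formed by [x], a parent and a sibling are counted twice over: each sibling lies in
    one, and each of the m parents in 3 - m, two link neighbours less the m - 1 other parents. For m
    = 1 or 2 the total m (3 - m) is 2. *)
Lemma card_siblings : #|siblings x| = 2%N.
Proof.
have nb := other_parents.
have fromP (q : W) : q \in parents x -> (#|parents x| + #|[set z in siblings x | tri x q z]|)%N = 3%N.
  move=> qP; have qx : edge x q by move: qP; rewrite inE => /andP[]; rewrite edge_sym.
  have := split_full qx; rewrite nb // (_ : [set z | (lvl z == _) && _] = set0) ?cards0.
    by rewrite (cardsD1 q (parents x)) qP addn0 -addnA => ->.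
  apply/setP => z; rewrite !inE; apply/negP => /andP[/eqP lz /tri_perm[_ _ qz _ _]].
  have := lvl_edge (tri_edge surf qz); rewrite lz.
  by move: qP; rewrite inE => /upE ->; rewrite ltnn.
have dc : (\sum_(y in siblings x) #|[set z in parents x | tri x y z]| =
           \sum_(q in parents x) #|[set y in siblings x | tri x q y]|)%N.
  have cE (X : {set W}) (P : pred W) : #|[set z in X | P z]| = (\sum_(z in X) P z)%N.
    rewrite -sum1_card big_mkcond [RHS]big_mkcond; apply: eq_bigr => z _.
    by rewrite inE; case: (z \in X); case: (P z).
  rewrite (eq_bigr (fun y => \sum_(z in parents x) tri x y z)%N) => [|y _]; last exact: cE.
  rewrite exchange_big; apply: eq_bigr => q _ /=; rewrite cE; apply: eq_bigr => y _.
  by rewrite triC23.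
move: dc; rewrite (eq_bigr (fun=> 1%N)) ?sum1_card; last exact: sibling_apex_down.
rewrite (eq_bigr (fun=> 3 - #|parents x|)%N) ?sum_nat_const; last first.
  by move=> q /fromP <-; rewrite addKn.
by move=> ->; have := card_parents; case: #|parents x| => [|[|[|]]].
Qed.

End SphereVertex.

End Levels.

(** * Counting triangles between consecutive spheres *)

Section SphereCounting.
Variables (W : finType) (Tr Ed : {set {set W}}).
Implicit Types (x y z u : W) (k j : nat) (i : bool).
Hypothesis surf : systolic_surface Tr Ed.
Variables (lvl : W -> nat) (N : nat) (v0 : W).
Notation edge := (edge Ed).
Notation tri := (tri Tr).
Hypothesis lvl_edge : forall x y, edge x y -> (lvl y <= (lvl x).+1)%N.
Hypothesis lvl_pred : forall x, (0 < lvl x)%N -> (lvl x < N)%N ->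
  exists2 y, edge y x & lvl x = (lvl y).+1.
Hypothesis lvl0 : forall x, lvl x = 0%N -> x = v0.
Variables (isS : pred W) (s t n : nat).
Hypothesis nN : (n < N)%N.
Hypothesis full : forall x y, (lvl x <= n)%N -> edge x y -> #|[set z | tri x y z]| = 2%N.
Hypothesis degree : forall x, (lvl x <= n)%N -> #|[set y | edge x y]| = if isS x then s else t.
Hypothesis one_S : forall x y z, tri x y z -> (lvl x <= n)%N -> (lvl y <= n)%N -> (lvl z <= n)%N ->
  (isS x + isS y + isS z = 1)%N.

Definition sphere_count k i : nat := #|[set x | (lvl x == k) && (isS x == i)]|.

(* Ordered pairs, i.e. twice the number of edges of the sphere whose type
   forces a third vertex of type i. *)
Definition opposite_type i y z : bool :=
  if i then ~~ isS y && ~~ isS z else isS y != isS z.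

Definition sphere_pairs k (P : W -> W -> bool) : nat :=
  \sum_y \sum_z [&& edge y z, lvl y == k, lvl z == k & P y z].

Let lN x : (lvl x <= n)%N -> (lvl x < N)%N. Proof. by move/leq_ltn_trans; apply. Qed.

Let tri_edges x y z : tri x y z -> [/\ edge x y, edge y z & edge x z].
Proof.
move=> xyz; have [xzy yxz yzx _ _] := tri_perm xyz.
by split; [exact: (tri_edge surf xyz) | exact: (tri_edge surf yzx) | exact: (tri_edge surf xzy)].
Qed.

Let down_sum y z : (0 < lvl y)%N -> (lvl y <= n)%N -> lvl z = lvl y ->
  (\sum_x ((lvl x).+1 == lvl y) && tri x y z = edge y z)%N.
Proof.
move=> y0 yn lzy; case: (boolP (edge y z)) => yz; last first.
  apply: big1 => x _; case: (boolP (tri x y z)) => [/tri_edges[_ e _]|]; rewrite ?andbF //.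
  by rewrite e in yz.
have ys : z \in siblings Ed lvl y by rewrite inE yz lzy eqxx.
have := sibling_apex_down surf lvl_edge lvl_pred lvl0 (lN yn) ys; rewrite card_set_sum => h.
apply: etrans h; apply: eq_bigr => x _; congr nat_of_bool; rewrite inE.
apply/andP/andP => [[lx xyz]|[xy yzx]].
  have [_ _ yzx _ _] := tri_perm xyz; have [e _ _] := tri_edges xyz.
  by split=> //; rewrite /up e eq_sym.
by have [_ _ _ xyz _] := tri_perm yzx; split=> //; rewrite (upE xy).
Qed.

Let up_sum y z : (lvl y <= n)%N -> lvl z = lvl y ->
  (\sum_x (lvl x == (lvl y).+1) && tri x y z = edge y z)%N.
Proof.
move=> yn lzy; case: (boolP (edge y z)) => yz; last first.
  apply: big1 => x _; case: (boolP (tri x y z)) => [/tri_edges[_ e _]|]; rewrite ?andbF //.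
  by rewrite e in yz.
have y0 : (0 < lvl y)%N.
  rewrite lt0n; apply/eqP => ly; move: (edge_neq surf yz).
  by rewrite (lvl0 ly) (lvl0 (etrans lzy ly)) eqxx.
have ys : z \in siblings Ed lvl y by rewrite inE yz lzy eqxx.
have := sibling_apex_up surf lvl_edge lvl_pred lvl0 (lN yn) (fun u => full yn) ys.
rewrite card_set_sum => h; apply: etrans h; apply: eq_bigr => x _; congr nat_of_bool; congr (_ && _).
by apply/idP/idP => /tri_perm[].
Qed.

(** Both sides count ordered triangles at [x]. The 8 are those through a sibling: two siblings, one
    triangle up and one down for each, two orders. This is the origin of the 4 in S = s - 4 and T =
    t - 4. The other triangles have their opposite edge in the sphere below or above. *)
Lemma degree_split x : (0 < lvl x)%N -> (lvl x <= n)%N ->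
  (2 * #|[set y | edge x y]| = 8
   + \sum_y \sum_z [&& tri x y z, (lvl y).+1 == lvl x & (lvl z).+1 == lvl x]
   + \sum_y \sum_z [&& tri x y z, lvl y == (lvl x).+1 & lvl z == (lvl x).+1])%N.
Proof.
move=> x0 xn.
have fx y : edge x y -> #|[set z | tri x y z]| = 2%N by exact: full.
transitivity (\sum_y \sum_z tri x y z)%N.
  rewrite card_set_sum big_distrr /=; apply: eq_bigr => y _.
  case: (boolP (edge x y)) => xy; first by rewrite -card_set_sum fx.
  by rewrite muln0 big1 // => z _; case: (boolP (tri x y z)) => // /tri_edges[e]; rewrite e // in xy.
pose sib y : nat := y \in siblings Ed lvl x.
pose dn y z : nat := (z \in parents Ed lvl x) && tri x y z.
pose ab y z : nat := (lvl z == (lvl x).+1) && tri x y z.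
have sib2 y : (sib y * (\sum_z dn y z + \sum_z ab y z) = sib y * 2)%N.
  rewrite /sib; case: (boolP (y \in _)) => ys; rewrite ?mul0n // !mul1n.
  rewrite -!card_set_sum (sibling_apex_down surf lvl_edge lvl_pred lvl0 (lN xn) ys).
  by rewrite (sibling_apex_up surf lvl_edge lvl_pred lvl0 (lN xn) fx ys).
have sib4 : (\sum_y \sum_z sib y * (dn y z + ab y z) = 4)%N.
  rewrite (eq_bigr (fun y => sib y * 2))%N => [|y _]; last first.
    by rewrite -big_distrr /= big_split /= sib2.
  rewrite -big_distrl /= (_ : \sum_y sib y = 2)%N //.
  rewrite -(card_siblings surf lvl_edge lvl_pred lvl0 x0 (lN xn) fx) -sum1_card [RHS]big_mkcond.
  by apply: eq_bigr => y _; rewrite /sib; case: (_ \in _).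
have sib4' : (\sum_y \sum_z sib z * (dn z y + ab z y) = 4)%N by rewrite exchange_big.
rewrite -[8%N]/(4 + 4)%N -{1}sib4 -sib4' -!big_split /=; apply: eq_bigr => y _.
rewrite -!big_split /=; apply: eq_bigr => z _.
rewrite /sib /dn /ab [tri x z y]triC23.
case: (boolP (tri x y z)) => xyz; rewrite ?andbF ?muln0 //= !andbT.
have [xy yz xz] := tri_edges xyz.
have := level_near lvl_edge xy; have := level_near lvl_edge xz.
have := level_near lvl_edge yz.
have := @no_flat_triangle _ _ _ surf _ _ _ lvl_edge lvl_pred lvl0 x (lN xn) y z.
rewrite xyz !inE /up ![edge _ x]edge_sym xy xz /=.
move: (lvl x) (lvl y) (lvl z); clear => a b c.
by lia.
Qed.

Let type_of_apex i x y z : tri x y z -> (lvl x <= n)%N -> (lvl y <= n)%N -> (lvl z <= n)%N ->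
  (isS x == i) = opposite_type i y z.
Proof.
move=> xyz xn yn zn; have := one_S xyz xn yn zn.
by rewrite /opposite_type; case: i; case: (isS x); case: (isS y); case: (isS z).
Qed.

(** Double counting of apex against base, for k = j + 1 and k = j - 1: an edge of sphere j carries
    one triangle with apex on sphere k, and the types of its ends decide the type of the apex. *)
Let apex_count (r : rel nat) k j i : (j <= n)%N -> (k <= n)%N ->
  (forall a, r k a = (a == j)) ->
  (forall y z, lvl y = j -> lvl z = j -> (\sum_x (lvl x == k) && tri x y z = edge y z)%N) ->
  (\sum_(x | (lvl x == k) && (isS x == i)) \sum_y \sum_z
     [&& tri x y z, r (lvl x) (lvl y) & r (lvl x) (lvl z)] = sphere_pairs j (opposite_type i))%N.
Proof.
move=> jn kn rk apex; rewrite exchange_big /=; apply: eq_bigr => y _.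
rewrite exchange_big /=; apply: eq_bigr => z _.
rewrite big_mkcond /=.
have [/andP[/eqP ly /eqP lz]|nl] := boolP ((lvl y == j) && (lvl z == j)); last first.
  rewrite [RHS](_ : _ = 0%N); last by move: nl; case: (edge y z) => //=; case: eqP => //=; case: eqP.
  apply: big1 => x _; case: ifP => // /andP[/eqP -> _]; rewrite !rk.
  by rewrite (negPf nl) andbF.
rewrite ly lz !eqxx /= -[RHS]muln1 -mulnb -mulnA.
rewrite -(apex y z ly lz) big_distrl /=; apply: eq_bigr => x _.
case: (boolP (tri x y z)) => xyz; last by rewrite !andbF if_same.
rewrite !andbT; case: eqP => [lx|] //=; rewrite lx !rk !eqxx /= mul1n muln1.
by rewrite (type_of_apex i xyz) ?lx ?ly ?lz //; case: ifP.
Qed.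

Lemma sphere_recursion k i : (0 < k)%N -> (k < n)%N ->
  (2 * (if i then s else t) * sphere_count k i = 8 * sphere_count k i
   + sphere_pairs k.-1 (opposite_type i) + sphere_pairs k.+1 (opposite_type i))%N.
Proof.
move=> k0 kn; have kn' := ltnW kn.
have k1 : k.-1.+1 = k by rewrite prednK.
rewrite -(apex_count (r := fun a b => b.+1 == a) (k := k)) //; first last.
- move=> y z ly lz; rewrite -(up_sum (y := y)) ?ly ?k1 ?lz //.
  by rewrite (leq_trans (leq_pred k)).
- by move=> a; rewrite -{1}k1 eqSS.
- by rewrite (leq_trans (leq_pred k)).
rewrite -(apex_count (r := fun a b => b == a.+1) (k := k)) //; last first.
  by move=> y z ly lz; rewrite -(down_sum (y := y)) ?ly ?lz.
have cE c : (c * sphere_count k i = \sum_(x | (lvl x == k) && (isS x == i)) c)%N.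
  by rewrite sum_nat_const mulnC /sphere_count cardsE.
rewrite !cE -!big_split /=; apply: eq_bigr => x /andP[/eqP lx /eqP <-].
by rewrite -degree_split ?lx // degree ?lx.
Qed.

Let sibling_count k i : (0 < k)%N -> (k <= n)%N ->
  (2 * sphere_count k i = sphere_pairs k (fun x _ => isS x == i))%N.
Proof.
move=> k0 kn; rewrite /sphere_count cardsE mulnC -sum_nat_const big_mkcond.
apply: eq_bigr => x _; rewrite -topredE /=; case: (boolP (lvl x == k)) => /= [/eqP lx|lx]; last first.
  by rewrite big1 // => y _; rewrite andbF.
case: ifP => xi; last by rewrite big1 // => y _; rewrite !andbF.
have x0 : (0 < lvl x)%N by rewrite lx.
have xN : (lvl x < N)%N by rewrite lN // lx.
have xn : (lvl x <= n)%N by rewrite lx.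
rewrite -(card_siblings surf lvl_edge lvl_pred lvl0 x0 xN (fun y => full xn)) card_set_sum.
by apply: eq_bigr => y _; rewrite lx andbT.
Qed.

Let no_SS k x y : (0 < k)%N -> (k <= n)%N -> edge x y -> lvl x = k -> lvl y = k -> ~~ (isS x && isS y).
Proof.
move=> k0 kn xy lx ly.
have [|a axy la] := triangle_condition surf lvl_edge lvl_pred lvl0 xy (etrans lx (esym ly)).
  by rewrite lN // lx.
have an : (lvl a <= n)%N by rewrite ltnW // -la lx.
have := one_S axy an; rewrite lx ly => /(_ kn kn).
by case: (isS a); case: (isS x); case: (isS y).
Qed.

(** An s-vertex has two siblings, both t-vertices, and each such edge is counted in both orders. *)
Lemma sphere_mixed k : (0 < k)%N -> (k <= n)%N ->
  sphere_pairs k (opposite_type false) = (4 * sphere_count k true)%N.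
Proof.
move=> k0 kn; rewrite -[4%N]/(2 + 2)%N mulnDl sibling_count //.
have -> : (sphere_pairs k (fun x _ => isS x == true) + sphere_pairs k (fun x _ => isS x == true) =
  sphere_pairs k (fun x _ => isS x == true) + sphere_pairs k (fun _ y => isS y == true))%N.
  congr (_ + _)%N; rewrite /sphere_pairs [RHS]exchange_big /=; apply: eq_bigr => x _; apply: eq_bigr => y _.
  by rewrite edge_sym; case: (lvl x == k); case: (lvl y == k).
rewrite -big_split; apply: eq_bigr => x _; rewrite -big_split; apply: eq_bigr => y _ /=.
case: (boolP (edge x y)) => //= xy; case: eqP => //= lx; case: eqP => //= ly.
have := no_SS k0 kn xy lx ly; rewrite /opposite_type.
by case: (isS x); case: (isS y).
Qed.

(** The ordered pairs that start at a t-vertex, two for each, end at a t-vertex or at an s-vertex;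
    the latter are the reversals of the pairs that start at an s-vertex. *)
Lemma sphere_total k : (0 < k)%N -> (k <= n)%N ->
  (sphere_pairs k (opposite_type true) + 2 * sphere_count k true = 2 * sphere_count k false)%N.
Proof.
move=> k0 kn; apply: (@addnI (2 * sphere_count k true)%N); rewrite addnCA addnn -mul2n mulnA -sphere_mixed //.
rewrite !sibling_count // /sphere_pairs -!big_split; apply: eq_bigr => x _.
rewrite -!big_split; apply: eq_bigr => y _ /=.
case: (boolP (edge x y)) => //= xy; case: eqP => //= lx; case: eqP => //= ly.
have := no_SS k0 kn xy lx ly; rewrite /opposite_type.
by case: (isS x); case: (isS y).
Qed.

Lemma sphere_pairs0 P : sphere_pairs 0 P = 0%N.
Proof.
apply: big1 => x _; apply: big1 => y _; case: (boolP (edge x y)) => //= xy.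
case: eqP => //= /lvl0 ex; case: eqP => //= /lvl0 ey.
by move: (edge_neq surf xy); rewrite ex ey eqxx.
Qed.

End SphereCounting.

(** * Triangulated discs as systolic surfaces *)

Section FsetSet.
Variable W : finType.

(** Complexes are made of [{fset W}], whereas the chain and counting arguments use [{set W}]. *)
Definition to_set (A : {fset W}) : {set W} := [set x | x \in A].
Definition to_fset (T : {set W}) : {fset W} := [fset x in T]%fset.

Lemma to_setK : cancel to_set to_fset.
Proof. by move=> A; apply/fsetP => x; rewrite !inE. Qed.

Lemma to_fsetK : cancel to_fset to_set.
Proof. by move=> T; apply/setP => x; rewrite !inE. Qed.

Lemma card_to_set (A : {fset W}) : #|to_set A| = #|` A|%fset.
Proof. by rewrite cardsE; apply/card_uniqP/fset_uniq. Qed.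

Lemma sub_to_set (A B : {fset W}) : (A `<=` B)%fset = (to_set A \subset to_set B).
Proof.
apply/fsubsetP/subsetP => h x; first by rewrite !inE => /h.
by have := h x; rewrite !inE.
Qed.

Lemma card_fset_pred (P : pred {set W}) :
  #|[pred A : {fset W} | P (to_set A)]| = #|[set T | P T]|.
Proof.
rewrite -(card_imset _ (can_inj to_setK)); apply: eq_card => T.
apply/imsetP/idP => [[A PA ->]|]; first by rewrite inE.
by rewrite inE => PT; exists (to_fset T); rewrite ?inE to_fsetK.
Qed.

Lemma to_fset2 (x y : W) : to_fset [set x; y] = [fset x; y]%fset.
Proof. by apply/fsetP => u; rewrite !inE. Qed.

Lemma to_fset3 (x y z : W) : to_fset [set x; y; z] = [fset x; y; z]%fset.
Proof. by apply/fsetP => u; rewrite !inE. Qed.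

End FsetSet.

Section DiscSurface.
Variables (W : finType) (D : scomplex W).

Definition triangles : {set {set W}} := [set T | D (to_fset T) & #|T| == 3%N].
Definition edges : {set {set W}} := [set e | D (to_fset e) & #|e| == 2%N].

Notation tri := (tri triangles).

Lemma edgeE x y : edge edges x y = adj D x y.
Proof. by rewrite /edge inE to_fset2 cards2 /adj andbC; case: (x != y). Qed.

Lemma triE x y z : tri x y z = [&& x != y, y != z, x != z & D [fset x; y; z]%fset].
Proof.
rewrite /tri inE to_fset3; case: (boolP (x != y)) => //= xy; case: (boolP (y != z)) => //= yz.
case: (boolP (x != z)) => //= xz.
by rewrite -setUA cardsU1 cards2 !inE negb_or xy xz yz /= andbT.
Qed.

Lemma triangle_edge_disc (T e : {set W}) :
  T \in triangles -> e \subset T -> #|e| = 2%N -> e \in edges.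
Proof.
rewrite !inE => /andP[DT _] eT e2; rewrite e2 eqxx andbT.
apply: (simplexS DT); first by rewrite sub_to_set !to_fsetK.
by apply/negP => /eqP e0; move: e2; rewrite -[e]to_fsetK e0 card_to_set cardfs0.
Qed.

Lemma incident_tri x y : x != y -> incident triangles [set x; y] = #|[set z | tri x y z]|.
Proof.
move=> xy; rewrite /incident -(card_in_imset (f := fun z => [set x; y; z])).
  apply: eq_card => T; apply/idP/imsetP => [|[z]].
    rewrite inE => /andP[TT eT].
    have T3 : #|T| = 3%N by move: TT; rewrite inE => /andP[_ /eqP].
    have /card_gt0P[z] : (0 < #|T :\: [set x; y]|)%N.
      by rewrite cardsD (setIidPr eT) cards2 xy T3.
    rewrite !inE negb_or => /andP[/andP[zx zy] zT].
    have TE : T = [set x; y; z].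
      apply/esym/eqP; rewrite eqEcard T3; apply/andP; split.
        by apply/subsetP => v; rewrite in_setU => /orP[/(subsetP eT)|] //; rewrite inE => /eqP ->.
      by rewrite -setUA cardsU1 cards2 !inE negb_or xy (eq_sym x z) zx (eq_sym y z) zy.
    by exists z; rewrite // inE /tri xy (eq_sym y) zy (eq_sym x) zx -TE TT.
  rewrite inE => /and4P[_ _ _ TT] ->; rewrite inE TT.
  exact: subsetUl.
move=> z z'; rewrite !inE => /tri_neq[_ yz xz] _ /setP/(_ z).
by rewrite !inE eqxx orbT => /esym; rewrite eq_sym (negPf xz) eq_sym (negPf yz) => /eqP.
Qed.

Lemma card_fset_triangles (P : pred {set W}) :
  #|[pred A : {fset W} | triangle D A && P (to_set A)]| = #|[set T in triangles | P T]|.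
Proof.
rewrite -(card_fset_pred (fun T => (T \in triangles) && P T)); apply: eq_card => A.
by rewrite !inE /triangle to_setK card_to_set.
Qed.

Lemma boundary_edgeE x y : adj D x y ->
  boundary_edge D [fset x; y]%fset = (#|[set z | tri x y z]| == 1%N).
Proof.
move=> /andP[xy Dxy]; rewrite /boundary_edge Dxy cardfs2 xy /= -incident_tri // /incident.
rewrite -card_fset_triangles; congr (_ == _); apply: eq_card => A.
by rewrite !inE sub_to_set -to_fset2 to_fsetK.
Qed.

Lemma boundary_vertexP x : boundary_vertex D x <->
  exists2 y, adj D x y & #|[set z | tri x y z]| = 1%N.
Proof.
split=> [[_ [B bB xB]]|[y xy b1]].
  have := bB; rewrite /boundary_edge => /and3P[DB /eqP B2 _].
  have /cards2P[a [b [ab BE]]] : #|to_set B| == 2%N by rewrite card_to_set B2.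
  have xin : x \in [set a; b] by rewrite -BE inE; apply: (fsubsetP xB); rewrite inE.
  have [y [xy BE']] : exists y, x != y /\ to_set B = [set x; y].
    move: xin; rewrite !inE => /orP[] /eqP ->; first by exists b.
    by exists a; rewrite eq_sym setUC.
  have DE : B = [fset x; y]%fset by rewrite -to_fset2 -BE' to_setK.
  have axy : adj D x y by rewrite /adj xy -DE.
  by exists y => //; move: bB; rewrite DE boundary_edgeE // => /eqP.
split; first by apply/fset0Pn; exists x; rewrite inE.
exists [fset x; y]%fset; first by rewrite boundary_edgeE // b1.
by apply/fsubsetP => u; rewrite !inE => ->.
Qed.

Section Link.
Variable x : W.

Lemma link1P y : link D x [fset y]%fset <-> adj D x y.
Proof.
split=> [[_ xy Dxy]|/andP[xy Dxy]].
  by rewrite /adj Dxy andbT; rewrite inE in xy.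
by split=> //; [apply/fset0Pn; exists y; rewrite inE | rewrite inE].
Qed.

Lemma link2P y z : y != z -> link D x [fset y; z]%fset <-> tri x y z.
Proof.
move=> yz; rewrite triE yz; split=> [[_ xyz Dxyz]|/and4P[xy _ xz Dxyz]].
  by move: xyz; rewrite !inE negb_or => /andP[-> ->]; rewrite -fsetUA.
split; first by apply/fset0Pn; exists y; rewrite !inE eqxx.
  by rewrite !inE negb_or xy xz.
by rewrite fsetUA.
Qed.

Lemma fset2_inj (y z a b : W) : [fset y; z]%fset = [fset a; b]%fset -> y != z ->
  (y = a /\ z = b) \/ (y = b /\ z = a).
Proof.
move=> /fsetP e yz; have := e y; have := e z; rewrite !inE !eqxx orbT /=.
move=> /esym/orP[] /eqP h1 /esym/orP[] /eqP h2; subst; rewrite ?eqxx // in yz; by [left|right].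
Qed.

Lemma cycle_linkP c : uniq c -> (3 <= size c)%N -> link D x = cycle_complex c ->
  (forall y, adj D x y = (y \in c)) /\
  (forall y, y \in c -> [set z | tri x y z] = [set next c y; prev c y] /\ next c y != prev c y).
Proof.
move=> uc sc lk; split=> [y|y yc].
  apply/idP/idP => [/link1P|yc]; last by apply/link1P; rewrite lk; exists y => //; left.
  rewrite lk => -[u ucc [] /fsetP e]; have := e u; rewrite !inE eqxx.
    by move/eqP <-.
  by rewrite orTb => /eqP <-.
split; last first.
  have := next_next_neq uc sc (_ : prev c y \in c); rewrite mem_prev => /(_ yc).
  by rewrite next_prev.
apply/setP => z; rewrite !inE; apply/idP/orP => [t|].
  have [_ yz _] := tri_neq t; move/(link2P yz): t; rewrite lk => -[u ucc [e|e]].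
    have /fsetP eu := e; have := eu y; have := eu z; rewrite !inE !eqxx orbT /=.
    by move=> /esym/eqP zu /esym/eqP yu; rewrite yu zu eqxx in yz.
  have [[-> ->]|[-> ->]] := fset2_inj e yz; first by left.
  by right; rewrite prev_next.
have ny u : u \in c -> next c u != u by move=> ?; rewrite next_neq // ltnW.
case=> /eqP ->.
  have yz : y != next c y by rewrite eq_sym ny.
  by apply/(link2P yz); rewrite lk; exists y => //; right.
have yz : y != prev c y by rewrite -{1}(next_prev uc y) ny // mem_prev.
apply/(link2P yz); rewrite lk; exists (prev c y); first by rewrite mem_prev.
by right; rewrite next_prev // fsetUC.
Qed.

(** Positions in the arc order the link: the first vertex gives an edge lying in one triangle, and
    the leftmost member of a set of link vertices has at most one link neighbour in the set. *)
Lemma arc_linkP p : uniq p -> (2 <= size p)%N -> link D x = arc_complex p ->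
  [/\ forall y, adj D x y -> y \in p,
      forall y z, tri x y z -> index z p = (index y p).+1 \/ index y p = (index z p).+1 &
      exists y z, [/\ adj D x y, index y p = 0%N, tri x y z & index z p = 1%N]].
Proof.
move=> up sp lk.
have consec p1 p2 a b : p = p1 ++ [:: a, b & p2] -> [/\ index a p = size p1, index b p = (size p1).+1 & a != b].
  move=> pE; move: up; rewrite pE cat_uniq => /and3P[_ /hasPn h /= /andP[ab /andP[bp2 _]]].
  have na : a \notin p1 by apply: h; rewrite inE eqxx.
  have nb : b \notin p1 by apply: h; rewrite !inE eqxx orbT.
  move: ab; rewrite inE negb_or => /andP[ab _].
  by rewrite !index_cat (negPf na) (negPf nb) /= !eqxx (negPf ab) addn0 addn1.
split.
- move=> y /link1P; rewrite lk => -[[u uin /fsetP/(_ u)]|[p1 [p2 [a [b [pE /fsetP/(_ a)]]]]]].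
    by rewrite !inE eqxx => /eqP <-.
  by rewrite !inE eqxx /= => /eqP <-; rewrite pE mem_cat inE eqxx orbT.
- move=> y z t; have [_ yz _] := tri_neq t; move/(link2P yz): t.
  rewrite lk => -[[u uin /fsetP eu]|[p1 [p2 [a [b [pE e]]]]]].
    have := eu y; have := eu z; rewrite !inE !eqxx orbT /=.
    by move=> /esym/eqP zu /esym/eqP yu; rewrite yu zu eqxx in yz.
  have [ia ib _] := consec _ _ _ _ pE.
  by have [[-> ->]|[-> ->]] := fset2_inj e yz; rewrite ia ib; [left|right].
case: p up sp lk consec => [|a [|b p]] // up sp lk consec.
have [ia ib ab] := consec [::] p a b erefl; exists a, b; split=> //.
  by apply/link1P; rewrite lk; left; exists a; rewrite // inE eqxx.
by apply/(link2P ab); rewrite lk; right; exists [::], p, a, b.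
Qed.

End Link.

Hypothesis surfD : triangulated_surface D.

Let surface_cases x : (exists c : seq W, [/\ uniq c, (3 <= size c)%N & link D x = cycle_complex c]) \/
  (exists p : seq W, [/\ uniq p, (2 <= size p)%N & link D x = arc_complex p]).
Proof. exact: surfD. Qed.

Lemma tri_adj x y z : tri x y z -> adj D x y.
Proof.
rewrite triE => /and4P[xy _ _ Dxyz]; rewrite /adj xy; apply: (simplexS Dxyz).
  exact: fsubsetUl.
by apply/fset0Pn; exists x; rewrite !inE eqxx.
Qed.

(** If the link were an arc, the edge to its first vertex would be a boundary edge. *)
Lemma interior_full x y : interior_vertex D x -> adj D x y -> #|[set z | tri x y z]| = 2%N.
Proof.
move=> ix xy; have [[c [uc sc lk]]|[p [up sp lk]]] := surface_cases x.
  have [adjE tE] := cycle_linkP uc sc lk.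
  by have [-> np] := tE y (etrans (esym (adjE y)) xy); rewrite cards2 np.
have [_ ind [a [b [xa ia t ib]]]] := arc_linkP up sp lk.
have sur := arc_linkP up sp lk.
case: ix; apply/boundary_vertexP; exists a => //; apply/eqP/cards1P; exists b; apply/setP => z; rewrite !inE.
apply/idP/eqP => [t'|->] //; have [] := ind _ _ t'; rewrite ia // => iz.
have zp : z \in p by have [h _ _] := sur; apply: h; have [t2 _ _ _ _] := tri_perm t'; exact: (tri_adj t2).
have bp : b \in p by have [h _ _] := sur; apply: h; have [t2 _ _ _ _] := tri_perm t; exact: (tri_adj t2).
by rewrite -(nth_index x zp) iz -ib nth_index.
Qed.

Lemma cycle_link_interior x c : uniq c -> (3 <= size c)%N -> link D x = cycle_complex c ->
  interior_vertex D x.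
Proof.
move=> uc sc lk /boundary_vertexP[y xy t1].
have [adjE tE] := cycle_linkP uc sc lk.
by have [e np] := tE y (etrans (esym (adjE y)) xy); rewrite e cards2 np in t1.
Qed.

Lemma edge_thin_disc e : e \in edges -> (incident triangles e <= 2)%N.
Proof.
move=> eE; have /cards2P[x [y [xy eE2]]] : #|e| == 2%N by move: eE; rewrite inE => /andP[].
rewrite eE2 incident_tri //.
have axy : adj D x y by rewrite -edgeE /edge -eE2.
have [[c [uc sc lk]]|[p [up sp lk]]] := surface_cases x.
  have [adjE tE] := cycle_linkP uc sc lk.
  by have [-> np] := tE y (etrans (esym (adjE y)) axy); rewrite cards2; case: (_ != _).
have [inp ind _] := arc_linkP up sp lk.
apply: leq_trans (_ : #|[set nth x p (index y p).+1; nth x p (index y p).-1]| <= 2)%N; last first.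
  by rewrite cards2; case: (_ != _).
apply/subset_leq_card/subsetP => z; rewrite !inE => t.
have zp : z \in p by apply: inp; have [t2 _ _ _ _] := tri_perm t; exact: (tri_adj t2).
by have [<-|->] := ind _ _ t; rewrite /= nth_index // eqxx ?orbT.
Qed.

Hypothesis deg6 : forall x, interior_vertex D x -> (6 <= #|[pred w | adj D x w]|)%N.

(** In a cyclic link [Z] is closed under [next], so it is the whole link, of size at least 6. In an
    arc its leftmost vertex contradicts the condition. *)
Lemma link_girth_disc x (Z : {set W}) : Z != set0 ->
  (forall y, y \in Z -> (2 <= #|[set z in Z | tri x y z]|)%N) -> (6 <= #|Z|)%N.
Proof.
move=> /set0Pn[y0 y0Z] Z2.
have [[c [uc sc lk]]|[p [up sp lk]]] := surface_cases x.
  have [adjE tE] := cycle_linkP uc sc lk.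
  apply: leq_trans (deg6 (cycle_link_interior uc sc lk)) _.
  apply/subset_leq_card/subsetP => w; rewrite inE adjE => wc.
  have Zc y : y \in Z -> y \in c.
    move=> /Z2/ltnW/card_gt0P[z]; rewrite inE => /andP[_ t]; rewrite -adjE; exact: (tri_adj t).
  have Znext y : y \in Z -> next c y \in Z.
    move=> yZ; have [e np] := tE y (Zc y yZ).
    have : [set z in Z | tri x y z] == [set next c y; prev c y].
      rewrite eqEcard cards2 np (Z2 y yZ) andbT -e.
      by apply/subsetP => z; rewrite !inE => /andP[].
    by move/eqP/setP/(_ (next c y)); rewrite !inE eqxx => /andP[].
  have [i q rc] := rot_to (Zc y0 y0Z).
  have fc : fcycle (next c) (y0 :: q).
    have := cycle_next (_ : uniq (rot i c)); rewrite rot_uniq rc => /(_ uc).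
    rewrite -rc (eq_cycle (e' := frel (next c))) // => a b /=.
    by rewrite next_rot.
  have : w \in y0 :: q by rewrite -rc mem_rot.
  rewrite inE => /orP[/eqP -> //|wq]; move: fc; rewrite /= rcons_path => /andP[+ _].
  elim: q y0 y0Z wq {rc} => // a q IH y0 y0Z /=; rewrite inE => wq /andP[/eqP aE pq].
  have aZ : a \in Z by rewrite -aE Znext.
  by case/orP: wq => [/eqP -> //|wq]; apply: IH pq.
have [inp ind _] := arc_linkP up sp lk.
have [y yZ ymin] := @arg_minnP _ y0 (mem Z) (fun u => index u p) y0Z.
suff le1 : (#|[set z in Z | tri x y z]| <= 1)%N by have := leq_trans (Z2 y yZ) le1.
apply: leq_trans (_ : #|[set nth x p (index y p).+1]| <= 1)%N; last by rewrite cards1.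
apply/subset_leq_card/subsetP => z; rewrite !inE => /andP[zZ t].
have zp : z \in p by apply: inp; have [t2 _ _ _ _] := tri_perm t; exact: (tri_adj t2).
have [<-|iy] := ind _ _ t; first by rewrite nth_index.
by have := ymin z zZ; rewrite iy ltnn.
Qed.

Variable R : realType.
Hypothesis homeoD : homeomorphic_to_set (realization R D) (@closed_disc R).

(** An edge cochain, extended by 0 on the diagonal, satisfies the local cocycle identity on all
    triples, degenerate ones included; signs disappear over F_2. *)
Lemma acyclic_disc : acyclic triangles edges.
Proof.
move=> z zc; pose g x y : 'F_2 := if x == y then 0 else z [set x; y].
have gc : local_cocycle D g.
  move=> A x y w DA xA yA wA; rewrite /g.
  have [->|xy] := eqVneq x y; first by rewrite add0r.
  have [e|yw] := eqVneq y w; first by rewrite addr0 -e (negPf xy).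
  have [->|xw] := eqVneq x w; first by rewrite setUC F2_addrr.
  have TT : [set x; y; w] \in triangles.
    rewrite inE to_fset3 -setUA cardsU1 cards2 !inE negb_or xy xw yw /= andbT.
    apply: (simplexS DA); last by apply/fset0Pn; exists x; rewrite !inE eqxx.
    by apply/fsubsetP => u; rewrite !inE => /orP[/orP[]|] /eqP ->.
  have e0 := zc _ TT; rewrite (eq_bigl (fun e : {set W} => (e \subset [set x; y; w]) && (#|e| == 2%N))) in e0; last first.
    move=> e; apply/andP/andP => [[]|[eT /eqP e2]].
      by rewrite inE => /andP[_ ->] ->.
    by split=> //; exact: (triangle_edge_disc TT eT e2).
  rewrite sum_pairs_of_triple // in e0.
  by apply/eqP; rewrite -subr_eq0 F2_oppr e0.
have [f fP] := disc_cocycle_coboundary homeoD gc.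
exists f => e eE; have /cards2P[x [y [xy eE2]]] : #|e| == 2%N by move: eE; rewrite inE => /andP[].
have axy : adj D x y by rewrite -edgeE /edge -eE2.
have := fP x y axy; rewrite /g (negPf xy) eE2 coboundary2 // => ->.
by rewrite F2_oppr addrC.
Qed.

Lemma systolic_disc : systolic_surface triangles edges.
Proof.
split.
- by move=> T; rewrite inE => /andP[_ /eqP].
- by move=> e; rewrite inE => /andP[_ /eqP].
- exact: triangle_edge_disc.
- exact: edge_thin_disc.
- exact: acyclic_disc.
- exact: link_girth_disc.
Qed.

End DiscSurface.

(** * Edge-path distance from the centre *)

Section Distance.
Variables (W : finType) (D : scomplex W).
Implicit Types (u v x y : W).

Lemma walkP n u v : reflect (exists p, [/\ size p = n, path (adj D) u p & last u p = v]) (walk D n u v).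
Proof.
apply: (iffP existsP) => [[p /andP[pp /eqP lp]]|[p [sp pp lp]]].
  by exists p; rewrite size_tuple.
by exists (tcast sp (in_tuple p)); rewrite val_tcast pp /= lp eqxx.
Qed.

Lemma dist_le v u : (dist D v u <= #|W|)%N.
Proof. by rewrite /dist (leq_trans (find_size _ _)) // size_iota. Qed.

Lemma dist_walk v u : (dist D v u < #|W|)%N -> walk D (dist D v u) v u.
Proof.
move=> lt; have h : has (fun n => walk D n v u) (iota 0 #|W|) by rewrite has_find size_iota.
by have := nth_find 0%N h; rewrite nth_iota // add0n.
Qed.

Lemma walk_dist n v u : walk D n v u -> (dist D v u <= n)%N.
Proof.
move=> wn; have [nW|Wn] := ltnP n #|W|; last exact: leq_trans (dist_le v u) Wn.
rewrite leqNgt; apply/negP => /(before_find 0%N).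
by rewrite nth_iota // add0n wn.
Qed.

Lemma dist_adj v x y : adj D x y -> (dist D v y <= (dist D v x).+1)%N.
Proof.
(* If [x] is out of reach, its value is the default [#|W|], which bounds every distance. *)
move=> xy; have [lt|ge] := ltnP (dist D v x) #|W|; last first.
  by apply: leq_trans (dist_le v y) _; apply: leqW.
have /walkP[p [sp pp lp]] := dist_walk lt.
apply: walk_dist; apply/walkP; exists (rcons p y).
by rewrite size_rcons sp rcons_path pp lp last_rcons.
Qed.

Lemma dist_pred v x : (0 < dist D v x)%N -> (dist D v x < #|W|)%N ->
  exists2 y, adj D y x & dist D v x = (dist D v y).+1.
Proof.
move=> gt0 lt; have /walkP[p [sp pp lp]] := dist_walk lt.
case: (lastP p) sp pp lp => [e|q y]; first by rewrite -e in gt0.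
rewrite size_rcons rcons_path last_rcons => sq /andP[pq ay] yx; rewrite yx in ay.
exists (last v q) => //; apply/eqP; rewrite eqn_leq dist_adj // -sq ltnS.
by apply: walk_dist; apply/walkP; exists q.
Qed.

Lemma dist_eq0 v x : dist D v x = 0%N -> x = v.
Proof.
move=> d0; have /walkP[p [sp _ lp]] : walk D 0 v x.
  by rewrite -{1}d0 dist_walk // d0; apply/card_gt0P; exists v.
by rewrite -lp (size0nil sp).
Qed.

Lemma distxx v : dist D v v = 0%N.
Proof. by apply/eqP; rewrite -leqn0; apply: walk_dist; apply/walkP; exists [::]. Qed.

End Distance.

Section DiscCounts.
Variables (W : finType) (D : scomplex W).
Hypothesis surfD : triangulated_surface D.

(** Incidences of a triangle at [x] with another of its vertices: each triangle has two such
    vertices, and each edge at [x] two triangles. *)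
Lemma curvature_interior (R : realType) x : interior_vertex D x ->
  curvature D R x = 6 - #|[pred w | adj D x w]|%:R.
Proof.
move=> ix; rewrite /curvature; congr (6 - _%:R).
have -> : #|[pred A : {fset W} | triangle D A && (x \in A)]| = corner_count (triangles D) x.
  rewrite /corner_count -card_fset_triangles; apply: eq_card => A.
  by rewrite !inE.
apply/eqP; rewrite -(eqn_pmul2l (isT : 0 < 2)%N); apply/eqP.
transitivity (\sum_y \sum_(T in triangles D | x \in T) ((y != x) && (y \in T)))%N.
  rewrite exchange_big /= /corner_count -sum1_card big_distrr /=.
  rewrite (eq_bigl (fun T => (T \in triangles D) && (x \in T))); last by move=> T; rewrite inE.
  apply: eq_bigr => T /andP[TT xT]; have : #|T| = 3%N by move: TT; rewrite inE => /andP[_ /eqP].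
  rewrite (cardsD1 x) xT => -[<-]; rewrite muln1 add0n -sum1_card [LHS]big_mkcond; apply: eq_bigr => y _.
  by rewrite !inE; case: (y != x); case: (y \in T).
rewrite -sum1_card big_distrr [RHS]big_mkcond /=; apply: eq_bigr => y _.
have [->|yx] := eqVneq y x.
  rewrite big1; last by move=> T _.
  by rewrite inE /adj eqxx.
have e : (\sum_(T in triangles D | x \in T) (y \in T) = incident (triangles D) [set x; y])%N.
  rewrite /incident -sum1_card big_mkcond [RHS]big_mkcond; apply: eq_bigr => T _.
  rewrite inE; case: (T \in triangles D) => //=.
  by rewrite subUset !sub1set; case: (x \in T); case: (y \in T).
rewrite e incident_tri 1?eq_sym // inE.
case: ifP => xy; first by rewrite interior_full.
apply/eqP; rewrite cards_eq0; apply/eqP/setP => z; rewrite !inE; apply/negP => /tri_adj.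
by rewrite xy.
Qed.

End DiscCounts.

(** * Asymptotics of the recursion *)

Section Asymptotics.
Variable R : realType.
Implicit Types (p q r x : R) (n k : nat).

(** The Lucas sequence U_k(p, 1), a Chebyshev polynomial of the second kind at p / 2. *)
Fixpoint lucas p k {struct k} : R :=
  match k with
  | 0 => 0
  | 1 => 1
  | (k''.+1 as k').+1 => p * lucas p k' - lucas p k''
  end.

Lemma lucasSS p k : lucas p k.+2 = p * lucas p k.+1 - lucas p k.
Proof. by []. Qed.

(** Stated up to [n] because the sphere counts obey their recursion only inside a complete ball. *)
Lemma lucas_unique p (u : nat -> R) n : u 0%N = 0 ->
  (forall k, (k.+2 < n)%N -> u k.+2 = p * u k.+1 - u k) ->
  forall k, (k < n)%N -> u k = u 1%N * lucas p k.
Proof.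
move=> u0 urec k kn.
suff [] : u k = u 1%N * lucas p k /\ ((k.+1 < n)%N -> u k.+1 = u 1%N * lucas p k.+1) by [].
elim: k kn => [|k IH] kn; first by rewrite u0 mulr0 mulr1.
have [hk hk1] := IH (ltnW kn); split; first exact: hk1.
by move=> kn2; rewrite lucasSS urec // hk hk1 //; ring.
Qed.

Lemma lucasN p k : `|lucas (- p) k| = `|lucas p k|.
Proof.
suff [-> _] : lucas (- p) k = (-1) ^+ k.+1 * lucas p k /\
              lucas (- p) k.+1 = (-1) ^+ k.+2 * lucas p k.+1.
  by rewrite normrM normrX normrN1 expr1n mul1r.
elim: k => [|k [IH1 IH2]]; first by rewrite /= mulr0 expr2 mulrNN !mulr1.
by split=> //; rewrite !lucasSS IH1 IH2 !exprS; ring.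
Qed.

(** The larger root of x^2 - p x + 1 when p >= 2; the other root is its inverse. *)
Definition growth p : R := (p + Num.sqrt (p ^+ 2 - 4)) / 2.

Lemma growth_root p : 2 <= p -> growth p ^+ 2 = p * growth p - 1.
Proof.
move=> p2; have d0 : 0 <= p ^+ 2 - 4 by nra.
have := sqr_sqrtr d0; rewrite /growth; set r := Num.sqrt _ => rr.
have -> : ((p + r) / 2) ^+ 2 = (p ^+ 2 + r ^+ 2 + 2 * p * r) / 4 by field.
by rewrite rr; field.
Qed.

Lemma growth_ge1 p : 2 <= p -> 1 <= growth p.
Proof. by move=> p2; rewrite /growth; have := sqrtr_ge0 (p ^+ 2 - 4); lra. Qed.

Lemma growth_lt p q : 2 <= p -> p < q -> growth p < growth q.
Proof.
move=> p2 pq; rewrite /growth ltr_pM2r; last by rewrite invr_gt0.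
by rewrite ltr_leD // ler_sqrt; nra.
Qed.

Lemma growth_gt1 p : 2 < p -> 1 < growth p.
Proof. by move=> p2; rewrite /growth; have := sqrtr_ge0 (p ^+ 2 - 4); lra. Qed.

Lemma lucas_growth p k : 2 <= p -> lucas p k.+1 - growth p * lucas p k = (growth p)^-1 ^+ k.
Proof.
move=> p2; have g0 : growth p != 0 by rewrite gt_eqF // (lt_le_trans ltr01) // growth_ge1.
have gr := growth_root p2.
elim: k => [|k IH]; first by rewrite /= mulr0 subr0 expr0.
have pE : p - growth p = (growth p)^-1.
  by apply: (mulIf g0); rewrite mulrBl mulVf // -expr2 gr opprB addrC subrK.
by rewrite lucasSS exprS -IH mulrBr mulKf // -pE; ring.
Qed.

Lemma lucas_ge p k : 2 <= p -> growth p ^+ k <= lucas p k.+1.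
Proof.
move=> p2; have g1 := growth_ge1 p2; have g0 : 0 < growth p by rewrite (lt_le_trans ltr01).
elim: k => [|k IH]; first by rewrite expr0.
have := lucas_growth k.+1 p2; have : 0 <= (growth p)^-1 ^+ k.+1 by rewrite exprn_ge0 // invr_ge0 ltW.
have : growth p * growth p ^+ k <= growth p * lucas p k.+1 by rewrite ler_pM2l.
by rewrite -exprS; lra.
Qed.

Lemma lucas_ge0 p k : 2 <= p -> 0 <= lucas p k.
Proof.
move=> p2; case: k => // k; apply: le_trans (lucas_ge k p2).
by rewrite exprn_ge0 // (le_trans ler01) // growth_ge1.
Qed.

(** The roots lie on the unit circle, and the quadratic form in [energy] is an invariant of the
    recursion, positive definite for q < 2. *)
Lemma lucas_bounded q k : 0 <= q -> q < 2 -> `|lucas q k| <= (1 - q / 2)^-1.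
Proof.
move=> q0 q2.
have energy j : lucas q j.+1 ^+ 2 - q * lucas q j.+1 * lucas q j + lucas q j ^+ 2 = 1.
  elim: j => [|j IH]; first by rewrite /=; ring.
  by rewrite -[RHS]IH lucasSS; ring.
have c0 : 0 < 1 - q / 2 by lra.
have c1 : 1 <= (1 - q / 2)^-1 by rewrite -invr1 lef_pV2 ?posrE //; lra.
have sq : lucas q k ^+ 2 <= (1 - q / 2)^-1.
  rewrite -[X in _ <= X]mul1r ler_pdivlMr // -[X in _ <= X](energy k).
  have : 0 <= q / 2 * (lucas q k.+1 - lucas q k) ^+ 2 by apply: mulr_ge0; [lra | exact: sqr_ge0].
  have : 0 <= (1 - q / 2) * lucas q k.+1 ^+ 2 by apply: mulr_ge0; [lra | exact: sqr_ge0].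
  by nra.
rewrite -ler_sqr ?nnegrE ?normr_ge0 ?(le_trans ler01) // real_normK ?num_real //.
by apply: le_trans sq _; rewrite expr2 ler_peMl // (le_trans ler01).
Qed.

(** The slack between [growth q] and [r] also absorbs the linear growth at the double root q = 2. *)
Lemma lucas_le q r k : 2 <= q -> growth q < r -> `|lucas q k| <= r ^+ k / (r - growth q).
Proof.
move=> q2 gr; have g1 := growth_ge1 q2; have d0 : 0 < r - growth q by lra.
have g0 : 0 < growth q by lra.
rewrite ger0_norm ?lucas_ge0 // ler_pdivlMr //.
elim: k => [|k IH]; first by rewrite /= mul0r expr0.
have := lucas_growth k q2.
have : (growth q)^-1 ^+ k <= 1 by apply: exprn_ile1; [rewrite invr_ge0 ltW | rewrite invf_le1].
have : 1 <= r ^+ k by rewrite exprn_ege1 //; lra.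
rewrite exprS => h1 h2 h3.
have : growth q * (lucas q k * (r - growth q)) <= growth q * r ^+ k by rewrite ler_pM2l.
nra.
Qed.

(** The rate [r] lies midway between [growth p] and the larger of 1 and [growth q]; it exceeds 1 so
    that geometric sums are of order r^n. *)
Lemma lucas_dominated p q : 2 < p -> 0 <= q -> q < p ->
  exists r C, [/\ 1 < r, r < growth p, 0 <= C & forall k, `|lucas q k| <= C * r ^+ k].
Proof.
move=> p2 q0 qp; have gp := growth_gt1 p2.
have [q2|q2] := ltP q 2.
  exists ((1 + growth p) / 2), (1 - q / 2)^-1; split; [lra | lra | by rewrite invr_ge0; lra |].
  move=> k; apply: le_trans (lucas_bounded k q0 q2) _.
  by rewrite ler_peMr ?invr_ge0 ?exprn_ege1 //; lra.
have g1 := growth_ge1 q2; have gg := growth_lt q2 qp.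
exists ((growth q + growth p) / 2), ((growth q + growth p) / 2 - growth q)^-1.
split; [lra | lra | by rewrite invr_ge0; lra |].
by move=> k; rewrite mulrC; apply: lucas_le => //; lra.
Qed.

Lemma bernoulli x n : 0 <= x -> 1 + n%:R * x <= (1 + x) ^+ n.
Proof.
move=> x0; elim: n => [|n IH]; first by rewrite mul0r addr0 expr0.
rewrite exprS mulrSr; have : 0 <= n%:R * x by rewrite mulr_ge0.
have : (1 + x) * (1 + n%:R * x) <= (1 + x) * (1 + x) ^+ n by apply: ler_wpM2l => //; lra.
nra.
Qed.

Lemma sum_geometric_le r n : 1 < r -> \sum_(k < n) r ^+ k <= r ^+ n / (r - 1).
Proof.
move=> r1; rewrite ler_pdivlMr; last lra.
have := subrX1 r n; rewrite mulrC => <-.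
by rewrite lerBlDr lerDl.
Qed.

Lemma lucas_sum_dominated p q A B e : 2 < p -> 0 <= q -> q < p -> 0 <= A -> 0 <= B -> 0 < e ->
  exists N, forall n, (N <= n)%N ->
  A + B * \sum_(k < n) `|lucas q k| < e * \sum_(k < n) lucas p k.
Proof.
move=> p2 q0 qp A0 B0 e0.
have [r [C [r1 rg C0 Cr]]] := lucas_dominated p2 q0 qp.
set g := growth p in rg *.
have g0 : 0 < g by lra.
have r0 : 0 < r by lra.
pose M := A + B * C / (r - 1); pose d := g / r - 1.
have d0 : 0 < d by rewrite /d subr_gt0 ltr_pdivlMr // mul1r.
have M0 : 0 <= M by rewrite addr_ge0 // divr_ge0 ?mulr_ge0 // subr_ge0 ltW.
(* For n > x Bernoulli gives M g^2 < e (1 + d)^n with 1 + d = g / r, that is, M r^n < e g^(n-2). The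
   2 added to the bound gives the exponent n - 2 its literal meaning. *)
pose x := M * g ^+ 2 / (e * d).
have x0 : 0 <= x by apply: divr_ge0; apply: mulr_ge0; rewrite ?exprn_ge0 // ltW.
exists (Num.bound x + 2)%N => n Nn.
have n2 : (2 <= n)%N by rewrite (leq_trans _ Nn) // leq_addl.
have xn : x < n%:R.
  apply: lt_le_trans (archi_boundP x0) _; rewrite ler_nat.
  by rewrite (leq_trans _ Nn) // leq_addr.
have rn1 : 1 <= r ^+ n by rewrite exprn_ege1 // ltW.
have lhs : A + B * \sum_(k < n) `|lucas q k| <= M * r ^+ n.
  have h1 : \sum_(k < n) `|lucas q k| <= C * (r ^+ n / (r - 1)).
    apply: le_trans (ler_wpM2l C0 (sum_geometric_le n r1)).
    by rewrite mulr_sumr ler_sum.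
  have h2 := ler_wpM2l B0 h1.
  have h3 : A <= A * r ^+ n by rewrite ler_peMr.
  have -> : M * r ^+ n = A * r ^+ n + B * (C * (r ^+ n / (r - 1))).
    by rewrite /M; field; lra.
  lra.
have rhs : g ^+ n.-2 <= \sum_(k < n) lucas p k.
  case: n n2 {Nn xn rn1 lhs} => [|[|n]] // _; rewrite big_ord_recr /=.
  apply: le_trans (lucas_ge n (ltW p2)) _; rewrite -[X in X <= _]add0r lerD2r.
  by apply: sumr_ge0 => k _; rewrite lucas_ge0 // ltW.
apply: le_lt_trans lhs (lt_le_trans _ (ler_wpM2l (ltW e0) rhs)).
have gn : g ^+ n = g ^+ n.-2 * g ^+ 2 by rewrite -exprD addn2; case: n n2 {xn rn1 rhs Nn} => [|[|]].
have grn : g ^+ n = (1 + d) ^+ n * r ^+ n.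
  by rewrite -exprMn /d addrC subrK divfK // gt_eqF.
have e1 : M * r ^+ n * g ^+ 2 = M * g ^+ 2 * r ^+ n by rewrite mulrAC.
have e2 : e * g ^+ n.-2 * g ^+ 2 = e * (1 + d) ^+ n * r ^+ n.
  by rewrite -[LHS]mulrA -gn grn [LHS]mulrA.
rewrite -(ltr_pM2r (exprn_gt0 2 g0)) e1 e2 ltr_pM2r ?exprn_gt0 //.
have := bernoulli n (ltW d0).
move: xn; rewrite ltr_pdivrMr ?mulr_gt0 // => xn hb.
apply: lt_le_trans xn _; rewrite mulrCA ler_pM2l //; lra.
Qed.

End Asymptotics.

Definition weight_average (R : realType) (S T : R) : R := (T + Num.sqrt (T ^+ 2 + 8 * S * T)) / 4.

Lemma weight_average_root (R : realType) (S T : R) : 2 <= S -> 2 <= T ->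
  2 * weight_average S T ^+ 2 = T * (weight_average S T + S).
Proof.
move=> S2 T2; have d0 : 0 <= T ^+ 2 + 8 * S * T by nra.
have := sqr_sqrtr d0; rewrite /weight_average; set r := Num.sqrt _ => rr.
have -> : 2 * ((T + r) / 4) ^+ 2 = (T ^+ 2 + r ^+ 2 + 2 * T * r) / 8 by field.
by rewrite rr; field.
Qed.

(** Inserting S, T >= 2 into the quadratic equation gives (P - 2) (P + 1) >= 0, strictly unless S =
    T = 2. P > 2 is what makes the ball grow exponentially. *)
Lemma weight_average_gt2 (R : realType) (S T : R) : 2 <= S -> 2 <= T -> 4 < S + T ->
  2 < weight_average S T.
Proof.
move=> S2 T2 ST; have := weight_average_root S2 T2.
have : 0 < weight_average S T.
  have r0 := sqrtr_ge0 (T ^+ 2 + 8 * S * T).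
  by apply: divr_gt0; lra.
move: (weight_average S T) => P P0 root; rewrite ltNge; apply/negP => P2.
have h1 : 0 <= (2 - P) * (1 + P) by apply: mulr_ge0; lra.
have h3 : 0 <= (T - 2) * (P + S) by apply: mulr_ge0; lra.
have [T2'|T2'] := leP T 2; last first.
  have h2 : 0 < (T - 2) * (P + S) by apply: mulr_gt0; lra.
  nra.
have TE : T = 2 by lra.
by move: root; rewrite TE; nra.
Qed.

(* The matrix of the recursion has eigenvalues P and T/2 - P: the first weighs
   the size of the ball, the second its deviation from the average P. *)
Lemma average_limit (R : realType) (S T c e : R) (P := weight_average S T) :
  2 <= S -> 2 <= T -> 4 < S + T -> 0 < c -> 0 < e -> exists N, forall n, (N <= n)%N ->
  forall a b : nat -> R,
    a 0%N = 0 -> b 0%N = 0 -> a 1%N = 0 -> b 1%N = c ->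
    (forall k, (k < n)%N -> 0 <= a k /\ a k <= b k) ->
    (forall k, (k.+2 < n)%N -> a k.+2 + a k = T / 2 * b k.+1) ->
    (forall k, (k.+2 < n)%N -> (b k.+2 - a k.+2) + (b k - a k) = S * a k.+1) ->
    `|((S - P) + \sum_(k < n) (S * a k + T * b k - P * (a k + b k)))
      / (1 + \sum_(k < n) (a k + b k))| < e.
Proof.
move=> S2 T2 ST c0 e0; have P_gt2 : 2 < P := weight_average_gt2 S2 T2 ST.
have P_root : 2 * P ^+ 2 = T * (P + S) := weight_average_root S2 T2.
move: P P_gt2 P_root => P P_gt2 P_root; have PT0 : 0 < 2 * P + T by lra.
(* The root equation reads P (2 P - T) = T S. *)
have q0 : 0 <= P - T / 2 by have := P_root; nra.
have qP : P - T / 2 < P by lra.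
(* T c / (2 P + T) is the constant by which [den] bounds the size of the ball below by the sum of
   [lucas P]. *)
have e'0 : 0 < e * (T * c / (2 * P + T)) by rewrite mulr_gt0 ?divr_gt0 // mulr_gt0 //; lra.
have B0 : 0 <= `|T - P| * c by rewrite mulr_ge0 // ltW.
have [N HN] := lucas_sum_dominated P_gt2 q0 qP (normr_ge0 (S - P)) B0 e'0.
exists N => n Nn a b a0 b0 a1 b1 pos reca rech.
have wE k : (k < n)%N -> S * a k + T * b k - P * (a k + b k) = (T - P) * c * lucas (- (P - T / 2)) k.
  pose w j := (S + T - 2 * P) * a j + (T - P) * (b j - a j).
  have w1 : w 1%N = (T - P) * c by rewrite /w a1 b1; ring.
  move=> kn; rewrite -w1 -(@lucas_unique _ (- (P - T / 2)) w n) //; first by rewrite /w; ring.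
    by rewrite /w a0 b0; ring.
  move=> j jn; have := reca j jn; have := rech j jn; rewrite /w => h1 h2.
  have -> : b j.+2 - a j.+2 = S * a j.+1 - (b j - a j) by rewrite -h1; ring.
  have -> : a j.+2 = T / 2 * b j.+1 - a j by rewrite -h2; ring.
  apply/eqP; rewrite -subr_eq0; apply/eqP.
  transitivity ((T * (P + S) - 2 * P ^+ 2) * (b j.+1 - a j.+1) / 2 + (T * (P + S) - 2 * P ^+ 2) * a j.+1).
    by field.
  by rewrite -P_root; ring.
have yE k : (k < n)%N -> 2 * P * a k + T * (b k - a k) = T * c * lucas P k.
  pose y j := 2 * P * a j + T * (b j - a j).
  have y1 : y 1%N = T * c by rewrite /y a1 b1; ring.
  move=> kn; rewrite -y1 -(@lucas_unique _ P y n) //.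
    by rewrite /y a0 b0; ring.
  move=> j jn; have := reca j jn; have := rech j jn; rewrite /y => h1 h2.
  have -> : b j.+2 - a j.+2 = S * a j.+1 - (b j - a j) by rewrite -h1; ring.
  have -> : a j.+2 = T / 2 * b j.+1 - a j by rewrite -h2; ring.
  apply/eqP; rewrite -subr_eq0; apply/eqP.
  transitivity ((T * (P + S) - 2 * P ^+ 2) * a j.+1); first by field.
  by rewrite -P_root; ring.
have den : T * c / (2 * P + T) * \sum_(k < n) lucas P k <= \sum_(k < n) (a k + b k).
  rewrite mulrAC ler_pdivrMr // mulr_sumr mulr_suml; apply: ler_sum => k _.
  have [ak bk] := pos k (ltn_ord k).
  by rewrite -yE //; nra.
have den0 : 0 <= T * c / (2 * P + T) * \sum_(k < n) lucas P k.
  apply: mulr_ge0; first by rewrite divr_ge0 ?mulr_ge0 ?ltW //; lra.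
  by apply: sumr_ge0 => k _; rewrite lucas_ge0 // ltW.
have d1 : 0 < 1 + \sum_(k < n) (a k + b k) by lra.
rewrite normrM normfV [X in _ / X]gtr0_norm // ltr_pdivrMr //.
have num : `|S - P + \sum_(k < n) (S * a k + T * b k - P * (a k + b k))| <=
    `|S - P| + `|T - P| * c * \sum_(k < n) `|lucas (P - T / 2) k|.
  apply: le_trans (ler_normD _ _) _; rewrite lerD2l.
  apply: le_trans (ler_norm_sum _ _ _) _; rewrite mulr_sumr; apply: ler_sum => k _.
  by rewrite wE // !normrM lucasN (gtr0_norm c0).
apply: le_lt_trans num (lt_le_trans (HN n Nn) _).
by rewrite -[X in X <= _]mulrA ler_pM2l //; lra.
Qed.

(** * Sphere counts in a uniform disc *)

Section UniformDisc.
Variables (W : finType) (D : scomplex W) (s t : nat).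
Hypothesis t_even : ~~ odd t.
Hypothesis st : s <> t.
Hypothesis uniD : forall u, interior_vertex D u -> st_interior_vertex s t D u.
Notation deg x := #|[pred w | adj D x w]|.
Notation tri := (tri (triangles D)).

Let isS : pred W := fun x => deg x == s.

Lemma interior_degree x : interior_vertex D x -> deg x = if isS x then s else t.
Proof.
by move=> ix; have [[[_ d]|[_ d]] _ _] := uniD ix; rewrite /isS d ?eqxx //; case: eqP.
Qed.

Let t_not_S x : k_vertex D t x -> ~~ isS x.
Proof. by move=> [_ d]; rewrite /isS d; apply/eqP => ts; apply: st. Qed.

(** Types alternate around a t-vertex, so two consecutive neighbours contain exactly one
    s-vertex. *)
Let link_types x y z : tri x y z -> interior_vertex D x -> interior_vertex D y ->
  interior_vertex D z -> ~~ isS x -> (isS y + isS z = 1)%N.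
Proof.
move=> xyz ix iy iz nS; have [_ yz _] := tri_neq xyz.
have kx : k_vertex D t x by split=> //; rewrite interior_degree // (negPf nS).
have [_ _ /(_ kx)[c [sc cE [uc _ _ full] even odd]]] := uniD ix.
have adj_in w : adj D x w -> w \in c by move=> xw; rewrite cE inE.
have [xzy _ yzx _ _] := tri_perm xyz.
have yc : y \in c by apply/adj_in/(tri_adj xyz).
have zc : z \in c by apply/adj_in/(tri_adj xzy).
have evenE i : (i < t)%N -> ~~ ssrnat.odd i -> interior_vertex D (nth x c i) -> isS (nth x c i) = false.
  by move=> it oi ii; apply/negbTE; have [/t_not_S|] := even i it oi.
have oddE i : (i < t)%N -> ssrnat.odd i -> interior_vertex D (nth x c i) -> isS (nth x c i).
  by move=> it oi ii; have [[_ d]|] := odd i it oi; rewrite /isS ?d ?eqxx.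
have [u ucc] : cycle_complex c [fset y; z]%fset.
  apply: full => [|w]; first by have /andP[] := tri_adj yzx.
  by rewrite !inE => /orP[] /eqP ->.
case=> [/fsetP e|e].
  have := e y; have := e z; rewrite !inE !eqxx orbT /=.
  by move=> /esym/eqP zu /esym/eqP yu; rewrite yu zu eqxx in yz.
suff key : interior_vertex D u -> interior_vertex D (next c u) -> (isS u + isS (next c u) = 1)%N.
  by have [[yu zu]|[yu zu]] := fset2_inj e yz; rewrite yu zu in iy iz *; [|rewrite addnC]; apply: key.
move=> iu inu; pose i := index u c.
have it : (i < t)%N by rewrite -sc index_mem.
have uE : u = nth x c i by rewrite nth_index.
have nE : next c u = nth x c (if i.+1 == t then 0 else i.+1).
  rewrite next_nth ucc; case: (c) sc ucc @i it uE => // y0 p sc ucc i it uE.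
  case: eqP => [iS|/eqP iS]; first by rewrite nth_default // -ltnS -/i iS -sc.
  have ip : (i < size p)%N by rewrite -ltnS -[(size p).+1]/(size (y0 :: p)) sc ltn_neqAle iS.
  by rewrite [RHS]/= (set_nth_default x).
rewrite nE in inu *; rewrite uE in iu *; clearbody i; case: eqP => [iS|/eqP iS] in inu *.
  (* At the wrap-around the last index is odd because t is even, so the alternation closes up. *)
  rewrite oddE // ?evenE //; first by rewrite -iS.
  by move: t_even; rewrite -iS /= negbK.
have iSt : (i.+1 < t)%N by rewrite ltn_neqAle iS.
by case: (boolP (ssrnat.odd i)) => oi; [rewrite oddE // evenE //= negbK | rewrite evenE // oddE].
Qed.

Lemma one_s_vertex x y z : tri x y z -> interior_vertex D x -> interior_vertex D y ->
  interior_vertex D z -> (isS x + isS y + isS z = 1)%N.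
Proof.
move=> xyz ix iy iz; case: (boolP (isS x)) => Sx; last by rewrite add0n (link_types xyz).
have nS w : adj D x w -> interior_vertex D w -> isS w = false.
  move=> xw iw; apply/negbTE; have [_ h _] := uniD ix.
  have kx : k_vertex D s x by split=> //; apply/eqP.
  by have [/t_not_S|] := h kx w xw.
have [xzy _ _ _ _] := tri_perm xyz.
by rewrite (nS y) ?(nS z) //; [exact: (tri_adj xzy) | exact: (tri_adj xyz)].
Qed.

End UniformDisc.

Section BallCounts.
Variables (R : realType) (W : finType) (D : scomplex W) (s t : nat) (v : W) (n : nat).
Hypotheses (s_ge6 : (6 <= s)%N) (t_ge6 : (6 <= t)%N) (t_even : ~~ odd t) (st : s <> t).
Hypothesis surfD : triangulated_surface D.
Hypothesis homeoD : homeomorphic_to_set (realization R D) (@closed_disc R).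
Hypothesis uniD : forall u, interior_vertex D u -> st_interior_vertex s t D u.
Hypothesis sv : k_vertex D s v.
Hypotheses (n_gt0 : (0 < n)%N) (nW : (n < #|W|)%N) (complete : sphere_complete D v n).

Let lvl := dist D v.
Let isS : pred W := fun x => #|[pred w | adj D x w]| == s.

Let surf : systolic_surface (triangles D) (edges D).
Proof.
apply: (systolic_disc surfD _ homeoD) => x ix.
by have [[[_ ->]|[_ ->]] _ _] := uniD ix.
Qed.

Let lvl_edge x y : edge (edges D) x y -> (lvl y <= (lvl x).+1)%N.
Proof. by rewrite edgeE; exact: dist_adj. Qed.

Let lvl_pred x : (0 < lvl x)%N -> (lvl x < #|W|)%N ->
  exists2 y, edge (edges D) y x & lvl x = (lvl y).+1.
Proof. by move=> x0 xW; have [y yx e] := dist_pred x0 xW; exists y; rewrite ?edgeE. Qed.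

Let lvl0 x : lvl x = 0%N -> x = v. Proof. exact: dist_eq0. Qed.

Let full x y : (lvl x <= n)%N -> edge (edges D) x y -> #|[set z | tri (triangles D) x y z]| = 2%N.
Proof. by rewrite edgeE => /complete; exact: interior_full. Qed.

Let degree x : (lvl x <= n)%N -> #|[set y | edge (edges D) x y]| = if isS x then s else t.
Proof.
move=> /complete ix; rewrite -(interior_degree uniD ix); apply: eq_card => y.
by rewrite !inE edgeE.
Qed.

Let one_S x y z : tri (triangles D) x y z -> (lvl x <= n)%N -> (lvl y <= n)%N -> (lvl z <= n)%N ->
  (isS x + isS y + isS z = 1)%N.
Proof.
move=> xyz /complete ix /complete iy /complete iz.
exact: (one_s_vertex t_even st uniD xyz ix iy iz).
Qed.

Let isSv : isS v. Proof. by case: sv => _ d; rewrite /isS d. Qed.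

(* The centre is left out: the recursion of the counts holds with value 0, not 1, at k = 0. *)
Let cnt k i : nat := if k is 0 then 0%N else sphere_count lvl isS k i.

Let pairs_mixed k : (k <= n)%N ->
  sphere_pairs (edges D) lvl k (opposite_type isS false) = (4 * cnt k true)%N.
Proof.
case: k => [|k] kn; first by rewrite (sphere_pairs0 surf lvl0).
exact: (sphere_mixed surf lvl_edge lvl_pred lvl0 nW full one_S).
Qed.

Let pairs_total k : (k <= n)%N ->
  (sphere_pairs (edges D) lvl k (opposite_type isS true) + 2 * cnt k true = 2 * cnt k false)%N.
Proof.
case: k => [|k] kn; first by rewrite (sphere_pairs0 surf lvl0).
exact: (sphere_total surf lvl_edge lvl_pred lvl0 nW full one_S).
Qed.

Let rec k i : (k.+2 <= n)%N -> (2 * (if i then s else t) * cnt k.+1 i = 8 * cnt k.+1 i +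
  sphere_pairs (edges D) lvl k (opposite_type isS i) +
  sphere_pairs (edges D) lvl k.+2 (opposite_type isS i))%N.
Proof. exact: (sphere_recursion surf lvl_edge lvl_pred lvl0 nW full degree one_S). Qed.

(** The recursion of h, with the subtractions moved across. *)
Let recS k : (k.+2 <= n)%N ->
  (s * cnt k.+1 true + cnt k true + cnt k.+2 true = 4 * cnt k.+1 true + cnt k false + cnt k.+2 false)%N.
Proof.
move=> kn; have := rec true kn; have := pairs_total kn; have := pairs_total (ltnW (ltnW kn)).
move: (sphere_pairs _ _ k _) (sphere_pairs _ _ k.+2 _) => p q; rewrite -[(2 * _ * _)%N]mulnA.
move: (cnt k true) (cnt k.+2 true) (cnt k false) (cnt k.+2 false) (cnt k.+1 true) (s * _)%N.
by clear; lia.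
Qed.

Let recT k : (k.+2 <= n)%N ->
  (t * cnt k.+1 false = 4 * cnt k.+1 false + 2 * cnt k true + 2 * cnt k.+2 true)%N.
Proof.
move=> kn; have := rec false kn; rewrite !pairs_mixed ?(ltnW (ltnW kn)) // -[(2 * _ * _)%N]mulnA.
by move: (cnt k true) (cnt k.+2 true) (cnt k.+1 false) (t * _)%N; clear; lia.
Qed.

Let cnt_le k : (k <= n)%N -> (cnt k true <= cnt k false)%N.
Proof. by move=> /pairs_total; move: (sphere_pairs _ _ k _) (cnt k true) (cnt k false); clear; lia. Qed.

Let lvl1 x : (lvl x == 1%N) = adj D v x.
Proof.
apply/eqP/idP => [l1|vx].
  have [||y yx ly] := @lvl_pred x; rewrite ?l1 //; first exact: leq_ltn_trans n_gt0 nW.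
  by move: yx; rewrite edgeE (@lvl0 y) //; apply/eqP; rewrite -eqSS -ly l1.
have := dist_adj v vx; rewrite distxx -/(lvl x) leq_eqVlt ltnS leqn0 => /orP[/eqP //|/eqP/lvl0 xv].
by move: vx; rewrite xv /adj eqxx.
Qed.

Let nbr_not_S x : adj D v x -> isS x = false.
Proof.
move=> vx; have lx : (lvl x <= n)%N by have := lvl1 x; rewrite vx => /eqP ->.
have lv : lvl v = 0%N by exact: distxx.
have vx' : edge (edges D) v x by rewrite edgeE.
have : (0 < #|[set z | tri (triangles D) v x z]|)%N by rewrite full // lv.
case/card_gt0P => z; rewrite inE => vxz.
have lz : (lvl z <= n)%N.
  have [vzx _ _ _ _] := tri_perm vxz; have := lvl1 z; rewrite (tri_adj vzx) => /eqP -> //.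
have := one_S vxz _ lx lz; rewrite lv isSv => /(_ isT).
by case: (isS x).
Qed.

(** Initial values: the neighbours of the s-vertex [v] are s in number and, by [one_S], none of them
    is an s-vertex. *)
Let cnt1 : cnt 1 true = 0%N /\ cnt 1 false = s.
Proof.
split; rewrite /cnt /sphere_count.
  apply/eqP; rewrite cards_eq0; apply/eqP/setP => x; rewrite !inE lvl1.
  by case: (boolP (adj D v x)) => //= vx; rewrite nbr_not_S.
have [_ <-] := sv; apply: eq_card => x; rewrite !inE lvl1.
by case: (boolP (adj D v x)) => //= vx; rewrite nbr_not_S.
Qed.

Let count0 : sphere_count lvl isS 0 true = 1%N /\ sphere_count lvl isS 0 false = 0%N.
Proof.
have lv : lvl v = 0%N by exact: distxx.
split.
  apply/eqP/cards1P; exists v; apply/setP => x; rewrite !inE.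
  apply/andP/eqP => [[/eqP/lvl0] //|->]; by rewrite lv isSv.
apply/eqP; rewrite cards_eq0; apply/eqP/setP => x; rewrite !inE.
by apply/negP => /andP[/eqP/lvl0 ->]; rewrite isSv.
Qed.

(** The summand [i] restores the centre, an s-vertex that [cnt] omits. *)
Let ball_count i : #|[set x | (lvl x < n)%N && (isS x == i)]| =
  ((i : nat) + \sum_(k < n) cnt k i)%N.
Proof.
have -> : #|[set x | (lvl x < n)%N && (isS x == i)]| = (\sum_(k < n) sphere_count lvl isS k i)%N.
  rewrite card_set_sum (eq_bigr (fun k : 'I_n => \sum_x (lvl x == k) && (isS x == i)))%N; last first.
    by move=> k _; rewrite /sphere_count card_set_sum.
  rewrite exchange_big /=; apply: eq_bigr => x _; case: (boolP (lvl x < n)%N) => /= [xn|xn].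
    rewrite (bigD1 (Ordinal xn)) //= eqxx big1 ?addn0 // => k /negP h.
    by case: eqP => // e; case: h; apply/eqP/val_inj.
  by rewrite big1 // => k _; case: eqP => // e; rewrite e ltn_ord in xn.
case: (n) n_gt0 => // m _; rewrite !big_ord_recl /= add0n; congr (_ + _)%N.
by have [c1 c2] := count0; case: i.
Qed.

(** The curvatures are 2 - S and 2 - T, so the difference from 2 - P is minus the mean excess of the
    weights S and T over P; the terms outside the sums belong to the centre. *)
Lemma ball_average : exists a b : nat -> R,
  [/\ a 0%N = 0, b 0%N = 0, a 1%N = 0 & b 1%N = s%:R] /\
  [/\ forall k, (k < n)%N -> 0 <= a k /\ a k <= b k,
      forall k, (k.+2 < n)%N -> a k.+2 + a k = (t%:R - 4) / 2 * b k.+1,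
      forall k, (k.+2 < n)%N -> (b k.+2 - a k.+2) + (b k - a k) = (s%:R - 4) * a k.+1 &
      forall P, sphere_avg_curvature D R v n - (2 - P) =
        - (((s%:R - 4 - P) + \sum_(k < n) ((s%:R - 4) * a k + (t%:R - 4) * b k - P * (a k + b k)))
          / (1 + \sum_(k < n) (a k + b k)))].
Proof.
exists (fun k => (cnt k true)%:R), (fun k => (cnt k false)%:R); have [c1 c2] := cnt1.
split; first by rewrite c1 c2.
split.
- by move=> k kn; rewrite ler0n ler_nat cnt_le // ltnW.
- move=> k kn; have := congr1 (fun m => m%:R : R) (recT (ltnW kn)).
  by rewrite !natrD !natrM; lra.
- move=> k kn; have := congr1 (fun m => m%:R : R) (recS (ltnW kn)).
  by rewrite !natrD !natrM; lra.
move=> P.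
pose A := \sum_(k < n) (cnt k true)%:R : R; pose B := \sum_(k < n) (cnt k false)%:R : R.
have ballA : #|[set x | (lvl x < n)%N && (isS x == true)]|%:R = 1 + A :> R.
  by rewrite ball_count natrD natr_sum.
have ballB : #|[set x | (lvl x < n)%N && (isS x == false)]|%:R = B :> R.
  by rewrite ball_count add0n natr_sum.
have curv : sphere_curvature D R v n = (6 - s%:R) * (1 + A) + (6 - t%:R) * B.
  rewrite -ballA -ballB /sphere_curvature.
  rewrite (eq_bigr (fun u => if isS u then 6 - s%:R else 6 - t%:R : R)); last first.
    move=> u un; have iu : interior_vertex D u by apply: complete; rewrite ltnW.
    by rewrite curvature_interior // (interior_degree uniD iu) /isS; case: ifP.
  rewrite (bigID isS) /=; congr (_ + _).
    rewrite (eq_bigr (fun=> 6 - s%:R)) => [|u /andP[_ ->]] //; rewrite sumr_const mulr_natr.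
    by congr (_ *+ _); apply: eq_card => u; rewrite !inE eqb_id.
  rewrite (eq_bigr (fun=> 6 - t%:R)) => [|u /andP[_ /negPf ->]] //; rewrite sumr_const mulr_natr.
  by congr (_ *+ _); apply: eq_card => u; rewrite !inE eqbF_neg.
have card_in : #|inside_sphere D v n|%:R = 1 + A + B :> R.
  rewrite -ballA -ballB -natrD; congr _%:R.
  rewrite -(cardID isS (inside_sphere D v n)); congr (_ + _)%N; apply: eq_card => x.
    by rewrite !inE eqb_id.
  by rewrite !inE eqbF_neg andbC.
have A0 : 0 <= A by apply: sumr_ge0 => k _; rewrite ler0n.
have B0 : 0 <= B by apply: sumr_ge0 => k _; rewrite ler0n.
rewrite /sphere_avg_curvature curv card_in.
have -> : \sum_(k < n) ((cnt k true)%:R + (cnt k false)%:R) = A + B by rewrite big_split.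
have -> : \sum_(k < n) ((s%:R - 4) * (cnt k true)%:R + (t%:R - 4) * (cnt k false)%:R
    - P * ((cnt k true)%:R + (cnt k false)%:R)) = (s%:R - 4) * A + (t%:R - 4) * B - P * (A + B).
  rewrite /A /B -big_split !mulr_sumr /= -big_split -sumrB; apply: eq_bigr => k _ //.
have d0 : 1 + A + B != 0 by rewrite gt_eqF //; lra.
by field; move: d0; rewrite addrA.
Qed.

End BallCounts.

Lemma loop_filling_boundary (R : realType) (V : choiceType) (X : scomplex V) (G : set {fset V})
    (W : finType) (D : scomplex W) (f : W -> V) :
  is_loop X G -> filling_diagram R X G D f -> exists u, boundary_vertex D u.
Proof.
move=> [_ [c [_ sc GE]]] [_ _ _ GD].
have [x xc] : exists x, x \in c by case: c sc {GE} => // x c _; exists x; rewrite inE eqxx.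
have : G [fset x]%fset by rewrite GE; exists x => //; left.
rewrite GD => -[A [/fset0Pn[u uA] [B bB AB]] _]; exists u; split.
  by apply/fset0Pn; exists u; rewrite inE.
exists B => //; apply/fsubsetP => w; rewrite inE => /eqP ->.
exact: (fsubsetP AB).
Qed.

(** * The limit, uniformly over all filling diagrams *)

Theorem theorem3p4 (R : realType) (s t : nat)
    (s_ge6 : (6 <= s)%N) (t_ge6 : (6 <= t)%N) (t_even : ~~ odd t)
    (st_neq : (s, t) <> (6, 6)%N)
    (V : choiceType) (X : scomplex V) (X_uniform : st_uniform R X s t) :
  forall eps : R, 0 < eps ->
  exists N : nat, (1 <= N)%N /\
  forall (G : set {fset V}) (W : finType) (D : scomplex W) (f : W -> V),
    is_loop X G -> minimal_filling R X G D f ->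
  forall v : W, k_vertex D s v ->
  forall n : nat, (N <= n)%N -> sphere_complete D v n ->
    `|sphere_avg_curvature D R v n - (2 - Pst R s t)| < eps.
Proof.
move=> eps eps0; have [_ _ uni] := X_uniform.
have s6 : (6 : R) <= s%:R by rewrite (ler_nat R 6).
have t6 : (6 : R) <= t%:R by rewrite (ler_nat R 6).
have [st|/eqP st] := eqVneq s t.
  exists 1%N; split=> // G W D f loopG minD v sv n n1 compl.
  have [[[surfD _] _ _ _] _] := minD.
  have deg u : (dist D v u <= n)%N -> #|[pred w | adj D u w]| = t.
    by move=> /compl iu; have [_ /(_ st)[]] := uni G W D f loopG minD u iu.
  have in_gt0 : (0 < #|inside_sphere D v n|)%N.
    by apply/card_gt0P; exists v; rewrite inE distxx.
  suff -> : sphere_avg_curvature D R v n = 2 - Pst R s t by rewrite subrr normr0.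
  rewrite /sphere_avg_curvature /sphere_curvature (eq_bigr (fun=> 6 - t%:R)); last first.
    move=> u un; have un' := ltnW un.
    by rewrite curvature_interior ?deg //; exact: compl.
  rewrite sumr_const -[X in X / _]mulr_natr mulfK; last by rewrite pnatr_eq0 -lt0n.
  (* Here S = T, the radicand is (3 T)^2 and P = T, so 2 - P is the common curvature 6 - t. *)
  rewrite /Pst st (_ : _ + 8 * _ * _ = (3 * (t%:R - 4)) ^+ 2); last by ring.
  by rewrite sqrtr_sqr ger0_norm; [field | lra].
have S2 : 2 <= s%:R - 4 :> R by lra.
have T2 : 2 <= t%:R - 4 :> R by lra.
have ST : 4 < (s%:R - 4) + (t%:R - 4) :> R.
  have : ((12 : nat)%:R : R) < (s + t)%:R by rewrite ltr_nat; move: st s_ge6 t_ge6; clear; lia.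
  by rewrite natrD; lra.
have s0 : 0 < s%:R :> R by lra.
have [N HN] := average_limit S2 T2 ST s0 eps0.
exists N.+1; split=> // G W D f loopG minD v sv n nN compl.
have [[discD _ _ _] _] := minD; have [surfD homeoD] := discD.
have uniD u : interior_vertex D u -> st_interior_vertex s t D u.
  by move=> iu; have [h _] := uni G W D f loopG minD u iu; exact: h.
(* No distance exceeds [#|W|], so a complete sphere of radius at least [#|W|] would make every
   vertex interior, against the boundary vertex that the loop provides. *)
have nW : (n < #|W|)%N.
  have [u bu] := loop_filling_boundary loopG minD.1.
  rewrite ltnNge; apply/negP => Wn; apply: (compl u) => //.
  exact: leq_trans (dist_le D v u) Wn.
have n0 : (0 < n)%N := leq_ltn_trans (leq0n N) nN.
have [a [b [[a0 b0 a1 b1] [pos reca rech avg]]]] :=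
  ball_average s_ge6 t_ge6 t_even st surfD homeoD uniD sv n0 nW compl.
by rewrite avg normrN; apply: HN => //; exact: ltnW.
Qed.
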